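(* Let $U$ be a balanced open subset of a complex Banach space $E$ with the approximation property. Then $M_b(U)=\delta(U)$ if and only if $U$ is $H_b(U)$-convex and $E$ is a Tsirelson-like space.
   Context: Balanced sets are understood to be nonempty. A set $A\subset U$ is $U$-bounded if it is bounded and has positive distance to $E\setminus U$ (no distance condition if $U=E$). $H_b(U)$ is the Fréchet algebra of holomorphic functions on $U$ bounded on every $U$-bounded set, with the topology of uniform convergence on $U$-bounded sets. $M_b(U)$ is the set of all nonzero continuous linear multiplicative functionals on $H_b(U)$, and $\delta(U)=\{\delta_x:x\in U\}$ with $\delta_x(f)=f(x)$. $U$ is $H_b(U)$-convex if for every $U$-bounded set $A$ the set $\widehat A_{H_b(U)}=\{x\in U:|f(x)|\le\sup_A|f|\ \forall f\in H_b(U)\}$ is $U$-bounded. A Tsirelson-like space is a reflexive Banach space on which every continuous polynomial is approximable, i.e. a norm limit (uniformly on the unit ball) of finite type polynomials; finite type polynomials are the elements of the algebra generated by the constants and $E'$. *)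

(* Defs.v *)
(* The scalar field is [R[i]] for [R : realType]; the
   regular module [R[i]^o] is used wherever the complex numbers are the target
   of a function, because this is the type carrying the library's normed-module
   structure.  Norms therefore take values in [R[i]], where [0 < x] and [x <= y]
   entail that [x], resp. [y - x], is real. *)
From HB Require Import structures.
From mathcomp Require Import all_boot all_order all_algebra.
From mathcomp Require Import complex.
From mathcomp Require Import all_classical all_reals all_analysis.

Set Implicit Arguments.
Unset Strict Implicit.
Unset Printing Implicit Defensive.

Import Order.TTheory GRing.Theory Num.Theory.
Import numFieldNormedType.Exports.

Local Open Scope classical_set_scope.
Local Open Scope ring_scope.

Section dual.
Context {R : realType} (E : normedModType R[i]).

Definition dual_pred : {pred E -> R[i]^o} :=
  fun f => `[< linear f /\ continuous f >].

Lemma dual_pred_submod : submod_closed dual_pred.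
Proof.
split=> [|k f g /asboolP[lf cf] /asboolP[lg cg]]; apply/asboolP; split.
- by move=> a x y; rewrite /= scaler0 addr0.
- exact: cst_continuous.
- move=> a x y; have kfgE (z : E) : (k *: f + g) z = k *: f z + g z by [].
  by rewrite !kfgE lf lg !scalerDr !scalerA [k * a]mulrC addrACA.
- move=> x; have -> : (k *: f + g) = (fun z => k *: f z + g z) by [].
  by apply: cvgD; [apply: cvgZr; exact: cf|exact: cg].
Qed.

HB.instance Definition _ :=
  GRing.isSubmodClosed.Build R[i] (E -> R[i]^o) dual_pred dual_pred_submod.

Record dual := Dual { dual_val :> E -> R[i]^o ; _ : dual_val \in dual_pred }.

HB.instance Definition _ := [isSub for dual_val].
HB.instance Definition _ := [Choice of dual by <:].
HB.instance Definition _ := [SubChoice_isSubLmodule of dual by <:].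

(* The norm topology of the dual: uniform convergence on the unit ball. *)
Definition dual_to_uniform (f : dual) :
  {uniform` [set x : E | `|x| <= 1] -> R[i]^o} := f.

HB.instance Definition _ :=
  Topological.copy dual (initial_topology dual_to_uniform).

Definition reflexive_space :=
  forall Phi : {linear dual -> R[i]^o}, continuous Phi ->
    exists x : E, forall f : dual, Phi f = f x.

Definition finite_rank (T : E -> E) :=
  exists (n : nat) (e : 'I_n -> E),
    forall x, exists c : 'I_n -> R[i], T x = \sum_(i < n) c i *: e i.

Definition approximation_property :=
  forall K : set E, compact K -> forall eps : R[i], 0 < eps ->
    exists T : {linear E -> E}, [/\ continuous T, finite_rank T &
      forall x, K x -> `|T x - x| <= eps].

Definition multilinear n (A : ('I_n -> E) -> R[i]^o) :=
  forall (v : 'I_n -> E) (i : 'I_n), linear (fun x : E => A (@dfwith 'I_n (fun=> E) v i x)).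

(* A finite sum of [k]-homogeneous polynomials [x |-> A_k (x, .., x)] with [A_k]
   an algebraic [k]-linear form, the sum being continuous. *)
Definition continuous_polynomial (P : E -> R[i]^o) :=
  continuous P /\
  exists (n : nat) (A : forall k : 'I_n.+1, ('I_k -> E) -> R[i]^o),
    (forall k, multilinear (A k)) /\
    (forall x, P x = \sum_(k < n.+1) A k (fun=> x)).

Inductive finite_type_polynomial : (E -> R[i]^o) -> Prop :=
| finite_type_cst (c : R[i]^o) : finite_type_polynomial (cst c)
| finite_type_dual (f : dual) : finite_type_polynomial f
| finite_type_add P Q : finite_type_polynomial P -> finite_type_polynomial Q ->
    finite_type_polynomial (P + Q)
| finite_type_mul P Q : finite_type_polynomial P -> finite_type_polynomial Q ->
    finite_type_polynomial (P * Q).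

Definition approximable (P : E -> R[i]^o) :=
  forall eps : R[i], 0 < eps -> exists2 Q, finite_type_polynomial Q &
    forall x : E, `|x| <= 1 -> `|P x - Q x| <= eps.

Definition Tsirelson_like :=
  reflexive_space /\ forall P, continuous_polynomial P -> approximable P.

Definition balanced_set (U : set E) :=
  U !=set0 /\ forall (l : R[i]) x, `|l| <= 1 -> U x -> U (l *: x).

End dual.

(* Functions on [U] and subsets of [U] are taken on the subtype of [E]
   associated with [U]. *)
Section Hb.
Context {R : realType} {E : normedModType R[i]}.
Implicit Types U : set E.

(* For [U = setT] the distance condition is vacuous. *)
Definition U_bounded U (A : set U) :=
  [bounded val a | a in A] /\
  exists2 d : R[i], 0 < d &
    forall (a : U) (y : E), A a -> ~ U y -> d <= `|val a - y|.

(* Complex Frechet differentiability at every point of [U]; as [U] will be open,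
   the value given to the extension ['valL_0 f] outside [U] is irrelevant. *)
Definition holomorphic U (f : U -> R[i]^o) :=
  forall x : U, differentiable ('valL_(0 : R[i]^o) f) (val x).

Definition Hb_pred U : {pred U -> R[i]^o} :=
  fun f => `[< holomorphic f /\
               forall A : set U, U_bounded A -> [bounded f x | x in A] >].

Lemma valL0D U (f g : U -> R[i]^o) :
  'valL_0 (f + g) = 'valL_0 f + 'valL_0 g :> (E -> R[i]^o).
Proof.
apply/funext => x; rewrite [RHS]/(_ x + _ x) /valL_ /=.
by case: ('oinv_ _ _) => [u|] //=; rewrite addr0.
Qed.

Lemma valL0M U (f g : U -> R[i]^o) :
  'valL_0 (f * g) = 'valL_0 f * 'valL_0 g :> (E -> R[i]^o).
Proof.
apply/funext => x.
rewrite [RHS]/('valL_0 f x * 'valL_0 g x) /valL_ /comp.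
case: ('oinv_ _ _) => [u|]; first by [].
by apply/esym; exact: (mulr0 (0 : R[i])).
Qed.

Lemma valL0Z U k (f : U -> R[i]^o) :
  'valL_0 (k *: f) = k *: 'valL_0 f :> (E -> R[i]^o).
Proof.
apply/funext => x.
rewrite [RHS]/(k *: 'valL_0 f x) /valL_ /comp.
case: ('oinv_ _ _) => [u|]; first by [].
by apply/esym; exact: (mulr0 (k : R[i])).
Qed.

Let bounded_le (T : Type) (f : T -> R[i]^o) (A : set T) (M : R[i]) :
  0 <= M -> (forall x, A x -> `|f x| <= M) -> [bounded f x | x in A].
Proof.
move=> M0 fM; exists M; split; first exact: ger0_real.
by move=> N /ltW MN x /fM /le_trans; exact.
Qed.

Lemma Hb_pred_submod U : submod_closed (@Hb_pred U).
Proof.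
split=> [|k f g /asboolP[hf bf] /asboolP[hg bg]]; apply/asboolP; split.
- move=> x; suff -> : 'valL_0 (0 : U -> R[i]^o) = cst (0 : R[i]^o) :> (E -> _).
    exact: differentiable_cst.
  by apply/funext => y; rewrite /valL_ /=; case: ('oinv_ _ _).
- by move=> A _; exact: bounded_cst.
- move=> x; rewrite valL0D valL0Z; apply: differentiableD; last exact: hg.
  by apply: differentiableZ; exact: hf.
- move=> A bA; have [M M0 fM] := pinfty_ex_gt0 (bf A bA).
  have [N N0 gN] := pinfty_ex_gt0 (bg A bA).
  apply: (@bounded_le _ _ A (`|k| * M + N)) => [|x Ax].
    by rewrite addr_ge0 ?mulr_ge0// ltW.
  have -> : (k *: f + g) x = k *: f x + g x by [].
  by rewrite (le_trans (ler_normD _ _))// lerD ?normrZ ?ler_wpM2l ?fM ?gN.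
Qed.

HB.instance Definition _ U :=
  GRing.isSubmodClosed.Build R[i] (U -> R[i]^o) (@Hb_pred U) (@Hb_pred_submod U).

Lemma Hb_pred_mul U (f g : U -> R[i]^o) :
  f \in @Hb_pred U -> g \in @Hb_pred U -> f * g \in @Hb_pred U.
Proof.
move=> /asboolP[hf bf] /asboolP[hg bg]; apply/asboolP; split => [x|A bA].
  by rewrite valL0M; apply: differentiableM; [exact: hf|exact: hg].
have [M M0 fM] := pinfty_ex_gt0 (bf A bA).
have [N N0 gN] := pinfty_ex_gt0 (bg A bA).
apply: (@bounded_le _ _ A (M * N)) => [|x Ax].
  by rewrite mulr_ge0// ltW.
have -> : (f * g) x = f x * g x by [].
by rewrite normrM ler_pM ?fM ?gN.
Qed.

Record Hb U := MkHb { Hb_val :> U -> R[i]^o ; Hb_valP : Hb_val \in @Hb_pred U }.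

HB.instance Definition _ U := [isSub for @Hb_val U].
HB.instance Definition _ U := [Choice of Hb U by <:].
HB.instance Definition _ U := [SubChoice_isSubLmodule of Hb U by <:].

Definition Hb_mul U (f g : Hb U) : Hb U :=
  MkHb (Hb_pred_mul (Hb_valP f) (Hb_valP g)).

(* Uniform convergence on [U]-bounded sets. *)
Definition Hb_to_family U (f : Hb U) :
  {family @U_bounded U, U -> R[i]^o} := Hb_val f.

HB.instance Definition _ U :=
  Topological.copy (Hb U) (initial_topology (@Hb_to_family U)).

Definition Mb U : set (Hb U -> R[i]^o) :=
  [set phi : Hb U -> R[i]^o |
   [/\ linear phi,
      forall f g, phi (Hb_mul f g) = phi f * phi g,
      continuous phi &
      exists f, phi f != 0]].

Definition delta U : set (Hb U -> R[i]^o) :=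
  range (fun (x : U) (f : Hb U) => f x).

(* [Normc.normc] is the modulus with values in [R].  The functions of [Hb U] are
   bounded on [U]-bounded sets, so [sup] is a genuine supremum there; for
   [A = set0] it is [0], and the hull is empty because of the constant [1]. *)
Definition Hb_hull U (A : set U) : set U :=
  [set x | forall f : Hb U,
     Normc.normc (f x) <= sup [set Normc.normc (f a) | a in A]].

Definition Hb_convex U :=
  forall A : set U, U_bounded A -> U_bounded (Hb_hull A).

End Hb.

Arguments Mb {R E} U.
Arguments delta {R E} U.

(* Main.v *)
From HB Require Import structures.
Require Import Defs.
From mathcomp Require Import all_boot all_order all_algebra.
From mathcomp Require Import complex.
From mathcomp Require Import all_classical all_reals all_analysis.
From mathcomp Require Import ring lra.

Set Implicit Arguments.
Unset Strict Implicit.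
Unset Printing Implicit Defensive.

Import Order.TTheory GRing.Theory Num.Theory.
Import numFieldNormedType.Exports.

Local Open Scope classical_set_scope.
Local Open Scope ring_scope.

(** A character phi of H_b(U) is dominated by the supremum over some U-bounded set
A: continuity gives this up to a constant, and powers f^m remove the constant
(Mb_dominated).  As U is balanced, Taylor expansion at the origin shows that continuous polynomials
are dense for uniform convergence on U-bounded sets (polynomial_dense), so phi
is determined by its values on polynomials.

Suppose first that U is H_b(U)-convex and that E is Tsirelson-like.  By
reflexivity phi coincides on the dual of E with the evaluation at a point x, and
because polynomials are approximable phi (P) = P (x) for every continuous
polynomial P.  The point x lies in U: when t x is in U for some t in [0, 1], it
belongs to the hull of the balanced hull of A, hence is at distance at least d
from the complement of U, with d independent of t; so one can walk from 0 to x
by steps shorter than d.  By density phi is the evaluation at x (Mb_delta).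

Suppose conversely that all characters are evaluations.  The limit, along an
ultrafilter, of evaluations at points that stay in a U-bounded set is a
character (ultra_point).  Hence bounded families of E have weak limits and
entire functions of bounded type follow these limits (ultra_weak_limit).
- Goldstine's theorem then makes E reflexive (characters_reflexive).
- If x is in the hull of A and z is shorter than the distance from A to the
  complement of U, then P |-> P (x + z) is dominated by the supremum over A + z;
  it extends to a character, which must be the evaluation at x + z, so x + z is
  in U (characters_hull_shift).  Thus the hull of A is as far from the complement
  of U as A is.
- A homogeneous polynomial P of degree n satisfies Euler's identity
  n P (x) = D_x P (x).  The differentials of P at the points of the unit ball
  form a totally bounded subset of the dual, because the values of P follow weak
  limits (differentials_totally_bounded).  On such a set the identity of E is
  approximated by finite rank operators S = sum_i f_i (.) e_i
  (totally_bounded_approx), so that n P (x) is close to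
  D_(S x) P (x) = sum_i f_i (x) D_(e_i) P (x), where D_(e_i) P has degree n - 1.
  By induction P is approximable (homog_approximable).

The operator S comes from trace duality: a functional separating the identity
from the finite rank operators would, by reflexivity, be a trace
T |-> sum_i z_i (T x_i) with sum_i |x_i| <= 1 and z_i tending to 0, which the
approximation property of E excludes (null_family_approx).

Complex analysis is used through Cauchy's estimates for functions on the disc
that are only assumed complex differentiable.  They rest on Goursat's theorem
for polar rectangles (goursat, coef_bound); Banach space versions follow by
restriction to complex lines, together with the holomorphy of directional
derivatives (D_holo), on which Taylor expansions depend. *)

(** * Goursat's theorem for closed forms on a rectangle *)

Section integral.
Context {R : realType}.
Implicit Types (a b : R) (g : R -> R).
Local Notation mu := (@lebesgue_measure R).

Definition itg a b g : R := (\int[mu]_(x in `[a, b]) g x)%R.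

Definition cts_on a b g := forall x, a <= x <= b -> forall e, 0 < e ->
  exists2 d, 0 < d & forall y, a <= y <= b -> `|y - x| < d -> `|g y - g x| <= e.

Lemma cts_onW a b c d g : a <= c -> d <= b -> cts_on a b g -> cts_on c d g.
Proof.
move=> ac db cg x /andP[cx xd] e e0.
have [|r r0 gr] := cg x _ e e0; first by lra.
by exists r => // y /andP[cy yd]; apply: gr; lra.
Qed.

Lemma cts_onB a b g h : cts_on a b g -> cts_on a b h ->
  cts_on a b (fun x => g x - h x).
Proof.
move=> cg ch x xab e e0; have e20 : 0 < e / 2 by lra.
have [r r0 gr] := cg x xab _ e20; have [s s0 hs] := ch x xab _ e20.
exists (Num.min r s) => [|y yab]; first by rewrite lt_min r0.
rewrite lt_min => /andP[/(gr y yab) + /(hs y yab)].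
by rewrite !ler_norml => /andP[? ?] /andP[? ?]; lra.
Qed.

Lemma cts_on_integrable a b g : cts_on a b g ->
  mu.-integrable `[a, b] (EFin \o g).
Proof.
move=> cg; apply: continuous_compact_integrable; first exact: segment_compact.
apply/subspace_continuousP => x; rewrite /= in_itv /= => xab.
apply/cvgrPdist_le => e e0; have [d d0 gd] := cg x xab e e0.
near=> y; rewrite distrC; apply: gd.
  have : `[a, b]%classic y by near: y; exact: withinT.
  by rewrite /= in_itv.
near: y; apply: cvg_within; exists d => //= z /=.
by rewrite distrC.
Unshelve. all: by end_near. Qed.

Lemma itg_split a m b g : a <= m <= b -> cts_on a b g ->
  itg a b g = itg a m g + itg m b g.
Proof.
move=> /andP[am mb] /cts_on_integrable ig; rewrite /itg.
have := @Rintegral_itvB R g (BLeft a) (BRight b) m ig.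
rewrite !bnd_simp => /(_ am mb); rewrite Rintegral_itv_obnd_cbnd; last first.
  by apply: integrableS ig => //; apply: subset_itvr; rewrite bnd_simp.
by move=> <-; rewrite addrC subrK.
Qed.

Lemma itgB a b g h : cts_on a b g -> cts_on a b h ->
  itg a b (fun x => g x - h x) = itg a b g - itg a b h.
Proof.
by move=> /cts_on_integrable ig /cts_on_integrable ih; exact: RintegralB.
Qed.

Lemma itg_cst a b (k : R) : a <= b -> itg a b (fun=> k) = k * (b - a).
Proof.
move=> ab; rewrite /itg Rintegral_cst//=; congr (_ * _).
by rewrite lebesgue_measure_itv/= lte_fin; case: ltrP => //= ba; lra.
Qed.

Lemma cts_on_cst a b (k : R) : cts_on a b (fun=> k).
Proof. by move=> x _ e e0; exists 1 => // y _ _; rewrite subrr normr0 ltW. Qed.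

Lemma le_itg a b g h : cts_on a b g -> cts_on a b h ->
  (forall x, a <= x <= b -> g x <= h x) -> itg a b g <= itg a b h.
Proof.
move=> /cts_on_integrable ig /cts_on_integrable ih gh; exact: le_Rintegral.
Qed.

Lemma eq_itg a b g h : (forall x, a <= x <= b -> g x = h x) ->
  itg a b g = itg a b h.
Proof.
move=> gh; apply: eq_Rintegral => x; rewrite inE /= in_itv /=; exact: gh.
Qed.

Lemma itgZ a b (k : R) g : cts_on a b g -> itg a b (fun x => k * g x) = k * itg a b g.
Proof. by move=> /cts_on_integrable ig; exact: RintegralZl. Qed.

Lemma itg_dist a b g (k M : R) : a <= b -> cts_on a b g ->
  (forall x, a <= x <= b -> `|g x - k| <= M) ->
  `|itg a b g - k * (b - a)| <= M * (b - a).
Proof.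
move=> ab cg gk; rewrite ler_norml; apply/andP; split.
  have : itg a b (fun=> k - M) <= itg a b g.
    apply: le_itg => // [|x /gk]; first exact: cts_on_cst.
    by rewrite ler_norml => /andP[? ?]; lra.
  rewrite itg_cst //; nra.
have : itg a b g <= itg a b (fun=> k + M).
  apply: le_itg => // [|x /gk]; first exact: cts_on_cst.
  by rewrite ler_norml => /andP[? ?]; lra.
rewrite itg_cst //; nra.
Qed.

End integral.

Section estimates.
Context {R : realType}.
Implicit Types (a b c d e s t u v x : R).

Lemma bisect_axis a d x s c u : 0 <= u <= s * c -> a <= x -> x + (s + s) * c <= d ->
  [/\ a <= x + u, x + u + s * c <= d, x <= x + u & x + u + s * c <= x + (s + s) * c].
Proof. by move=> /andP[? ?] ? ?; split; lra. Qed.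

Lemma ler_norm_sum4 a b c d e : `|a| <= e -> `|b| <= e -> `|c| <= e -> `|d| <= e ->
  `|a + b + c + d| <= 4 * e.
Proof.
rewrite !ler_norml => /andP[? ?] /andP[? ?] /andP[? ?] /andP[? ?].
by apply/andP; split; lra.
Qed.

Lemma ler_dist2 a b c u v x e : `|a - x - u| <= e -> `|b - x - v| <= e -> u - v = c ->
  `|a - b - c| <= 2 * e.
Proof.
by rewrite !ler_norml => /andP[? ?] /andP[? ?] <-; apply/andP; split; lra.
Qed.

Lemma ler_dist_segment x d u v : x <= u <= x + d -> x <= v <= x + d -> `|u - v| <= d.
Proof. by move=> /andP[? ?] /andP[? ?]; rewrite ler_norml; apply/andP; split; lra. Qed.

End estimates.

Section goursat.
Context {R : realType}.
Variables (p q : R -> R -> R) (A B w h : R).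
Hypotheses (w0 : 0 < w) (h0 : 0 < h).

(** The crossed partial derivatives of p dx + q dy at (x0, y0) share the value k:
the form is closed at that point, in the sense of differentials taken within
the rectangle. *)
Definition closed_at (x0 y0 : R) := exists a k b : R, forall e, 0 < e ->
  exists2 d, 0 < d & forall x y, A <= x <= A + w -> B <= y <= B + h ->
    `|x - x0| <= d -> `|y - y0| <= d ->
    `|p x y - p x0 y0 - (a * (x - x0) + k * (y - y0))|
       <= e * (`|x - x0| + `|y - y0|) /\
    `|q x y - q x0 y0 - (k * (x - x0) + b * (y - y0))|
       <= e * (`|x - x0| + `|y - y0|).

Hypothesis pq : forall x0 y0, A <= x0 <= A + w -> B <= y0 <= B + h ->
  closed_at x0 y0.

Lemma closed_cts_p y : B <= y <= B + h -> cts_on A (A + w) (p^~ y).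
Proof.
move=> yB x xA e e0; have [a [k [b pe]]] := pq xA yB.
have [d d0 pd] := pe 1 ltr01.
pose N := `|a| + 1; have N0 : 0 < N by rewrite ltr_wpDl.
exists (Num.min d (e / N)) => [|z zA]; first by rewrite lt_min d0 divr_gt0.
rewrite lt_min => /andP[zd ze].
have [] := pd z y zA yB (ltW zd); first by rewrite subrr normr0 ltW.
rewrite !subrr !mulr0 !addr0 normr0 addr0 mul1r => pz _.
have := ler_normD (p z y - p x y - a * (z - x)) (a * (z - x)).
rewrite subrK => /le_trans; apply; rewrite normrM.
move: ze; rewrite ltr_pdivlMr // /N => ze; nra.
Qed.

Lemma closed_cts_q x : A <= x <= A + w -> cts_on B (B + h) (q x).
Proof.
move=> xA y yB e e0; have [a [k [b pe]]] := pq xA yB.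
have [d d0 pd] := pe 1 ltr01.
pose N := `|b| + 1; have N0 : 0 < N by rewrite ltr_wpDl.
exists (Num.min d (e / N)) => [|z zB]; first by rewrite lt_min d0 divr_gt0.
rewrite lt_min => /andP[zd ze].
have [||_] := pd x z xA zB; [by rewrite subrr normr0 ltW|exact: ltW|].
rewrite !subrr !mulr0 normr0 !add0r mul1r => qz.
have := ler_normD (q x z - q x y - b * (z - y)) (b * (z - y)).
rewrite subrK => /le_trans; apply; rewrite normrM.
move: ze; rewrite ltr_pdivlMr // /N => ze; nra.
Qed.

(** The circulation along the boundary of the rectangle with corner (x, y) and
sides s w and s h. *)
Let mu x y s := itg y (y + s * h) (fun t => q (x + s * w) t - q x t) -
  itg x (x + s * w) (fun t => p t (y + s * h) - p t y).

Let inr x y s := [/\ 0 < s, A <= x, B <= y, x + s * w <= A + w & y + s * h <= B + h].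

Let mu_split x y s : inr x y (s + s) ->
  mu x y (s + s) = mu x y s + mu (x + s * w) y s + mu x (y + s * h) s +
     mu (x + s * w) (y + s * h) s.
Proof.
move=> [s0 Ax By xA yB]; have sw0 : 0 < s * w by rewrite mulr_gt0 //; lra.
have sh0 : 0 < s * h by rewrite mulr_gt0 //; lra.
rewrite /mu; rewrite !mulrDl in xA yB *.
have cp z c d : B <= z <= B + h -> A <= c -> d <= A + w -> cts_on c d (p^~ z).
  by move=> zB Ac dA; apply: cts_onW (closed_cts_p zB).
have cq z c d : A <= z <= A + w -> B <= c -> d <= B + h -> cts_on c d (q z).
  by move=> zB Ac dA; apply: cts_onW (closed_cts_q zB).
rewrite !addrA in xA yB *.
have x1 : x <= x + s * w by rewrite lerDl ltW.
have x2 : x + s * w <= x + s * w + s * w by rewrite lerDl ltW.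
have y1 : y <= y + s * h by rewrite lerDl ltW.
have y2 : y + s * h <= y + s * h + s * h by rewrite lerDl ltW.
have Ax1 := le_trans Ax x1; have x1A := le_trans x2 xA.
have By1 := le_trans By y1; have y1B := le_trans y2 yB.
have hx0 : A <= x <= A + w by rewrite Ax (le_trans x1).
have hx1 : A <= x + s * w <= A + w by rewrite Ax1.
have hx2 : A <= x + s * w + s * w <= A + w by rewrite xA (le_trans Ax1).
have hy0 : B <= y <= B + h by rewrite By (le_trans y1).
have hy1 : B <= y + s * h <= B + h by rewrite By1.
have hy2 : B <= y + s * h + s * h <= B + h by rewrite yB (le_trans By1).
have sx : x <= x + s * w <= x + s * w + s * w by rewrite x1.
have sy : y <= y + s * h <= y + s * h + s * h by rewrite y1.
rewrite !itgB; do ?[by apply: cp | by apply: cq].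
rewrite (@itg_split _ y (y + s * h) (y + s * h + s * h) (q (x + s * w + s * w)) sy);
  last exact: cq.
rewrite (@itg_split _ y (y + s * h) (y + s * h + s * h) (q x) sy); last exact: cq.
rewrite (@itg_split _ x (x + s * w) (x + s * w + s * w) (p^~ (y + s * h + s * h)) sx);
  last exact: cp.
rewrite (@itg_split _ x (x + s * w) (x + s * w + s * w) (p^~ y) sx); last exact: cp.
ring.
Qed.

Let half n : R := 2^-1 ^+ n.

(** Near (x0, y0) the form is closed with affine coefficients up to o(s), and the
boundary has length O(s); closed affine forms have circulation 0. *)
Lemma goursat_small e x0 y0 : 0 < e -> A <= x0 <= A + w -> B <= y0 <= B + h ->
  exists2 d, 0 < d & forall x y s, inr x y s -> s < d ->
   x <= x0 <= x + s * w -> y <= y0 <= y + s * h -> `|mu x y s| <= e * s ^+ 2.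
Proof.
move=> e0 xA yB; have [a [k [b pe]]] := pq xA yB.
pose N := 4 * (w + h) ^+ 2; have N0 : 0 < N by rewrite /N mulr_gt0 // exprn_gt0 // addr_gt0.
have [d d0 pd] := pe (e / N) (divr_gt0 e0 N0).
exists (d / (w + h)) => [|x y s [s0 Ax By xsA ysB]].
  by rewrite divr_gt0 // addr_gt0.
rewrite ltr_pdivlMr ?addr_gt0 // => sd xx yy.
have sw0 : 0 < s * w by rewrite mulr_gt0.
have sh0 : 0 < s * h by rewrite mulr_gt0.
have eN : 0 < e / N by rewrite divr_gt0.
have swd : s * w <= d.
  by apply: le_trans (ltW sd); rewrite mulrDr lerDl ltW.
have shd : s * h <= d.
  by apply: le_trans (ltW sd); rewrite mulrDr lerDr ltW.
pose D := s * (w + h).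
have D0 : 0 < D by rewrite /D mulr_gt0 // addr_gt0.
have est u v : x <= u <= x + s * w -> y <= v <= y + s * h ->
   `|p u v - p x0 y0 - (a * (u - x0) + k * (v - y0))| <= e / N * D /\
   `|q u v - q x0 y0 - (k * (u - x0) + b * (v - y0))| <= e / N * D.
  move=> ux vy.
  have ud := ler_dist_segment ux xx; have vd := ler_dist_segment vy yy.
  case/andP: ux => ux1 ux2; case/andP: vy => vy1 vy2.
  have uA : A <= u <= A + w by rewrite (le_trans Ax) // (le_trans ux2).
  have vB : B <= v <= B + h by rewrite (le_trans By) // (le_trans vy2).
  have [p1 p2] := pd u v uA vB (le_trans ud swd) (le_trans vd shd).
  have E : e / N * (`|u - x0| + `|v - y0|) <= e / N * D.
    by rewrite ler_pM2l // /D mulrDr lerD.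
  by split; [exact: le_trans p1 E | exact: le_trans p2 E].
have e2 : 0 < e / N * D by rewrite mulr_gt0.
have xs : x <= x + s * w by rewrite lerDl ltW.
have ys : y <= y + s * h by rewrite lerDl ltW.
have sx0 : x <= x <= x + s * w by rewrite lexx.
have sx1 : x <= x + s * w <= x + s * w by rewrite xs lexx.
have sy0 : y <= y <= y + s * h by rewrite lexx.
have sy1 : y <= y + s * h <= y + s * h by rewrite ys lexx.
have xA0 : A <= x <= A + w by rewrite Ax (le_trans xs).
have xA1 : A <= x + s * w <= A + w by rewrite xsA (le_trans Ax).
have yB0 : B <= y <= B + h by rewrite By (le_trans ys).
have yB1 : B <= y + s * h <= B + h by rewrite ysB (le_trans By).
have m1 : `|itg y (y + s * h) (fun t => q (x + s * w) t - q x t) -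
    k * (s * w) * (y + s * h - y)| <= 2 * (e / N * D) * (y + s * h - y).
  apply: itg_dist => //.
    by apply: cts_onB; apply: (cts_onW By ysB); exact: closed_cts_q.
  move=> t ty; have [_ e1] := est (x + s * w) t sx1 ty; have [_ e2'] := est x t sx0 ty.
  by apply: (ler_dist2 e1 e2'); ring.
have m2 : `|itg x (x + s * w) (fun t => p t (y + s * h) - p t y) -
    k * (s * h) * (x + s * w - x)| <= 2 * (e / N * D) * (x + s * w - x).
  apply: itg_dist => //.
    by apply: cts_onB; apply: (cts_onW Ax xsA); exact: closed_cts_p.
  move=> t tx; have [e1 _] := est t (y + s * h) tx sy1; have [e2' _] := est t y tx sy0.
  by apply: (ler_dist2 e1 e2'); ring.
have -> : e * s ^+ 2 = 4 * (e / N * D) * D.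
  by rewrite /D /N; field; rewrite gt_eqF // addr_gt0.
have yE : y + s * h - y = s * h by rewrite addrAC subrr add0r.
have xE : x + s * w - x = s * w by rewrite addrAC subrr add0r.
rewrite yE in m1; rewrite xE in m2; rewrite /mu.
rewrite (_ : _ - _ = (itg y (y + s * h) (fun t => q (x + s * w) t - q x t) -
    k * (s * w) * (s * h)) - (itg x (x + s * w) (fun t => p t (y + s * h) - p t y) -
    k * (s * h) * (s * w))); last by ring.
apply: le_trans (ler_normB _ _) _; apply: le_trans (lerD m1 m2) _.
rewrite -mulrDr -mulrDr [h + w]addrC -/D ler_wpM2r ?(ltW D0) // ler_wpM2r ?(ltW e2) //.
by rewrite ler_nat.
Qed.

(** Bisection: a quarter of a rectangle with large circulation, relative to its
area, has large circulation too, and goursat_small fails at the point to which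
the rectangles shrink. *)
Lemma goursat_mu0 : mu A B 1 = 0.
Proof.
apply/eqP; case: eqP => // /eqP; rewrite -normr_gt0 => mupos.
pose e := `|mu A B 1| / 2; have e0 : 0 < e by rewrite /e; lra.
pose bad n (z : R * R) := inr z.1 z.2 (half n) /\ e * half n ^+ 2 < `|mu z.1 z.2 (half n)|.
have halfS n : half n = half n.+1 + half n.+1 by rewrite /half exprS; lra.
have half0 n : 0 < half n by rewrite /half exprn_gt0 // invr_gt0.
have bad0 : bad 0 (A, B).
  split; first by rewrite /half expr0; split => /=; lra.
  by rewrite /half /= expr0 expr1n /e; lra.
have step n z : bad n z -> {z' | bad n.+1 z' /\
    [/\ z.1 <= z'.1, z.2 <= z'.2, z'.1 + half n.+1 * w <= z.1 + half n * w &
      z'.2 + half n.+1 * h <= z.2 + half n * h]}.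
  case: z => x y [/= iz bz]; apply: cid.
  move: (iz) bz; rewrite halfS; set s := half n.+1 => izs.
  rewrite mu_split // => bz; case: izs => s0 Ax By xA yB.
  have sp : 0 < s := half0 _.
  have sw0 : 0 < s * w by rewrite mulr_gt0.
  have sh0 : 0 < s * h by rewrite mulr_gt0.
  have ok (a b : bool) : `|mu (x + a%:R * (s * w)) (y + b%:R * (s * h)) s| > e * s ^+ 2 ->
     exists z' : R * R, bad n.+1 z' /\
    [/\ x <= z'.1, y <= z'.2, z'.1 + s * w <= x + (s + s) * w &
      z'.2 + s * h <= y + (s + s) * h].
    move=> ab; exists (x + a%:R * (s * w), y + b%:R * (s * h)) => /=.
    rewrite /bad/= -/s.
    have bd (c : bool) (t : R) : 0 < t -> 0 <= c%:R * t <= t.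
      by move=> t0; case: c; rewrite ?mul1r ?mul0r ?lexx ltW.
    have [a1 a2 a3 a4] := bisect_axis (bd a _ sw0) Ax xA.
    have [b1 b2 b3 b4] := bisect_axis (bd b _ sh0) By yB.
    by split; first by split.
  have := ok false false; have := ok false true; have := ok true false; have := ok true true.
  rewrite !mul1r !mul0r !addr0 => h1 h2 h3 h4.
  have [/h1//|c1] := ltrP (e * s ^+ 2) `|mu (x + s * w) (y + s * h) s|.
  have [/h2//|c2] := ltrP (e * s ^+ 2) `|mu (x + s * w) y s|.
  have [/h3//|c3] := ltrP (e * s ^+ 2) `|mu x (y + s * h) s|.
  have [/h4//|c4] := ltrP (e * s ^+ 2) `|mu x y s|.
  exfalso; move: bz; apply/negP; rewrite -leNgt.
  rewrite (_ : e * (s + s) ^+ 2 = 4 * (e * s ^+ 2)); last by ring.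
  exact: ler_norm_sum4.
pose F := fix F n : {z | bad n z} := match n with
  | 0%N => exist _ _ bad0
  | S m => let: exist z bz := F m in let: exist z' H := step m z bz in
           exist _ z' H.1 end.
pose z n := sval (F n).
have Fb n : bad n (z n) by rewrite /z; case: (F n).
have FS n : [/\ (z n).1 <= (z n.+1).1, (z n).2 <= (z n.+1).2,
     (z n.+1).1 + half n.+1 * w <= (z n).1 + half n * w &
     (z n.+1).2 + half n.+1 * h <= (z n).2 + half n * h].
  by rewrite /z /=; case: (F n) => u bu /=; case: (step n u bu) => u' [].
clearbody z; clear F step.
have lim (v : nat -> R) (c : R) : 0 < c -> (forall n, v n <= v n.+1) ->
    (forall n, v n.+1 + half n.+1 * c <= v n + half n * c) ->
    exists l, forall n, v n <= l <= v n + half n * c.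
  move=> c0 v1 v2.
  have hc n : 0 < half n * c by rewrite mulr_gt0.
  have up n k : v n <= v (n + k)%N.
    by elim: k => [|k /le_trans]; [rewrite addn0|rewrite addnS; apply].
  have dn n k : v (n + k)%N + half (n + k)%N * c <= v n + half n * c.
    elim: k => [|k]; first by rewrite addn0.
    by rewrite addnS; apply: le_trans.
  have vv n m : v m <= v n + half n * c.
    have [/subnKC <-|/ltnW/subnKC mn] := leqP n m.
      by apply: le_trans (dn n (m - n)%N); rewrite lerDl ltW.
    by apply: (le_trans (up m (n - m)%N)); rewrite mn lerDl ltW.
  have hs : has_sup (range v).
    by split; [exists (v 0%N), 0%N | exists (v 0%N + half 0 * c) => _ [m _ <-]].
  exists (sup (range v)) => n; apply/andP; split.
    by apply: ub_le_sup; [exact: hs.2 | exists n].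
  by apply: ge_sup; [exact: hs.1 | move=> _ [m _ <-]].
have [x0 x0P] := lim (fun n => (z n).1) w w0
  (fun n => let: And4 a _ _ _ := FS n in a) (fun n => let: And4 _ _ a _ := FS n in a).
have [y0 y0P] := lim (fun n => (z n).2) h h0
  (fun n => let: And4 _ a _ _ := FS n in a) (fun n => let: And4 _ _ _ a := FS n in a).
have [x00 y00] := (x0P 0%N, y0P 0%N).
have [/= [_ i1 i2 i3 i4] _] := Fb 0%N.
have [||d d0 md] := @goursat_small e x0 y0 e0; [lra|lra|].
have [n nd] : exists n, half n < d.
  have := @cvg_geometric R 1 2^-1; rewrite ger0_norm ?invr_ge0 //.
  rewrite invf_lt1 // ltr1n => /(_ isT) /cvgrPdist_lt /(_ d d0) [n _ /(_ n (leqnn n))].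
  rewrite /geometric /= sub0r normrN mul1r ger0_norm ?exprn_ge0 ?invr_ge0//.
  by move=> nd; exists n.
have [iz bz] := Fb n; exfalso; move: bz; apply/negP; rewrite -leNgt.
by apply: md.
Qed.

(** Where p takes the same values on the two horizontal sides, their
contributions to the circulation cancel. *)
Lemma goursat : (forall x, A <= x <= A + w -> p x (B + h) = p x B) ->
  itg B (B + h) (q (A + w)) = itg B (B + h) (q A).
Proof.
move=> pp; have := goursat_mu0; rewrite /mu !mul1r.
rewrite (@eq_itg _ A (A + w) _ (fun=> 0)); last by move=> x /pp ->; rewrite subrr.
rewrite itg_cst; last by rewrite lerDl ltW.
rewrite mul0r subr0 itgB; [by move/eqP; rewrite subr_eq0 => /eqP| |];
  by apply: closed_cts_q; rewrite lexx lerDl ltW.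
Qed.

End goursat.

Import Normc.

(** * Modulus, continuity and derivatives in one complex variable *)

Section modulus.
Context {R : realType}.
Implicit Types (x y z a b : R[i]).

Lemma normc_ge0 z : 0 <= normc z.
Proof. by case: z => a b; exact: sqrtr_ge0. Qed.

Lemma normc_sub x y : normc (x - y) = normc (y - x).
Proof. by rewrite -normcN opprB. Qed.

Lemma normc_gt0 z : (0 < normc z) = (z != 0).
Proof.
rewrite lt_def normc_ge0 andbT; congr negb; apply/eqP/eqP => [/eq0_normc//|->].
exact: normc0.
Qed.

Lemma normcX z n : normc (z ^+ n) = normc z ^+ n.
Proof. by elim: n => [|n IH]; rewrite ?expr0 ?normc1 // !exprS normcM IH. Qed.

Lemma normcR (r : R) : normc r%:C%C = `|r|.
Proof. by rewrite /normc /= expr0n /= addr0 sqrtr_sqr. Qed.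

Lemma ger0_normcR (r : R) : 0 <= r -> normc r%:C%C = r.
Proof. by move=> r0; rewrite normcR ger0_norm. Qed.

Lemma ler_normc_sub x y : normc x - normc y <= normc (x - y).
Proof. by have := le_normcD (x - y) y; rewrite subrK => ?; lra. Qed.

Lemma normc_sum (I : Type) (r : seq I) (P : pred I) (F : I -> R[i]) :
  normc (\sum_(i <- r | P i) F i) <= \sum_(i <- r | P i) normc (F i).
Proof.
elim/big_rec2: _ => [|i y x _ IH]; first by rewrite normc0.
by apply: le_trans (le_normcD _ _) _; rewrite lerD2l.
Qed.

Lemma normc_sq z : normc z ^+ 2 = complex.Re z ^+ 2 + complex.Im z ^+ 2.
Proof. by case: z => a b; rewrite /normc /= sqr_sqrtr // addr_ge0 ?sqr_ge0. Qed.

Lemma normc_geRe z : `|complex.Re z| <= normc z.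
Proof.
rewrite -(@ler_pXn2r _ 2) ?nnegrE ?normc_ge0// normc_sq real_normK ?num_real//.
by rewrite lerDl sqr_ge0.
Qed.

Lemma normc_geIm z : `|complex.Im z| <= normc z.
Proof.
rewrite -(@ler_pXn2r _ 2) ?nnegrE ?normc_ge0// normc_sq real_normK ?num_real//.
by rewrite lerDr sqr_ge0.
Qed.

Lemma normcJ' z : normc (z^*)%C = normc z.
Proof. by case: z => a b; rewrite /normc /= sqrrN. Qed.

Lemma unimodular_rotation z : exists2 c : R[i], normc c = 1 &
  c * z = (normc z)%:C%C.
Proof.
have [->|z0] := eqVneq z 0; first by exists 1; rewrite ?normc1 // mulr0 normc0.
have n0 : normc z != 0 by rewrite gt_eqF // normc_gt0.
exists ((normc z)%:C%C / z).
  by rewrite normcM normcV ger0_normcR ?normc_ge0 // divff.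
by rewrite divfK.
Qed.

End modulus.

Section ccont.
Context {R : realType}.
Implicit Types (f g : R[i] -> R[i]) (x y z a b : R[i]).

Definition ccont f a := forall e : R, 0 < e -> exists2 d : R, 0 < d &
  forall z, normc (z - a) < d -> normc (f z - f a) < e.

Lemma ccont_cst c a : ccont (fun=> c) a.
Proof. by move=> e e0; exists 1 => // z _; rewrite subrr normc0. Qed.

Lemma ccont_id a : ccont id a.
Proof. by move=> e e0; exists e. Qed.

Lemma ccontD f g a : ccont f a -> ccont g a -> ccont (fun z => f z + g z) a.
Proof.
move=> cf cg e e0; have e2 : 0 < e / 2 by lra.
have [d d0 fd] := cf _ e2; have [d' d'0 gd] := cg _ e2.
exists (Num.min d d') => [|z]; first by rewrite lt_min d0.
rewrite lt_min => /andP[/fd fz /gd gz].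
rewrite (_ : _ - _ = (f z - f a) + (g z - g a)); last by ring.
by apply: le_lt_trans (le_normcD _ _) _; lra.
Qed.

Lemma ccontM f g a : ccont f a -> ccont g a -> ccont (fun z => f z * g z) a.
Proof.
move=> cf cg e e0; pose N := 1 + normc (f a) + normc (g a).
have N1 : 1 <= N by rewrite /N; have := normc_ge0 (f a); have := normc_ge0 (g a); lra.
have N0 : 0 < N by lra.
pose r := Num.min 1 (e / N).
have r0 : 0 < r by rewrite lt_min ltr01 divr_gt0.
have [d d0 fd] := cf _ r0; have [d' d'0 gd] := cg _ r0.
exists (Num.min d d') => [|z]; first by rewrite lt_min d0.
rewrite lt_min => /andP[/fd fz /gd gz].
rewrite (_ : _ - _ = (f z - f a) * (g z - g a) + f a * (g z - g a) +
  (f z - f a) * g a); last by ring.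
have r1 : r <= 1 by rewrite ge_min lexx.
have rN : r * N <= e by rewrite -ler_pdivlMr // ge_min lexx orbT.
apply: le_lt_trans (le_normcD _ _) _; rewrite normcM.
apply: (@le_lt_trans _ _ (normc (f z - f a) * normc (g z - g a) +
    normc (f a) * normc (g z - g a) + normc (f z - f a) * normc (g a))).
  by rewrite lerD2r; apply: le_trans (le_normcD _ _) _; rewrite !normcM.
apply: lt_le_trans rN; rewrite /N.
have := normc_ge0 (f a); have := normc_ge0 (g a).
have := normc_ge0 (f z - f a); have := normc_ge0 (g z - g a).
move: fz gz; set A := normc (f z - _); set B := normc (g z - _).
set F := normc (f a); set G := normc (g a) => Ar Br B0 A0 G0 F0.
have AB : A * B < r.
  apply: (@le_lt_trans _ _ (A * 1)); last by rewrite mulr1.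
  by rewrite ler_wpM2l //; lra.
have : F * B <= F * r by rewrite ler_wpM2l // ltW.
have : A * G <= r * G by rewrite ler_wpM2r // ltW.
by lra.
Qed.

Lemma ccontN f a : ccont f a -> ccont (fun z => - f z) a.
Proof.
by move=> cf e /cf[d d0 fd]; exists d => // z /fd; rewrite -opprD normcN.
Qed.

Lemma ccontB f g a : ccont f a -> ccont g a -> ccont (fun z => f z - g z) a.
Proof. by move=> cf cg; apply: ccontD => //; exact: ccontN. Qed.

Lemma ccontV f a : f a != 0 -> ccont f a -> ccont (fun z => (f z)^-1) a.
Proof.
move=> fa cf e e0; have n0 : 0 < normc (f a) by rewrite normc_gt0.
pose N := normc (f a); pose r := Num.min (N / 2) (e * N ^+ 2 / 2).
have r0 : 0 < r by rewrite lt_min; apply/andP; split;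
  rewrite ?divr_gt0 ?mulr_gt0 ?exprn_gt0.
have [d d0 fd] := cf _ r0; exists d => // z /fd fz.
have r1 : r <= N / 2 by rewrite ge_min lexx.
have r2 : r <= e * N ^+ 2 / 2 by rewrite ge_min lexx orbT.
have fzN : N / 2 < normc (f z).
  by have := ler_normc_sub (f a) (f z); rewrite normc_sub -/N; lra.
have fz0 : f z != 0 by rewrite -normc_gt0; apply: lt_trans fzN; rewrite divr_gt0.
rewrite (_ : _ - _ = (f a - f z) * ((f z)^-1 * (f a)^-1)); last first.
  by field; rewrite fa fz0.
rewrite !normcM !normcV -/N normc_sub -invfM ltr_pdivrMr; last first.
  by rewrite mulr_gt0 // normc_gt0.
apply: lt_le_trans fz _; apply: le_trans r2 _.
rewrite (_ : _ / 2 = e * (N / 2 * N)); last by field.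
by rewrite ler_pM2l // ler_pM2r // ltW.
Qed.

Lemma ccont_comp f g a : ccont f a -> ccont g (f a) -> ccont (fun z => g (f z)) a.
Proof.
move=> cf cg e e0; have [d d0 gd] := cg e e0; have [r r0 fr] := cf d d0.
by exists r => // z /fr /gd.
Qed.

Lemma ccont_eq f g a : f =1 g -> ccont g a -> ccont f a.
Proof. by move=> /funext ->. Qed.

Lemma ccontX f n a : ccont f a -> ccont (fun z => f z ^+ n) a.
Proof.
move=> cf; elim: n => [|n IH]; first by apply: ccont_eq (ccont_cst 1 a).
by apply: ccont_eq (ccontM cf IH) => z; rewrite exprS.
Qed.

Lemma ccont_sum (n : nat) (F : 'I_n -> R[i] -> R[i]) a :
  (forall i, ccont (F i) a) -> ccont (fun z => \sum_(i < n) F i z) a.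
Proof.
elim: n F => [|n IH] F cF.
  by apply: ccont_eq (ccont_cst 0 a) => z; rewrite big_ord0.
apply: ccont_eq (ccontD (cF ord0) (IH (fun i => F (lift ord0 i)) _)) => // z.
by rewrite big_ord_recl.
Qed.

Lemma ccont_near f g a (r : R) : 0 < r -> (forall z, normc (z - a) < r -> f z = g z) ->
  ccont g a -> ccont f a.
Proof.
move=> r0 fg cg e e0; have [d d0 gd] := cg e e0.
exists (Num.min r d) => [|z]; first by rewrite lt_min r0.
by rewrite lt_min => /andP[zr zd]; rewrite !fg ?subrr ?normc0 //; exact: gd.
Qed.

Lemma ccontRe a : ccont (fun z => (complex.Re z)%:C%C) a.
Proof.
move=> e e0; exists e => // z; apply: le_lt_trans.
rewrite (_ : _ - _ = (complex.Re (z - a))%:C%C); first by rewrite normcR normc_geRe.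
by rewrite raddfB /= -rmorphB.
Qed.

Lemma ccontIm a : ccont (fun z => (complex.Im z)%:C%C) a.
Proof.
move=> e e0; exists e => // z; apply: le_lt_trans.
rewrite (_ : _ - _ = (complex.Im (z - a))%:C%C); first by rewrite normcR normc_geIm.
by rewrite raddfB /= -rmorphB.
Qed.

(** Caratheodory's form of the derivative: the difference quotient has a continuous
extension to a.  Sums, products and compositions then require no estimates. *)
Definition cderiv f a d := exists phi, [/\ ccont phi a, phi a = d &
  forall z, f z = f a + (z - a) * phi z].

Definition cdiff f a := exists d, cderiv f a d.

Lemma cderivP f a d : cderiv f a d <-> (forall e : R, 0 < e ->
  exists2 r : R, 0 < r & forall z, normc (z - a) < r ->
    normc (f z - f a - (z - a) * d) <= e * normc (z - a)).
Proof.
split=> [[phi [cphi pd fE]] e e0|fd].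
  have [r r0 pr] := cphi e e0; exists r => // z zr.
  rewrite [f z]fE (_ : _ - _ = (z - a) * (phi z - phi a)); last by rewrite pd; ring.
  by rewrite normcM mulrC ler_wpM2r ?normc_ge0 // ltW // pr.
exists (fun z => if z == a then d else (f z - f a) / (z - a)); split.
- move=> e e0; have e2 : 0 < e / 2 by lra.
  have [r r0 fr] := fd _ e2; exists r => // z zr; rewrite eqxx.
  case: eqVneq => [_|za]; first by rewrite subrr normc0.
  have za0 : z - a != 0 by rewrite subr_eq0.
  have n0 : 0 < normc (z - a) by rewrite normc_gt0.
  rewrite (_ : _ - _ = (f z - f a - (z - a) * d) / (z - a)); last by field.
  rewrite normcM normcV ltr_pdivrMr //; apply: le_lt_trans (fr z zr) _.
  by rewrite ltr_pM2r //; lra.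
- by rewrite eqxx.
- move=> z; case: eqVneq => [->|za]; first by rewrite subrr mul0r addr0.
  by rewrite mulrC divfK ?subr_eq0 // addrC subrK.
Qed.

Lemma cdiff_cont f a : cdiff f a -> ccont f a.
Proof.
case=> d [phi [cphi _ fE]].
apply: (@ccont_near _ (fun z => f a + (z - a) * phi z) _ 1) => //.
apply: ccontD; first exact: ccont_cst.
by apply: ccontM => //; apply: ccontB; [exact: ccont_id|exact: ccont_cst].
Qed.

Lemma cderiv_uniq f a d d' : cderiv f a d -> cderiv f a d' -> d = d'.
Proof.
move=> /cderivP fd /cderivP fd'; apply/eqP; rewrite -subr_eq0; case: eqP => // /eqP.
rewrite -normc_gt0 => dd; exfalso.
have e0 : 0 < normc (d - d') / 4 by lra.
have [r r0 fr] := fd _ e0; have [s s0 fs] := fd' _ e0.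
pose t := Num.min r s / 2; have t0 : 0 < t by rewrite divr_gt0 // lt_min r0.
have m1 : Num.min r s <= r by rewrite ge_min lexx.
have m2 : Num.min r s <= s by rewrite ge_min lexx orbT.
have [tr ts] : t < r /\ t < s by rewrite /t; rewrite /t in t0; lra.
have := fr (a + t%:C%C); have := fs (a + t%:C%C).
have E : a + t%:C%C - a = t%:C%C by ring.
rewrite !{}E ger0_normcR; last exact: ltW.
move=> /(_ ts) h1 /(_ tr) h2.
have := le_normcD (f (a + t%:C%C) - f a - t%:C%C * d')
  (- (f (a + t%:C%C) - f a - t%:C%C * d)).
rewrite normcN (_ : _ - _ = t%:C%C * (d - d')); last by ring.
rewrite normcM ger0_normcR; last exact: ltW.
move=> h3; have : t * normc (d - d') <= t * (normc (d - d') / 2) by lra.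
by rewrite ler_pM2l //; lra.
Qed.

Lemma cderiv_near f g a d (r : R) : 0 < r ->
  (forall z, normc (z - a) < r -> f z = g z) -> cderiv g a d -> cderiv f a d.
Proof.
move=> r0 fg /cderivP gd; apply/cderivP => e /gd[s s0 gs].
exists (Num.min r s) => [|z]; first by rewrite lt_min r0.
rewrite lt_min => /andP[zr zs]; rewrite !fg ?subrr ?normc0 //; exact: gs.
Qed.

Lemma cderiv_cst c a : cderiv (fun=> c) a 0.
Proof.
by exists (fun=> 0); split=> // [|z]; [exact: ccont_cst|rewrite mulr0 addr0].
Qed.

Lemma cderiv_id a : cderiv id a 1.
Proof.
exists (fun=> 1); split=> // [|z]; first exact: ccont_cst.
by rewrite mulr1 addrC subrK.
Qed.

Lemma cderivD f g a d d' : cderiv f a d -> cderiv g a d' ->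
  cderiv (fun z => f z + g z) a (d + d').
Proof.
move=> [phi [cphi pd fE]] [psi [cpsi pd' gE]].
exists (fun z => phi z + psi z); split=> [||z]; first exact: ccontD.
  by rewrite pd pd'.
by rewrite [f z]fE [g z]gE; ring.
Qed.

Lemma cderivM f g a d d' : cderiv f a d -> cderiv g a d' ->
  cderiv (fun z => f z * g z) a (d * g a + f a * d').
Proof.
move=> fd gd; have cg : ccont g a by apply: cdiff_cont; exists d'.
move: fd gd => [phi [cphi pd fE]] [psi [cpsi pd' gE]].
exists (fun z => phi z * g z + f a * psi z); split=> [||z].
- by apply: ccontD; apply: ccontM => //; exact: ccont_cst.
- by rewrite pd pd'.
- by rewrite [f z]fE [X in _ * X = _]gE [g z in RHS]gE; ring.
Qed.

Lemma cderivN f a d : cderiv f a d -> cderiv (fun z => - f z) a (- d).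
Proof.
move=> [phi [cphi pd fE]]; exists (fun z => - phi z).
by split=> [||z]; [exact: ccontN|rewrite pd|rewrite [f z]fE; ring].
Qed.

Lemma cderivV f a d : f a != 0 -> cderiv f a d ->
  cderiv (fun z => (f z)^-1) a (- d / f a ^+ 2).
Proof.
move=> fa fd; have cf : ccont f a by apply: cdiff_cont; exists d.
move: fd => [phi [cphi pd fE]].
have [r r0 fr] : exists2 r : R, 0 < r & forall z, normc (z - a) < r -> f z != 0.
  have := cf (normc (f a)); rewrite normc_gt0 => /(_ fa)[r r0 fr].
  exists r => // z /fr; apply: contraTneq => ->.
  by rewrite sub0r normcN ltxx.
apply: (@cderiv_near _ (fun z => (f a)^-1 + (z - a) * (- phi z * ((f z)^-1 * (f a)^-1))) _ _ r r0).
  move=> z /fr fz; have : f z - f a = (z - a) * phi z by rewrite {1}[f z]fE; ring.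
  by move=> E; rewrite mulrA mulrN -E; field; rewrite ?fa ?fz.
exists (fun z => - phi z * ((f z)^-1 * (f a)^-1)); split.
- apply: ccontM; first exact: ccontN.
  by apply: ccontM; [exact: ccontV|exact: ccont_cst].
- by rewrite pd; field.
- by move=> z; rewrite subrr mul0r addr0.
Qed.

Lemma cderiv_comp f g a d d' : cderiv f a d -> cderiv g (f a) d' ->
  cderiv (fun z => g (f z)) a (d * d').
Proof.
move=> fd [psi [cpsi pd' gE]]; have cf : ccont f a by apply: cdiff_cont; exists d.
move: fd => [phi [cphi pd fE]].
exists (fun z => phi z * psi (f z)); split.
- by apply: ccontM => //; exact: (@ccont_comp f psi).
- by rewrite pd pd'.
- by move=> z; rewrite gE {1}[f z]fE; ring.
Qed.

Lemma cdiff_cst c a : cdiff (fun=> c) a.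
Proof. by exists 0; exact: cderiv_cst. Qed.
Lemma cdiff_id a : cdiff id a.
Proof. by exists 1; exact: cderiv_id. Qed.
Lemma cdiffD f g a : cdiff f a -> cdiff g a -> cdiff (fun z => f z + g z) a.
Proof. by move=> [d fd] [d' gd]; eexists; exact: cderivD fd gd. Qed.
Lemma cdiffM f g a : cdiff f a -> cdiff g a -> cdiff (fun z => f z * g z) a.
Proof. by move=> [d fd] [d' gd]; eexists; exact: cderivM fd gd. Qed.
Lemma cdiffN f a : cdiff f a -> cdiff (fun z => - f z) a.
Proof. by move=> [d fd]; eexists; exact: cderivN fd. Qed.
Lemma cdiffB f g a : cdiff f a -> cdiff g a -> cdiff (fun z => f z - g z) a.
Proof. by move=> fd gd; apply: cdiffD => //; exact: cdiffN. Qed.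
Lemma cdiffV f a : f a != 0 -> cdiff f a -> cdiff (fun z => (f z)^-1) a.
Proof. by move=> fa [d fd]; eexists; exact: cderivV fa fd. Qed.
Lemma cdiff_comp f g a : cdiff f a -> cdiff g (f a) -> cdiff (fun z => g (f z)) a.
Proof. by move=> [d fd] [d' gd]; eexists; exact: cderiv_comp fd gd. Qed.
Lemma cdiff_near f g a (r : R) : 0 < r ->
  (forall z, normc (z - a) < r -> f z = g z) -> cdiff g a -> cdiff f a.
Proof. by move=> r0 fg [d gd]; exists d; exact: cderiv_near fg gd. Qed.
Lemma cdiff_eq f g a : f =1 g -> cdiff g a -> cdiff f a.
Proof. by move=> /funext ->. Qed.
Lemma cdiffX f n a : cdiff f a -> cdiff (fun z => f z ^+ n) a.
Proof.
move=> cf; elim: n => [|n IH]; first by apply: cdiff_eq (cdiff_cst 1 a).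
by apply: cdiff_eq (cdiffM cf IH) => z; rewrite exprS.
Qed.
Lemma cdiff_sum (n : nat) (F : 'I_n -> R[i] -> R[i]) a :
  (forall i, cdiff (F i) a) -> cdiff (fun z => \sum_(i < n) F i z) a.
Proof.
elim: n F => [|n IH] F cF.
  by apply: cdiff_eq (cdiff_cst 0 a) => z; rewrite big_ord0.
apply: cdiff_eq (cdiffD (cF ord0) (IH (fun i => F (lift ord0 i)) _)) => // z.
by rewrite big_ord_recl.
Qed.

End ccont.

(** * Means over circles and Taylor coefficients *)

Section circle_mean.
Context {R : realType}.
Implicit Types (f g : R[i] -> R[i]) (z a b : R[i]) (s t : R).
Local Notation Re := complex.Re.
Local Notation Im := complex.Im.
Local Notation "'i" := (Complex 0 1).
Local Notation "x %:C" := (real_complex _ x).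

(** For s in [-1, 1] this is the point of angle 2 atan s, which covers the right
half of the unit circle and makes polar coordinates rational. *)
Definition zeta s : R[i] := (1 + 'i * s%:C) / (1 - 'i * s%:C).
(** The derivative of the angle 2 atan s. *)
Definition wgt s : R := 2 / (1 + s ^+ 2).
(** The opposite point supplies the left half of the circle of radius t.  The
integral is left unnormalised: a constant K has mean 2 K total_wgt. *)
Definition circle_mean f t : R :=
  itg (-1) (-1 + 2) (fun s => Re (f (t%:C * zeta s) + f (- (t%:C * zeta s))) * wgt s).

Lemma Re_realM (x : R) z : Re (x%:C * z) = x * Re z.
Proof. by case: z => a b /=; rewrite mul0r subr0. Qed.

Lemma Im_realM (x : R) z : Im (x%:C * z) = x * Im z.
Proof. by case: z => a b /=; rewrite mul0r addr0. Qed.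

Lemma one_sub_i_neq0 s : 1 - 'i * s%:C != 0.
Proof.
rewrite eq_complex /= negb_and; apply/orP; left.
by rewrite !mul0r !mulr0 subr0 subr0 oner_eq0.
Qed.

Lemma normc_zeta s : normc (zeta s) = 1.
Proof.
rewrite /zeta normcM normcV.
have -> : 1 + 'i * s%:C = (1 - 'i * s%:C)^*%C.
  by apply/eqP; rewrite eq_complex /=; apply/andP; split; apply/eqP; ring.
by rewrite normcJ' divff // gt_eqF // normc_gt0 one_sub_i_neq0.
Qed.

Lemma zeta1 : zeta (-1 + 2) = 'i.
Proof.
have -> : -1 + 2 = 1 :> R by ring.
rewrite /zeta; apply: (canLR (mulfK (one_sub_i_neq0 1))).
by apply/eqP; rewrite eq_complex /=; apply/andP; split; apply/eqP; ring.
Qed.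

Lemma zetaN1 : zeta (-1) = - 'i.
Proof.
rewrite /zeta; apply: (canLR (mulfK (one_sub_i_neq0 (-1)))).
by apply/eqP; rewrite eq_complex /=; apply/andP; split; apply/eqP; ring.
Qed.

Lemma wgt_ge0 s : 0 <= wgt s.
Proof. by rewrite /wgt divr_ge0 // addr_ge0 // sqr_ge0. Qed.

Lemma wgt_sub s s0 : wgt s - wgt s0 =
  (s - s0) * (- (2 * (s + s0)) / ((1 + s ^+ 2) * (1 + s0 ^+ 2))).
Proof.
rewrite /wgt; field.
by apply/andP; split; rewrite gt_eqF // ltr_pwDl // sqr_ge0.
Qed.

Lemma zeta_sub s s0 : zeta s - zeta s0 =
  (s - s0)%:C * (2%:C * 'i / ((1 - 'i * s%:C) * (1 - 'i * s0%:C))).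
Proof.
rewrite /zeta rmorphB /= [2%:C](rmorph_nat (real_complex R)); field.
by rewrite !one_sub_i_neq0.
Qed.

Lemma one_add_sq_neq0 s : 1 + s%:C ^+ 2 != 0 :> R[i].
Proof.
rewrite -normc_gt0 -(rmorphXn (real_complex R)) -(rmorph1 (real_complex R)).
by rewrite -rmorphD normcR normr_gt0 gt_eqF // ltr_pwDl // sqr_ge0.
Qed.

(** Slopes of p and q that are continuous at the point serve as partial
derivatives there, as in Caratheodory's form of the derivative. *)
Lemma closed_at_ccont p q A w B h t0 s0 (u v u' v' : R[i] -> R[i]) :
  let tau := fun t s => Complex t s in
  ccont u (tau t0 s0) -> ccont v (tau t0 s0) ->
  ccont u' (tau t0 s0) -> ccont v' (tau t0 s0) ->
  (forall t s, A <= t <= A + w -> B <= s <= B + h ->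
     p t s - p t0 s0 = (t - t0) * Im (u (tau t s)) + (s - s0) * Im (v (tau t s))) ->
  (forall t s, A <= t <= A + w -> B <= s <= B + h ->
     q t s - q t0 s0 = (t - t0) * Re (u' (tau t s)) + (s - s0) * Re (v' (tau t s))) ->
  Im (v (tau t0 s0)) = Re (u' (tau t0 s0)) ->
  closed_at p q A B w h t0 s0.
Proof.
move=> tau cu cv cu' cv' pE qE vu.
exists (Im (u (tau t0 s0))), (Im (v (tau t0 s0))), (Re (v' (tau t0 s0))) => e e0.
have [d1 d10 h1] := cu e e0; have [d2 d20 h2] := cv e e0.
have [d3 d30 h3] := cu' e e0; have [d4 d40 h4] := cv' e e0.
pose d := Num.min (Num.min d1 d2) (Num.min d3 d4).
have d0 : 0 < d by rewrite !lt_min d10 d20 d30.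
exists (d / 3) => [|t s tA sB td sd]; first by rewrite divr_gt0.
have dtau : normc (tau t s - tau t0 s0) < d.
  have -> : tau t s - tau t0 s0 = (t - t0)%:C + 'i * (s - s0)%:C.
    by apply/eqP; rewrite eq_complex /=; apply/andP; split; apply/eqP; ring.
  apply: le_lt_trans (le_normcD _ _) _; rewrite normcM !normcR.
  have -> : normc ('i : R[i]) = 1 by rewrite /normc /= expr0n expr1n add0r sqrtr1.
  by lra.
have near (g : R[i] -> R[i]) r : d <= r -> (forall z, normc (z - tau t0 s0) < r ->
    normc (g z - g (tau t0 s0)) < e) ->
    `|Re (g (tau t s)) - Re (g (tau t0 s0))| <= e /\
    `|Im (g (tau t s)) - Im (g (tau t0 s0))| <= e.
  move=> dr /(_ _ (lt_le_trans dtau dr)) /ltW gd.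
  rewrite -!raddfB; split; apply: le_trans gd; [exact: normc_geRe|exact: normc_geIm].
have [D1 D2 D3 D4] : [/\ d <= d1, d <= d2, d <= d3 & d <= d4].
  by rewrite /d; split; rewrite !ge_min lexx ?orbT.
have est (x y x0 y0 : R) : `|x - x0| <= e -> `|y - y0| <= e ->
  `|(t - t0) * x + (s - s0) * y - (x0 * (t - t0) + y0 * (s - s0))| <=
    e * (`|t - t0| + `|s - s0|).
  move=> xe ye.
  rewrite (_ : _ - _ = (t - t0) * (x - x0) + (s - s0) * (y - y0)); last by ring.
  apply: le_trans (ler_normD _ _) _; rewrite !normrM mulrDr.
  by apply: lerD; rewrite [leLHS]mulrC ler_wpM2r.
split; first by rewrite pE //; apply: est; [exact: (near u _ D1 h1).2|exact: (near v _ D2 h2).2].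
rewrite qE // vu; apply: est; [exact: (near u' _ D3 h3).1|exact: (near v' _ D4 h4).1].
Qed.

(** The form in play is the imaginary part of f dz/z, written in the
coordinates z = t zeta(s). *)
Lemma closed_polar f t0 s0 A w B h : 0 < A -> 0 < t0 -> cdiff f (t0%:C * zeta s0) ->
  closed_at (fun t s => Im (f (t%:C * zeta s) / t%:C))
    (fun t s => Re (f (t%:C * zeta s)) * wgt s) A B w h t0 s0.
Proof.
move=> A0 t00 [D [phi [cphi _ fE]]].
set Z0 := t0%:C * zeta s0 in cphi fE *.
pose T z : R[i] := (Re z)%:C; pose S z : R[i] := (Im z)%:C.
pose Zt z : R[i] := (1 + 'i * S z) / (1 - 'i * S z).
pose kap z : R[i] := 2%:C * 'i / ((1 - 'i * S z) * (1 - 'i * s0%:C)).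
pose tau0 := Complex t0 s0.
have cT : ccont T tau0 by exact: ccontRe.
have cS : ccont S tau0 by exact: ccontIm.
have ciS : ccont (fun z => 'i * S z) tau0 by apply: ccontM => //; exact: ccont_cst.
have cden : ccont (fun z => 1 - 'i * S z) tau0 by apply: ccontB => //; exact: ccont_cst.
have cZt : ccont Zt tau0.
  apply: ccontM; first by apply: ccontD => //; exact: ccont_cst.
  by apply: ccontV => //; exact: one_sub_i_neq0.
have ckap : ccont kap tau0.
  apply: ccontM; first exact: ccont_cst.
  apply: ccontV; first by rewrite mulf_neq0 ?one_sub_i_neq0.
  by apply: ccontM => //; exact: ccont_cst.
have cTZ : ccont (fun z => T z * Zt z) tau0 by exact: ccontM.
have cph : ccont (fun z => phi (T z * Zt z)) tau0 by exact: (ccont_comp cTZ).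
have t0C : t0%:C != 0 :> R[i] by rewrite -normc_gt0 ger0_normcR // ltW.
have cTV : ccont (fun z => (T z)^-1) tau0 by exact: ccontV.
have cw : ccont (fun z => (wgt (Im z))%:C) tau0.
  apply: (@ccont_eq _ _ (fun z => 2%:C * (1 + S z ^+ 2)^-1)).
    move=> z; rewrite /wgt /S -rmorphXn -(rmorph1 (real_complex R)) -rmorphD.
    by rewrite -fmorphV -rmorphM.
  apply: ccontM; first exact: ccont_cst.
  apply: ccontV; last by apply: ccontD; [exact: ccont_cst|exact: ccontX].
  exact: one_add_sq_neq0.
have com : ccont (fun z => (- (2 * (Im z + s0)) / ((1 + Im z ^+ 2) * (1 + s0 ^+ 2)))%:C) tau0.
  apply: (@ccont_eq _ _ (fun z => - (2%:C * (S z + s0%:C)) * ((1 + S z ^+ 2) * (1 + s0%:C ^+ 2))^-1)).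
    move=> z; rewrite /S -!rmorphXn -(rmorph1 (real_complex R)) -!rmorphD -!rmorphM.
    by rewrite -fmorphV -rmorphN -rmorphM.
  apply: ccontM.
    apply: ccontN; apply: ccontM; first exact: ccont_cst.
    by apply: ccontD => //; exact: ccont_cst.
  apply: ccontV; last first.
    apply: ccontM; last exact: ccont_cst.
    by apply: ccontD; [exact: ccont_cst|exact: ccontX].
  by rewrite mulf_neq0 ?one_add_sq_neq0.
have fTZ (t s : R) : f (t%:C * zeta s) = f Z0 +
    ((t - t0)%:C * zeta s + (s - s0)%:C * (t0%:C * kap (Complex t s))) * phi (t%:C * zeta s).
  rewrite fE; congr (_ + _ * _); rewrite /Z0.
  transitivity ((t%:C - t0%:C) * zeta s + t0%:C * (zeta s - zeta s0)); first by ring.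
  by rewrite zeta_sub -rmorphB /kap /S /=; ring.
pose ph z := phi (T z * Zt z).
apply: (@closed_at_ccont _ _ _ _ _ _ _ _
  (fun z => (T z)^-1 * (Zt z * ph z - f Z0 / t0%:C))
  (fun z => (T z)^-1 * (t0%:C * kap z * ph z))
  (fun z => (wgt (Im z))%:C * (Zt z * ph z))
  (fun z => (wgt (Im z))%:C * (t0%:C * kap z * ph z) +
    (- (2 * (Im z + s0)) / ((1 + Im z ^+ 2) * (1 + s0 ^+ 2)))%:C * f Z0)) => //=.
- by apply: ccontM => //; apply: ccontB; [exact: ccontM|exact: ccont_cst].
- by apply: ccontM => //; apply: ccontM => //; apply: ccontM => //; exact: ccont_cst.
- by apply: ccontM => //; exact: ccontM.
- apply: ccontD; last by apply: ccontM => //; exact: ccont_cst.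
  by apply: ccontM => //; apply: ccontM => //; apply: ccontM => //; exact: ccont_cst.
- move=> t s /andP[At _] _; have t1 : 0 < t by exact: lt_le_trans At.
  have tC : t%:C != 0 :> R[i] by rewrite -normc_gt0 ger0_normcR // ltW.
  rewrite -!Im_realM -raddfD -raddfB; congr (Im _); rewrite fTZ /T /=.
  rewrite /Z0 /ph /T /= -[Zt _]/(zeta s) rmorphB; field.
  by rewrite tC t0C.
- move=> t s _ _; rewrite -!Re_realM.
  have -> : Re (f (t%:C * zeta s)) * wgt s = Re ((wgt s)%:C * f (t%:C * zeta s)).
    by rewrite Re_realM mulrC.
  have -> : Re (f (t0%:C * zeta s0)) * wgt s0 = Re ((wgt s0)%:C * f (t0%:C * zeta s0)).
    by rewrite Re_realM mulrC.
  rewrite -raddfD -raddfB; congr (Re _); rewrite fTZ /Z0 /ph /T /= -[Zt _]/(zeta s).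
  transitivity ((wgt s)%:C * (((t - t0)%:C * zeta s + (s - s0)%:C * (t0%:C * kap (t +i* s)%C)) *
    phi (t%:C * zeta s)) + (wgt s - wgt s0)%:C * f (t0%:C * zeta s0)).
    by rewrite rmorphB; ring.
  by rewrite wgt_sub [((s - s0) * _)%:C]rmorphM; ring.
- have -> : (t0%:C)^-1 * (t0%:C * kap tau0 * ph tau0) = 'i * ((wgt s0)%:C * (Zt tau0 * ph tau0)).
    rewrite /kap /Zt /S /= /wgt.
    rewrite (_ : (2 / (1 + s0 ^+ 2))%:C = 2%:C / (1 + s0%:C ^+ 2)); last first.
      by rewrite -(rmorphXn (real_complex R)) -(rmorph1 (real_complex R)) -rmorphD -fmorphV -rmorphM.
    have -> : 1 + s0%:C ^+ 2 = (1 + 'i * s0%:C) * (1 - 'i * s0%:C).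
      transitivity (1 - 'i ^+ 2 * s0%:C ^+ 2); last by ring.
      by rewrite sqr_i mulN1r opprK.
    field; rewrite t0C one_sub_i_neq0 /= andbT.
    have := one_sub_i_neq0 (- s0); by rewrite rmorphN mulrN opprK.
  by rewrite -ImiRe [in RHS]mulrC.
Qed.

Lemma normc_polar t s : 0 < t -> normc (t%:C * zeta s) = t.
Proof. by move=> t0; rewrite normcM normc_zeta mulr1 ger0_normcR // ltW. Qed.

Definition punctured_cdiff f := forall z, 0 < normc z -> normc z <= 1 -> cdiff f z.

Lemma punctured_even f t s : punctured_cdiff f -> 0 < t -> t <= 1 ->
  cdiff (fun z => f z + f (- z)) (t%:C * zeta s).
Proof.
move=> fd t0 t1; apply: cdiffD; first by apply: fd; rewrite normc_polar.
apply: (@cdiff_comp _ (fun z => - z) f); first by apply: cdiffN; exact: cdiff_id.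
by apply: fd; rewrite normcN normc_polar.
Qed.

Lemma punctured_closed f A x y : punctured_cdiff f -> 0 < A ->
  A <= x <= A + (1 - A) ->
  closed_at (fun t s => Im ((f (t%:C * zeta s) + f (- (t%:C * zeta s))) / t%:C))
    (fun t s => Re (f (t%:C * zeta s) + f (- (t%:C * zeta s))) * wgt s)
    A (-1) (1 - A) 2 x y.
Proof.
move=> fd A0 /andP[Ax xA]; have x0 : 0 < x by exact: lt_le_trans Ax.
apply: (@closed_polar (fun z => f z + f (- z))) => //.
by apply: punctured_even => //; lra.
Qed.

Lemma circle_mean_cts f t : punctured_cdiff f -> 0 < t -> t <= 1 ->
  cts_on (-1) (-1 + 2)
    (fun s => Re (f (t%:C * zeta s) + f (- (t%:C * zeta s))) * wgt s).
Proof.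
move=> fd t0 t1; have t20 : 0 < t / 2 by lra.
have w0 : 0 < 1 - t / 2 by lra.
have := closed_cts_q (fun x y xA _ => punctured_closed y fd t20 xA).
by apply; lra.
Qed.

(** Goursat's theorem on the polar rectangle [t, 1] x [-1, 1]: zeta takes opposite
values at 1 and - 1, where the even function f (z) + f (- z) agrees. *)
Lemma circle_mean_const f t : punctured_cdiff f -> 0 < t -> t < 1 ->
  circle_mean f t = circle_mean f 1.
Proof.
move=> fd t0 t1; have w0 : 0 < 1 - t by lra.
have := @goursat _ _ _ t (-1) _ _ w0 (ltr0n _ 2) (fun x y xA _ =>
  punctured_closed y fd t0 xA).
rewrite [t + _]addrC subrK => H; apply/esym/H.
by move=> x _; rewrite zeta1 zetaN1 mulrN opprK addrC.
Qed.

Definition total_wgt : R := itg (-1) (-1 + 2) wgt.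

Lemma wgt_cts : cts_on (-1) (-1 + 2) wgt.
Proof.
have := @circle_mean_cts (fun=> 2^-1%:C) 1 (fun z _ _ => cdiff_cst _ _) ltr01 (lexx 1).
have -> // : (fun s => Re (2^-1%:C + 2^-1%:C) * wgt s) = wgt.
by apply/funext => s /=; rewrite [_ + _ in X in X * _](_ : _ = 1) ?mul1r //; field.
Qed.

Lemma total_wgt_gt0 : 0 < total_wgt.
Proof.
apply: (@lt_le_trans _ _ (itg (-1) (-1 + 2) (fun=> 1 : R))).
  by rewrite itg_cst; lra.
apply: le_itg; [exact: cts_on_cst|exact: wgt_cts|move=> x x1].
rewrite /wgt ler_pdivlMr; last by rewrite ltr_pwDl // sqr_ge0.
by rewrite mul1r expr2; nra.
Qed.

Lemma circle_mean_le f t K : punctured_cdiff f -> 0 < t -> t <= 1 ->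
  (forall z, normc z = t -> Re (f z) <= K) -> circle_mean f t <= 2 * K * total_wgt.
Proof.
move=> fd t0 t1 fK; rewrite /total_wgt -itgZ; last exact: wgt_cts.
have cw : cts_on (-1) (-1 + 2) (fun s => 2 * K * wgt s).
  have := @circle_mean_cts (fun=> K%:C) 1 (fun z _ _ => cdiff_cst _ _) ltr01 (lexx 1).
  have -> // : (fun s => Re (K%:C + K%:C) * wgt s) = (fun s => 2 * K * wgt s).
  by apply/funext => s /=; ring.
apply: le_itg => // [|s _]; first exact: circle_mean_cts.
rewrite ler_wpM2r ?wgt_ge0 // raddfD /=.
have := fK _ (normc_polar s t0); have := fK (- (t%:C * zeta s)).
rewrite normcN normc_polar // => /(_ erefl); lra.
Qed.

Lemma circle_meanB f g t : punctured_cdiff f -> punctured_cdiff g -> 0 < t -> t <= 1 ->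
  circle_mean (fun z => f z - g z) t = circle_mean f t - circle_mean g t.
Proof.
move=> fd gd t0 t1; rewrite /circle_mean -itgB; [|exact: circle_mean_cts..].
apply: eq_itg => s _; rewrite -mulrBl -raddfB; congr (Re _ * _); ring.
Qed.

Lemma circle_mean_ge f t K : punctured_cdiff f -> 0 < t -> t <= 1 ->
  (forall z, normc z = t -> K <= Re (f z)) -> 2 * K * total_wgt <= circle_mean f t.
Proof.
move=> fd t0 t1 fK.
have zd : punctured_cdiff (fun=> 0) by move=> z _ _; exact: cdiff_cst.
have fd' : punctured_cdiff (fun z => 0 - f z) by move=> z z0 z1; apply: cdiffB; [exact: cdiff_cst|exact: fd].
have := @circle_mean_le (fun z => 0 - f z) t (- K) fd' t0 t1.
rewrite circle_meanB // [circle_mean (fun=> 0) t](_ : _ = 0); last first.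
  rewrite /circle_mean (@eq_itg _ _ _ _ (fun=> 0)) ?itg_cst ?mul0r //; first lra.
  by move=> s _; rewrite addr0 /= mul0r.
rewrite sub0r mulrN mulNr lerN2; apply => z /fK Kz.
by rewrite sub0r raddfN /= lerN2.
Qed.

Lemma circle_mean_scale f k t : punctured_cdiff f ->
  (forall z, f (t%:C * z) = k%:C * f (1%:C * z)) -> circle_mean f t = k * circle_mean f 1.
Proof.
move=> fd fk; rewrite /circle_mean -itgZ; last exact: circle_mean_cts.
by apply: eq_itg => s _; rewrite [RHS]mulrA -Re_realM mulrDr -!mulrN !fk.
Qed.

Lemma punctured_invX (c : R[i]) m : punctured_cdiff (fun z => c * (z ^+ m)^-1).
Proof.
move=> z z0 _; apply: cdiffM; first exact: cdiff_cst.
apply: cdiffV; first by rewrite expf_neq0 // -normc_gt0.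
by apply: cdiffX; exact: cdiff_id.
Qed.

(** A negative power of z has mean zero, because its mean is both independent
of the radius and homogeneous in it. *)
Lemma circle_mean_invX (c : R[i]) m : circle_mean (fun z => c * (z ^+ m.+1)^-1) 1 = 0.
Proof.
have h2 : (1 : R) < 2 ^+ m.+1 by rewrite exprn_egt1 // ltr1n.
have h1 : (2^-1 : R) < 1 by lra.
have h0 : 0 < (2^-1 : R) by lra.
have E := circle_mean_const (punctured_invX c m.+1) h0 h1.
have sc : circle_mean (fun z => c * (z ^+ m.+1)^-1) 2^-1 =
    2 ^+ m.+1 * circle_mean (fun z => c * (z ^+ m.+1)^-1) 1.
  apply: circle_mean_scale; first exact: punctured_invX.
  move=> z; rewrite !exprMn rmorph1 expr1n mul1r fmorphV exprVn invfM invrK rmorphXn.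
  by ring.
move: E sc; move: (circle_mean _ _) (circle_mean _ _) => u v -> E.
have : (2 ^+ m.+1 - 1) * u = 0 by rewrite mulrBl mul1r -E subrr.
by move/eqP; rewrite mulf_eq0 subr_eq0 gt_eqF //= => /eqP.
Qed.

(** Cauchy's estimate: subtracting from f / z^n its polar part leaves q, whose mean
over small circles is close to q (0); over the unit circle the polar part has
mean zero.  A rotation u reduces the modulus of q (0) to a real part. *)
Lemma coef_bound n (c : nat -> R[i]) f q M :
  (forall z, normc z <= 1 -> cdiff f z) ->
  (forall z, f z = \sum_(k < n) c k * z ^+ k + z ^+ n * q z) ->
  ccont q 0 -> (forall z, normc z = 1 -> normc (f z) <= M) -> normc (q 0) <= M.
Proof.
move=> fd fE cq fM.
suff main u : normc u = 1 -> Re (u * q 0) <= M.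
  by have [u u1 uq] := unimodular_rotation (q 0); have := main u u1; rewrite uq.
move=> u1; apply/ler_addgt0Pr => e e0.
pose G z := u * f z * (z ^+ n)^-1.
pose H j z := \sum_(k < j) u * c k * (z ^+ (n - k))^-1.
have Gd : punctured_cdiff G.
  move=> z z0 z1; apply: cdiffM.
    by apply: cdiffM; [exact: cdiff_cst|exact: fd].
  apply: cdiffV; first by rewrite expf_neq0 // -normc_gt0.
  by apply: cdiffX; exact: cdiff_id.
have Hd j : punctured_cdiff (H j).
  by move=> z z0 z1; apply: cdiff_sum => k; exact: punctured_invX.
have Hm j : (j <= n)%N -> circle_mean (H j) 1 = 0.
  elim: j => [|j IH] jn.
    rewrite (_ : H 0%N = fun=> 0); last by apply/funext => z; exact: big_ord0.
    rewrite /circle_mean (@eq_itg _ _ _ _ (fun=> 0)) ?itg_cst ?mul0r //; first lra.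
    by move=> s _; rewrite addr0 /= mul0r.
  have E : H j.+1 =1 fun z => H j z - (- (u * c j)) * (z ^+ (n - j))^-1.
    by move=> z; rewrite /H big_ord_recr /= mulNr opprK.
  rewrite (funext E) circle_meanB //; last exact: punctured_invX.
  rewrite IH ?(ltnW jn) // -(subnSK jn) circle_mean_invX subr0 //.
have Qd : punctured_cdiff (fun z => G z - H n z).
  by move=> z z0 z1; apply: cdiffB; [exact: Gd|exact: Hd].
have QE z : 0 < normc z -> G z - H n z = u * q z.
  rewrite normc_gt0 => z0; rewrite /G fE /H.
  have zn k : z ^+ k != 0 by rewrite expf_neq0.
  rewrite mulrDr mulrDl mulr_sumr mulr_suml -addrA addrC -addrA.
  rewrite [X in _ + X](_ : _ = 0) ?addr0; last first.
    apply/eqP; rewrite addrC subr_eq0; apply/eqP; apply: eq_bigr => k _.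
    rewrite -mulrA -[in RHS]mulrA; congr (u * _); rewrite -mulrA; congr (_ * _).
    have kn : (k <= n)%N := ltnW (ltn_ord k).
    by rewrite -{2}(subnKC kn) exprD; field; rewrite !zn.
  by field; rewrite zn.
have [d d0 qd] := cq e e0.
pose t := Num.min (d / 2) (2^-1).
have t0 : 0 < t by rewrite lt_min; apply/andP; split; lra.
have td : t < d.
  have : t <= d / 2 by rewrite ge_min lexx.
  lra.
have t1 : t < 1.
  have : t <= 2^-1 by rewrite ge_min lexx orbT.
  lra.
have W0 := total_wgt_gt0.
have lo : 2 * (Re (u * q 0) - e) * total_wgt <= circle_mean (fun z => G z - H n z) t.
  apply: circle_mean_ge => // [|z zt]; first exact: ltW.
  rewrite QE ?zt //; have : normc (z - 0) < d by rewrite subr0 zt.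
  move/qd; rewrite -[normc _]mul1r -u1 -normcM mulrBr => /ltW qe.
  have := le_trans (normc_geRe _) qe; rewrite raddfB /= ler_norml => /andP[]; lra.
have hi : circle_mean G 1 <= 2 * M * total_wgt.
  apply: circle_mean_le => // z z1.
  apply: le_trans (fM z z1); apply: le_trans (ler_norm _) _.
  apply: le_trans (normc_geRe _) _.
  by rewrite /G !normcM u1 normcV normcX z1 expr1n invr1 mul1r mulr1.
have E : circle_mean (fun z => G z - H n z) t = circle_mean G 1.
  by rewrite circle_mean_const // circle_meanB // Hm // subr0.
move: lo; rewrite E => /le_trans /(_ hi); rewrite ler_pM2r //; lra.
Qed.

End circle_mean.

(** * Maximum modulus, Schwarz and Taylor estimates on the disc *)

Section max_modulus.
Context {R : realType}.
Implicit Types (f g : R[i] -> R[i]) (z a b : R[i]) (s t M : R).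
Local Notation "x %:C" := (real_complex _ x).

Lemma conjcD z a : ((z + a)^*)%C = (z^*)%C + (a^*)%C.
Proof. exact: rmorphD. Qed.

Lemma conjcM z a : ((z * a)^*)%C = (z^*)%C * (a^*)%C.
Proof. exact: rmorphM. Qed.

Lemma conj_mul_normc z : z * (z^*)%C = (normc z ^+ 2)%:C.
Proof.
rewrite normc_sq; case: z => x y; apply/eqP.
by rewrite eq_complex /=; apply/andP; split; apply/eqP; ring.
Qed.

Lemma mobius_den_neq0 a z : normc a < 1 -> normc z <= 1 -> 1 + (a^*)%C * z != 0.
Proof.
move=> a1 z1; rewrite -normc_gt0.
have := ler_normc_sub 1 (- ((a^*)%C * z)); rewrite normcN normc1 opprK.
apply: lt_le_trans; rewrite subr_gt0 normcM normcJ'.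
have := normc_ge0 a; have := normc_ge0 z => z0 a0; nra.
Qed.

Lemma normc_mobius a z : normc a < 1 -> normc z <= 1 ->
  normc ((z + a) / (1 + (a^*)%C * z)) <= 1.
Proof.
move=> a1 z1; rewrite normcM normcV ler_pdivrMr ?normc_gt0 ?mobius_den_neq0 //.
rewrite mul1r -(@ler_pXn2r _ 2) ?nnegrE ?normc_ge0// -lecR -!conj_mul_normc.
rewrite !conjcD conjcM conjc1 conjcK.
rewrite (_ : (z + a) * _ = z * (z^*)%C + a * (a^*)%C + (z * (a^*)%C + a * (z^*)%C)); last by ring.
rewrite (_ : (1 + _) * _ = 1 + (z * (z^*)%C) * (a * (a^*)%C) + (z * (a^*)%C + a * (z^*)%C)); last by ring.
rewrite lerD2r !conj_mul_normc -rmorphM -rmorphD -(rmorph1 (real_complex R)) -rmorphD lecR.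
have zz : normc z ^+ 2 <= 1 by rewrite expr_le1 // normc_ge0.
have aa : normc a ^+ 2 <= 1 by rewrite expr_le1 ?normc_ge0 // ltW.
nra.
Qed.

Lemma normc_mobius1 a z : normc a < 1 -> normc z = 1 ->
  normc ((z + a) / (1 + (a^*)%C * z)) = 1.
Proof.
move=> a1 z1; have d0 : 1 + (a^*)%C * z != 0 by rewrite mobius_den_neq0 // z1.
rewrite normcM normcV.
suff -> : normc (z + a) = normc (1 + (a^*)%C * z) by rewrite divff // gt_eqF // normc_gt0.
have zz : z * (z^*)%C = 1 by rewrite conj_mul_normc z1 expr1n.
rewrite -[LHS]mulr1 -[X in _ * X]z1 -[X in _ * X]normcJ' -normcM -[LHS]normcJ'.
by rewrite conjcM conjcD conjcK mulrDl [(z^*)%C * z]mulrC zz.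
Qed.

(** The case n = 0 of coef_bound is the bound at the centre; a Moebius map of the
disc moves the centre to a. *)
Lemma max_modulus f M a : (forall z, normc z <= 1 -> cdiff f z) ->
  (forall z, normc z = 1 -> normc (f z) <= M) -> normc a < 1 -> normc (f a) <= M.
Proof.
move=> fd fM a1.
pose m z := (z + a) / (1 + (a^*)%C * z).
have md z : normc z <= 1 -> cdiff m z.
  move=> z1; apply: cdiffM; first by apply: cdiffD; [exact: cdiff_id|exact: cdiff_cst].
  apply: cdiffV; first exact: mobius_den_neq0.
  apply: cdiffD; first exact: cdiff_cst.
  by apply: cdiffM; [exact: cdiff_cst|exact: cdiff_id].
have fmd z : normc z <= 1 -> cdiff (fun z => f (m z)) z.
  by move=> z1; apply: cdiff_comp; [exact: md|apply: fd; exact: normc_mobius].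
have -> : a = m 0 by rewrite /m add0r mulr0 addr0 divr1.
apply: (@coef_bound _ 0 (fun=> 0) (fun z => f (m z)) (fun z => f (m z))) => //.
- by move=> z; rewrite big_ord0 add0r expr0 mul1r.
- by apply: cdiff_cont; apply: fmd; rewrite normc0.
- by move=> z z1; apply: fM; exact: normc_mobius1.
Qed.

(** The constants c and K disappear in m-th roots. *)
Lemma power_bound (c x K M : R) : 0 < c -> 0 <= x -> 0 <= M ->
  (forall m, c * x ^+ m <= K * M ^+ m) -> x <= M.
Proof.
move=> c0 x0 M0 H; rewrite leNgt; apply/negP => Mx.
have x1 : 0 < x by exact: le_lt_trans M0 Mx.
have K0 : 0 < K by have := H 0%N; rewrite !expr0 !mulr1; exact: lt_le_trans.
pose r := M / x; have r0 : 0 <= r by rewrite divr_ge0 // ltW.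
have r1 : r < 1 by rewrite ltr_pdivrMr // mul1r.
have := @cvg_geometric R K r; rewrite ger0_norm // => /(_ r1).
move=> /cvgrPdist_lt /(_ c c0) [n _ /(_ n (leqnn n))].
rewrite /geometric /= sub0r normrN ger0_norm ?mulr_ge0 ?exprn_ge0 ?(ltW K0) //.
rewrite /r expr_div_n mulrA ltr_pdivrMr ?exprn_gt0 // => /lt_le_trans.
by move=> /(_ _ (H n)); rewrite ltxx.
Qed.

(** Two points where f is only continuous do no harm: they are removed by
applying the principle to the products (z - b)(z - b') f(z)^m, with m large. *)
Lemma max_modulus_except f M a b b' : normc b <= 1 -> normc b' <= 1 ->
  (forall z, normc z <= 1 -> ccont f z) ->
  (forall z, normc z <= 1 -> z != b -> z != b' -> cdiff f z) ->
  (forall z, normc z = 1 -> normc (f z) <= M) -> normc a < 1 -> normc (f a) <= M.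
Proof.
move=> b1 b1' fc fd fM a1.
have M0 : 0 <= M by apply: le_trans (fM 1 (normc1 _)); exact: normc_ge0.
have step x : normc x < 1 -> x != b -> x != b' -> normc (f x) <= M.
  move=> x1 xb xb'.
  apply: (@power_bound (normc (x - b) * normc (x - b')) _ 4) => //.
  - by rewrite mulr_gt0 // normc_gt0 subr_eq0.
  - exact: normc_ge0.
  move=> m; pose k z := (z - b) * (z - b') * f z ^+ m.
  have -> : normc (x - b) * normc (x - b') * normc (f x) ^+ m = normc (k x).
    by rewrite /k !normcM normcX.
  apply: max_modulus => // z z1.
    have cB c : ccont (fun z => z - c) z by apply: ccontB; [exact: ccont_id|exact: ccont_cst].
    have dB c : cdiff (fun z => z - c) z by apply: cdiffB; [exact: cdiff_id|exact: cdiff_cst].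
    have [zb|zb] := eqVneq z b.
      exists ((z - b') * f z ^+ m), (fun z => (z - b') * f z ^+ m); split => //.
        by apply: ccontM => //; apply: ccontX; exact: fc.
      by move=> y; rewrite /k zb; ring.
    have [zb'|zb'] := eqVneq z b'.
      exists ((z - b) * f z ^+ m), (fun z => (z - b) * f z ^+ m); split => //.
        by apply: ccontM => //; apply: ccontX; exact: fc.
      by move=> y; rewrite /k zb'; ring.
    by apply: cdiffM; [exact: cdiffM|apply: cdiffX; exact: fd].
  rewrite /k !normcM normcX.
  have bd c : normc c <= 1 -> normc (z - c) <= 2.
    by move=> c1; have := le_normcD z (- c); rewrite normcN z1; lra.
  apply: ler_pM; rewrite ?mulr_ge0 ?exprn_ge0 ?normc_ge0 //.
    have -> : (4 : R) = 2 * 2 by ring.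
    by apply: ler_pM; rewrite ?normc_ge0 ?bd.
  by apply: lerXn2r; rewrite ?nnegrE ?normc_ge0 ?fM.
rewrite leNgt; apply/negP => Ma.
have e0 : 0 < normc (f a) - M by rewrite subr_gt0.
have [d d0 fa] := fc a (ltW a1) _ e0.
pose h := Num.min d (1 - normc a) / 4.
have h0 : 0 < h by rewrite divr_gt0 // lt_min d0 subr_gt0.
have m1 : Num.min d (1 - normc a) <= d by rewrite ge_min lexx.
have m2 : Num.min d (1 - normc a) <= 1 - normc a by rewrite ge_min lexx orbT.
have h1 : 4 * h <= d by rewrite /h; lra.
have h2 : 4 * h <= 1 - normc a by rewrite /h; lra.
(* If the bound failed at a it would fail nearby, so that three distinct points
   near a would all be equal to b or b'. *)
have bad (n : nat) : (0 < n <= 3)%N -> a + (n%:R * h)%:C = b \/ a + (n%:R * h)%:C = b'.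
  move=> n3; pose y := a + (n%:R * h)%:C.
  have n3' : 1 <= n%:R :> R /\ n%:R <= 3 :> R.
    by case/andP: n3 => n1 n3; rewrite (ler_nat R 1) (ler_nat R n 3).
  have nh : 0 <= n%:R * h by rewrite mulr_ge0 ?ler0n // ltW.
  have nh4 : n%:R * h < 4 * h by rewrite ltr_pM2r //; lra.
  have yd : normc (y - a) < d.
    by rewrite /y addrC addKr ger0_normcR //; lra.
  have y1 : normc y < 1.
    by apply: le_lt_trans (le_normcD _ _) _; rewrite ger0_normcR //; lra.
  have [|yb] := eqVneq y b; first by left.
  have [|yb'] := eqVneq y b'; first by right.
  have := step y y1 yb yb'; have := fa y yd.
  have := ler_normc_sub (f a) (f y); rewrite normc_sub => u1 u2 u3; exfalso; lra.
have sep (n n' : nat) : a + (n%:R * h)%:C = a + (n'%:R * h)%:C -> n = n'.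
  move=> /addrI/complexI/(mulIf (lt0r_neq0 h0))/eqP.
  by rewrite eqr_nat => /eqP.
have [e1|e1] := bad 1%N isT; have [e2|e2] := bad 2%N isT; have [e3|e3] := bad 3%N isT;
  do ?[by have := sep 1%N 2%N; rewrite e1 e2 => /(_ erefl)
      |by have := sep 1%N 3%N; rewrite e1 e3 => /(_ erefl)
      |by have := sep 2%N 3%N; rewrite e2 e3 => /(_ erefl)].
Qed.

Lemma quotient_cdiff (f phi : R[i] -> R[i]) b z : z != b -> cdiff f z ->
  (forall y, f y = f b + (y - b) * phi y) -> cdiff phi z.
Proof.
move=> zb fd fE; have n0 : 0 < normc (z - b) by rewrite normc_gt0 subr_eq0.
apply: (@cdiff_near _ _ (fun y => (f y - f b) / (y - b)) _ _ n0).
  move=> y yz; have yb : y != b by apply: contraTneq yz => ->; rewrite normc_sub ltxx.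
  by rewrite [f y]fE [f b + _]addrC addrK mulrC mulKf // subr_eq0.
apply: cdiffM; first by apply: cdiffB => //; exact: cdiff_cst.
apply: cdiffV; first by rewrite subr_eq0.
by apply: cdiffB; [exact: cdiff_id|exact: cdiff_cst].
Qed.

Lemma quotient_ccont (f phi : R[i] -> R[i]) b z : z != b -> ccont f z ->
  (forall y, f y = f b + (y - b) * phi y) -> ccont phi z.
Proof.
move=> zb fd fE; have n0 : 0 < normc (z - b) by rewrite normc_gt0 subr_eq0.
apply: (@ccont_near _ _ (fun y => (f y - f b) / (y - b)) _ _ n0).
  move=> y yz; have yb : y != b by apply: contraTneq yz => ->; rewrite normc_sub ltxx.
  by rewrite [f y]fE [f b + _]addrC addrK mulrC mulKf // subr_eq0.
apply: ccontM; first by apply: ccontB => //; exact: ccont_cst.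
apply: ccontV; first by rewrite subr_eq0.
by apply: ccontB; [exact: ccont_id|exact: ccont_cst].
Qed.

Lemma eq_ler (x y : R) : x = y -> x <= y. Proof. by move=> ->. Qed.

Section schwarz.

Variables (f : R[i] -> R[i]) (M : R).
Hypotheses (fd : forall z, normc z <= 1 -> cdiff f z)
  (fM : forall z, normc z <= 1 -> normc (f z) <= M).

(** The difference quotient at 0 is bounded by 2 M on the unit circle, and the
maximum principle applies to it in spite of the exceptional point 0. *)
Lemma schwarz_quot (phi : R[i] -> R[i]) a : ccont phi 0 ->
  (forall z, f z = f 0 + (z - 0) * phi z) -> normc a <= 1 -> normc (phi a) <= 2 * M.
Proof.
move=> cphi fE.
have on1 z : normc z = 1 -> normc (phi z) <= 2 * M.
  move=> z1; have : normc (f z - f 0) <= 2 * M.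
    have := le_normcD (f z) (- f 0); rewrite normcN => /le_trans; apply.
    have := fM (eq_ler z1); have : normc (f 0) <= M by apply: fM; rewrite normc0.
    lra.
  by rewrite fE addrAC subrr add0r subr0 normcM z1 mul1r.
rewrite le_eqVlt => /predU1P[/on1//|a1].
apply: (@max_modulus_except phi (2 * M) a 0 0); rewrite ?normc0 //.
  move=> z z1; have [->//|z0] := eqVneq z 0.
  by apply: quotient_ccont fE => //; apply: cdiff_cont; exact: fd.
by move=> z z1 z0 _; apply: quotient_cdiff fE => //; exact: fd.
Qed.

(** The difference quotient phi at 0 is Lipschitz: the maximum principle bounds its
own difference quotients at points b distinct from 0, and b then tends to 0. *)
Lemma schwarz_second d a : cderiv f 0 d -> normc a < 1 ->
  normc (f a - f 0 - a * d) <= 8 * M * normc a ^+ 2.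
Proof.
move=> [phi [cphi <- fE]] a1.
have M0 : 0 <= M by apply: le_trans (fM (eq_ler (normc1 _))); exact: normc_ge0.
have pc z : normc z <= 1 -> ccont phi z.
  move=> z1; have [->//|z0] := eqVneq z 0.
  by apply: quotient_ccont fE => //; apply: cdiff_cont; exact: fd.
have pd z : normc z <= 1 -> z != 0 -> cdiff phi z.
  by move=> z1 z0; apply: quotient_cdiff fE => //; exact: fd.
have lip b : b != 0 -> normc b <= 2^-1 -> normc (phi a - phi b) <= 8 * M * normc (a - b).
  move=> b0 bh; have b1 : normc b <= 1 by lra.
  have [d' [psi [cpsi _ pE]]] := pd b b1 b0.
  rewrite pE addrAC subrr add0r normcM mulrC ler_wpM2r ?normc_ge0 //.
  apply: (@max_modulus_except psi _ a 0 b); rewrite ?normc0 //.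
  - move=> z z1; have [->//|zb] := eqVneq z b.
    by apply: quotient_ccont pE => //; exact: pc.
  - by move=> z z1 z0 zb; apply: quotient_cdiff pE => //; exact: pd.
  - move=> z z1.
    have h : normc (phi z - phi b) <= 4 * M.
      have := le_normcD (phi z) (- phi b); rewrite normcN => /le_trans; apply.
      have := schwarz_quot cphi fE (eq_ler z1); have := schwarz_quot cphi fE b1; lra.
    have zb : 2^-1 <= normc (z - b) by have := ler_normc_sub z b; rewrite z1; lra.
    move: h; rewrite pE addrAC subrr add0r normcM => h.
    by have := normc_ge0 (psi z); nra.
have lip0 : normc (phi a - phi 0) <= 8 * M * normc a.
  apply/ler_addgt0Pr => e e0.
  have e2 : 0 < e / 2 by lra.
  have [r r0 pr] := cphi _ e2.
  pose t := Num.min (Num.min (r / 2) (2^-1)) (e / 2 / (8 * M + 1)).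
  have N0 : 0 < 8 * M + 1 by lra.
  have t0 : 0 < t by rewrite !lt_min; apply/andP; split; [apply/andP; split; lra|exact: divr_gt0].
  have t1 : t <= r / 2 by rewrite !ge_min lexx.
  have t2 : t <= 2^-1 by rewrite !ge_min lexx orbT.
  have t3 : t * (8 * M + 1) <= e / 2 by rewrite -ler_pdivlMr // !ge_min lexx orbT.
  have nt : normc t%:C = t by rewrite ger0_normcR // ltW.
  have tC : t%:C != 0 :> R[i] by rewrite -normc_gt0 nt.
  have := lip _ tC; rewrite nt => /(_ t2) h1.
  have h2 : normc (phi t%:C - phi 0) < e / 2 by apply: pr; rewrite subr0 nt; lra.
  have h3 : normc (a - t%:C) <= normc a + t by have := le_normcD a (- t%:C); rewrite normcN nt.
  have := le_normcD (phi a - phi t%:C) (phi t%:C - phi 0); rewrite addrA subrK.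
  nra.
have -> : f a - f 0 - a * phi 0 = a * (phi a - phi 0) by rewrite {1}[f a]fE; ring.
by rewrite normcM expr2 mulrA [normc a * _]mulrC ler_wpM2r ?normc_ge0.
Qed.

End schwarz.

Lemma real_derive (F : R -> R) (x d : R) :
  (forall e, 0 < e -> exists2 r, 0 < r & forall y, `|y - x| < r ->
     `|F y - F x - (y - x) * d| <= e * `|y - x|) -> is_derive x 1 F d.
Proof.
move=> Fd; have h : (fun h => h^-1 *: (F (h *: 1 + x) - F x)) @ 0^' --> d.
  apply/cvgrPdist_le => e e0; have [r r0 Fr] := Fd e e0.
  near=> h; have h0 : h != 0 by near: h; exact: nbhs_dnbhs_neq.
  have hr : `|h| < r.
    near: h; apply: dnbhs0_lt; exact: r0.
  have := Fr (h + x); rewrite addrK => /(_ hr) H.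
  rewrite distrC (_ : _ - d = h^-1 * (F (h + x) - F x - h * d)); last first.
    by rewrite /GRing.scale /= mulr1; field.
  by rewrite normrM normfV ler_pdivrMl ?normr_gt0 // [_ * e]mulrC.
split; first by apply/cvg_ex; exists d; exact: h.
exact: cvg_lim h.
Unshelve. all: by end_near. Qed.

(** The mean value theorem along [0, a], applied to a real part after a rotation
which makes g a - g 0 real. *)
Lemma mean_value_ineq (g g' : R[i] -> R[i]) K a :
  (forall t, 0 <= t <= 1 -> cderiv g (t%:C * a) (g' (t%:C * a))) ->
  (forall t, 0 <= t <= 1 -> normc (g' (t%:C * a)) <= K) ->
  normc (g a - g 0) <= K * normc a.
Proof.
move=> gd gK; have [u u1 ug] := unimodular_rotation (g a - g 0).
pose F t := complex.Re (u * g (t%:C * a)).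
have Fd t : 0 <= t <= 1 -> is_derive t 1 F (complex.Re (u * (a * g' (t%:C * a)))).
  move=> t01; apply: real_derive => e e0.
  have e1 : 0 < e / (normc a + 1) by rewrite divr_gt0 // ltr_wpDl ?normc_ge0.
  have /cderivP /(_ _ e1) [r r0 gr] := gd t t01.
  exists (r / (normc a + 1)) => [|y yt].
    by rewrite divr_gt0 // ltr_wpDl ?normc_ge0.
  have a1 : 0 < normc a + 1 by rewrite ltr_wpDl ?normc_ge0.
  have n1 : normc (y%:C * a - t%:C * a) = `|y - t| * normc a.
    by rewrite -mulrBl -rmorphB normcM normcR.
  have ya : normc (y%:C * a - t%:C * a) < r.
    rewrite n1; move: yt; rewrite ltr_pdivlMr //; have := normr_ge0 (y - t); nra.
  have -> : F y - F t - (y - t) * complex.Re (u * (a * g' (t%:C * a))) =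
     complex.Re (u * (g (y%:C * a) - g (t%:C * a) - (y%:C * a - t%:C * a) * g' (t%:C * a))).
    rewrite -Re_realM -!raddfB; congr (complex.Re _); rewrite rmorphB; ring.
  apply: le_trans (normc_geRe _) _; rewrite normcM u1 mul1r.
  apply: le_trans (gr _ ya) _; rewrite n1 mulrCA mulrC.
  by rewrite ler_wpM2r // mulrAC ler_pdivrMr // ler_pM2l // lerDl.
have F01 : F 1 - F 0 = normc (g a - g 0).
  by rewrite /F -raddfB rmorph1 mul1r rmorph0 mul0r -mulrBr ug.
have [||c c01] := @MVT _ F (fun t => complex.Re (u * (a * g' (t%:C * a)))) 0 1 ltr01.
- by move=> x; rewrite in_itv /= => /andP[x0 x1]; apply: Fd; rewrite !ltW.
- apply: derivable_within_continuous => x; rewrite in_itv /= => x01.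
  by have [] := Fd x x01.
rewrite F01 subr0 mulr1 => ->.
apply: le_trans (ler_norm _) _; apply: le_trans (normc_geRe _) _.
rewrite !normcM u1 mul1r mulrC ler_wpM2r ?normc_ge0 // gK //.
by move: c01; rewrite in_itv /= => /andP[c0 c1]; rewrite !ltW.
Qed.

Section taylor.
Variables (ph : nat -> R[i] -> R[i]).

Let T n m z : R[i] := \sum_(k < n) ph (m + k)%N 0 / k`!%:R * z ^+ k.

(** By induction on the order, through the mean value inequality for the remainder
of ph m, whose derivative is the remainder of ph m.+1. *)
Lemma taylor_peano (rho : R) : 0 < rho ->
  (forall n z, normc z < rho -> cderiv (ph n) z (ph n.+1 z)) ->
  forall n m e, 0 < e -> exists2 d, 0 < d & forall z, normc z < d ->
    normc (ph m z - T n.+1 m z) <= e * normc z ^+ n.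
Proof.
move=> rho0 pd; elim=> [|n IH] m e e0.
  have c0 : ccont (ph m) 0 by apply: cdiff_cont; exists (ph m.+1 0); apply: pd; rewrite normc0.
  have [d d0 pm] := c0 e e0; exists d => // z zd.
  rewrite /T big_ord1 addn0 fact0 divr1 !expr0 !mulr1.
  by apply/ltW/pm; rewrite subr0.
have [d d0 Hd] := IH m.+1 e e0.
exists (Num.min d rho) => [|z]; first by rewrite lt_min d0.
rewrite lt_min => /andP[zd zr].
have T0 : ph m 0 - T n.+2 m 0 = 0.
  rewrite /T big_ord_recl big1; last by move=> i _; rewrite expr0n mulr0.
  by rewrite addn0 fact0 divr1 expr0 mulr1 addr0 subrr.
have := @mean_value_ineq (fun z => ph m z - T n.+2 m z)
  (fun z => ph m.+1 z - T n.+1 m.+1 z) (e * normc z ^+ n) z.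
rewrite T0 subr0 exprSr mulrA; apply => t /andP[t0 t1].
  have tz : normc (t%:C * z) <= normc z.
    by rewrite normcM ger0_normcR //; have := normc_ge0 z; nra.
  apply: cderivD; first by apply: pd; exact: le_lt_trans zr.
  apply: cderivN; rewrite /T.
  have sumd (N : nat) (c : nat -> R[i]) (y : R[i]) :
      cderiv (fun z => \sum_(k < N.+1) c k * z ^+ k) y
        (\sum_(k < N) c k.+1 * (k.+1%:R * y ^+ k)).
    elim: N => [|N IHN].
      rewrite big_ord0; apply: (@cderiv_near _ _ (fun=> c 0%N) _ _ 1) => //.
        by move=> w _; rewrite big_ord1 expr0 mulr1.
      exact: cderiv_cst.
    apply: (@cderiv_near _ _ (fun z => \sum_(k < N.+1) c k * z ^+ k + c N.+1 * z ^+ N.+1) _ _ 1) => //.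
      by move=> w _; rewrite [LHS]big_ord_recr.
    rewrite big_ord_recr /=; apply: cderivD => //.
    have := cderivM (cderiv_cst (c N.+1) y) (_ : cderiv (fun z => z ^+ N.+1) y (N.+1%:R * y ^+ N)).
    rewrite mul0r add0r; apply.
    elim: (N) => [|k IHk].
      rewrite mul1r expr0; exact: cderiv_id.
    have := cderivM (cderiv_id y) IHk.
    have -> : 1 * y ^+ k.+1 + y * (k.+1%:R * y ^+ k) = k.+2%:R * y ^+ k.+1.
      by rewrite -[in RHS]addn1 natrD !exprS; ring.
    by apply: cderiv_near ltr01 _ => w _; rewrite exprS.
  set rhs := (X in cderiv _ _ X).
  have -> : rhs = \sum_(k < n.+1) (ph (m + k.+1)%N 0 / (k.+1)`!%:R) * (k.+1%:R * (t%:C * z) ^+ k).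
    rewrite /rhs; apply: eq_bigr => k _; rewrite addSnnS mulrA; congr (_ * _).
    rewrite factS natrM; field.
    by rewrite nat1r !pnatr_eq0 /= andbT -lt0n fact_gt0.
  exact: (sumd n.+1 (fun k => ph (m + k)%N 0 / k`!%:R)).
have tz : normc (t%:C * z) <= normc z.
  by rewrite normcM ger0_normcR //; have := normc_ge0 z; nra.
apply: le_trans (Hd _ _) _; first exact: le_lt_trans zd.
by rewrite ler_pM2l // lerXn2r // nnegrE normc_ge0.
Qed.

Hypothesis pd : forall n z, normc z <= 1 -> cderiv (ph n) z (ph n.+1 z).
Variable M : R.
Hypothesis pM : forall z, normc z <= 1 -> normc (ph 0 z) <= M.

Let c k : R[i] := ph k 0 / k`!%:R.
Let q n z : R[i] := if z == 0 then c n else (ph 0 z - \sum_(k < n) c k * z ^+ k) / z ^+ n.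

Let qE n z : ph 0 z = \sum_(k < n) c k * z ^+ k + z ^+ n * q n z.
Proof.
rewrite /q; case: eqVneq => [->|z0].
  case: n => [|n]; first by rewrite big_ord0 add0r expr0 mul1r /c fact0 divr1.
  rewrite exprS !mul0r addr0 big_ord_recl big1; last by move=> i _; rewrite exprS mul0r mulr0.
  by rewrite expr0 mulr1 addr0 /c fact0 divr1.
by rewrite mulrC divfK ?expf_neq0 // addrC subrK.
Qed.

Let q_cont n : ccont (q n) 0.
Proof.
move=> e e0; have e2 : 0 < e / 2 by lra.
have [d d0 pe] := taylor_peano ltr01 (fun k (z : R[i]) (z1 : normc z < 1) => @pd k z (ltW z1)) n 0 e2.
exists d => // z; rewrite subr0 => zd; rewrite /q eqxx.
case: eqVneq => [_|z0]; first by rewrite subrr normc0.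
have := pe z zd; rewrite /T big_ord_recr /=.
under eq_bigr do rewrite add0n -/(c _); rewrite add0n -/(c _) => h.
have -> : (ph 0 z - \sum_(k < n) c k * z ^+ k) / z ^+ n - c n =
  (ph 0 z - (\sum_(k < n) c k * z ^+ k + c n * z ^+ n)) / z ^+ n.
  by field; rewrite expf_neq0.
rewrite normcM normcV normcX ltr_pdivrMr ?exprn_gt0 ?normc_gt0 //.
apply: le_lt_trans h _; rewrite ltr_pM2r ?exprn_gt0 ?normc_gt0 //; lra.
Qed.

Lemma taylor_coef_bound n : normc (ph n 0 / n`!%:R) <= M.
Proof.
have -> : ph n 0 / n`!%:R = q n 0 by rewrite /q eqxx.
apply: (@coef_bound _ n c (ph 0) (q n)) => //; first by move=> z z1; exists (ph 1 z); exact: pd.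
by move=> z z1; apply: pM; rewrite z1.
Qed.

(** The remainder divided by z^n is holomorphic outside 0, continuous at 0, and at
most (n + 1) M on the unit circle. *)
Lemma taylor_remainder n a : normc a < 1 ->
  normc (ph 0 a - \sum_(k < n) ph k 0 / k`!%:R * a ^+ k) <= n.+1%:R * M * normc a ^+ n.
Proof.
move=> a1; rewrite -/(c _) (qE n a) [X in X - _]addrC addrK normcM normcX mulrC.
rewrite ler_wpM2r ?exprn_ge0 ?normc_ge0 //.
have qd z : normc z <= 1 -> z != 0 -> cdiff (q n) z.
  move=> z1 z0; apply: (@cdiff_near _ _
     (fun z => (ph 0 z - \sum_(k < n) c k * z ^+ k) / z ^+ n) _ (normc z)).
  - by rewrite normc_gt0.
  - move=> y yz; rewrite /q; case: eqVneq => // y0.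
    by move: yz; rewrite y0 sub0r normcN ltxx.
  apply: cdiffM.
    apply: cdiffB; first by exists (ph 1 z); exact: pd.
    apply: cdiff_sum => k; apply: cdiffM; first exact: cdiff_cst.
    by apply: cdiffX; exact: cdiff_id.
  by apply: cdiffV; [exact: expf_neq0|apply: cdiffX; exact: cdiff_id].
apply: (@max_modulus_except _ _ _ 0 0); rewrite ?normc0 //.
- by move=> z z1; have [->//|z0] := eqVneq z 0; apply: cdiff_cont; exact: qd.
- by move=> z z1 z0 _; exact: qd.
move=> z z1; have z0 : z != 0 by rewrite -normc_gt0 z1.
rewrite /q (negbTE z0) normcM normcV normcX z1 expr1n invr1 mulr1.
apply: le_trans (le_normcD _ _) _; rewrite normcN -addn1 natrD mulrDl mul1r addrC.
apply: lerD; last by apply: pM; rewrite z1.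
apply: le_trans (normc_sum _ _ _) _.
rewrite (_ : n%:R * M = \sum_(k < n) M); last by rewrite sumr_const card_ord mulr_natl.
apply: ler_sum => k _; rewrite normcM normcX z1 expr1n mulr1.
exact: taylor_coef_bound.
Qed.

End taylor.

End max_modulus.

(** * Limits along ultrafilters *)

Section ultralimit.
Context {R : realType} {T : Type}.
Implicit Types (G : set_system T) (f g : T -> R[i]) (l : R[i]).

Definition ucvg G f l := forall e : R, 0 < e -> G [set t | normc (f t - l) < e].

Lemma ucvg_cst G c : Filter G -> ucvg G (fun=> c) c.
Proof.
by move=> FG e e0; apply: filterS filterT => t _ /=; rewrite subrr normc0.
Qed.

Lemma ucvgD G f g l l' : Filter G -> ucvg G f l -> ucvg G g l' ->
  ucvg G (fun t => f t + g t) (l + l').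
Proof.
move=> FG fl gl e e0; have e2 : 0 < e / 2 by lra.
apply: filterS2 (fl _ e2) (gl _ e2) => t /= ft gt.
rewrite (_ : _ - _ = (f t - l) + (g t - l')); last by ring.
by apply: le_lt_trans (le_normcD _ _) _; lra.
Qed.

Lemma ucvg_near_cont G f l (h : R[i] -> R[i]) : Filter G -> ccont h l ->
  ucvg G f l -> ucvg G (fun t => h (f t)) (h l).
Proof.
move=> FG ch fl e e0; have [d d0 hd] := ch e e0.
by apply: filterS (fl d d0) => t /= /hd.
Qed.

Lemma ucvgZ G f l c : Filter G -> ucvg G f l -> ucvg G (fun t => c * f t) (c * l).
Proof.
move=> FG; apply: (@ucvg_near_cont G f l (fun z => c * z)).
by apply: ccontM; [exact: ccont_cst|exact: ccont_id].
Qed.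

Lemma ucvgN G f l : Filter G -> ucvg G f l -> ucvg G (fun t => - f t) (- l).
Proof.
by move=> FG; apply: (@ucvg_near_cont G f l -%R); apply: ccontN; exact: ccont_id.
Qed.

Lemma ucvgB G f g l l' : Filter G -> ucvg G f l -> ucvg G g l' ->
  ucvg G (fun t => f t - g t) (l - l').
Proof. by move=> FG fl gl; apply: ucvgD => //; exact: ucvgN. Qed.

Lemma ucvg_eq G f g l : Filter G -> G [set t | f t = g t] -> ucvg G g l -> ucvg G f l.
Proof.
by move=> FG fg gl e e0; apply: filterS2 fg (gl e e0) => t /= ->.
Qed.

Lemma ucvg_le G f l K : ProperFilter G -> ucvg G f l ->
  G [set t | normc (f t) <= K] -> normc l <= K.
Proof.
move=> PG fl fK; apply/ler_addgt0Pr => e e0.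
have [t [/= tl tK]] := filter_ex (filterI (fl e e0) fK).
have := ler_normc_sub l (f t); rewrite normc_sub; lra.
Qed.

Lemma ucvg_uniq G f l l' : ProperFilter G -> ucvg G f l -> ucvg G f l' -> l = l'.
Proof.
move=> PG fl fl'; have d := ucvgB (@filter_filter _ G PG) fl fl'.
have : normc (l - l') <= 0.
  apply: (@ucvg_le G _ _ 0 PG d); apply: filterS filterT => t _ /=.
  by rewrite subrr normc0.
move=> h; apply/eqP; rewrite -subr_eq0; apply/eqP/eq0_normc.
by apply/eqP; rewrite eq_le h normc_ge0.
Qed.

Lemma ucvgM G f g l l' : Filter G -> ucvg G f l -> ucvg G g l' ->
  ucvg G (fun t => f t * g t) (l * l').
Proof.
move=> FG fl gl e e0; pose N := 1 + normc l + normc l'.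
have N1 : 1 <= N by rewrite /N; have := normc_ge0 l; have := normc_ge0 l'; lra.
have N0 : 0 < N by lra.
pose r := Num.min 1 (e / N); have r0 : 0 < r by rewrite lt_min ltr01 divr_gt0.
have r1 : r <= 1 by rewrite ge_min lexx.
have rN : r * N <= e by rewrite -ler_pdivlMr // ge_min lexx orbT.
apply: filterS2 (fl _ r0) (gl _ r0) => t /= ft gt; apply: lt_le_trans rN.
rewrite (_ : _ - _ = (f t - l) * (g t - l') + l * (g t - l') + (f t - l) * l'); last by ring.
apply: le_lt_trans (le_normcD _ _) _; rewrite normcM.
apply: (@le_lt_trans _ _ (normc (f t - l) * normc (g t - l') +
    normc l * normc (g t - l') + normc (f t - l) * normc l')).
  by rewrite lerD2r; apply: le_trans (le_normcD _ _) _; rewrite !normcM.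
move: ft gt; have := normc_ge0 l; have := normc_ge0 l'.
have := normc_ge0 (f t - l); have := normc_ge0 (g t - l'); rewrite /N.
set A := normc (f t - _); set B := normc (g t - _).
set F := normc l; set H := normc l' => B0 A0 H0 F0 Ar Br.
have AB : A * B < r.
  apply: (@le_lt_trans _ _ (A * 1)); last by rewrite mulr1.
  by rewrite ler_wpM2l //; lra.
have : F * B <= F * r by rewrite ler_wpM2l // ltW.
have : A * H <= r * H by rewrite ler_wpM2r // ltW.
by lra.
Qed.

(** The limit is the supremum of the numbers that are below f on a member of G. *)
Lemma ultra_real_lim G (f : T -> R) (K : R) : UltraFilter G ->
  G [set t | `|f t| <= K] -> exists l : R, forall e, 0 < e -> G [set t | `|f t - l| < e].
Proof.
move=> UG fK; have PG : ProperFilter G by exact: ultra_proper.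
pose S := [set a | G [set t | a <= f t]].
have SK : S (- K).
  by apply: filterS fK => t /=; rewrite ler_norml => /andP[].
have ubS : ubound S K.
  move=> a Sa; have [t [/= + /=]] := filter_ex (filterI Sa fK).
  by rewrite ler_norml => at_ /andP[_]; exact: le_trans.
have hS : has_sup S by split; [exists (- K)|exists K].
exists (sup S) => e e0.
have [a Sa ae] := sup_adherent e0 hS.
have [|ne] := in_ultra_setVsetC [set t | sup S + e <= f t] UG.
  move=> Sb; have : sup S + e <= sup S by apply: ub_le_sup => //; exact: hS.2.
  lra.
apply: filterS2 Sa ne => t /= at_ /negP; rewrite -ltNge => te.
by rewrite ltr_norml; apply/andP; split; lra.
Qed.

Lemma ucvg_ex G f K : UltraFilter G -> G [set t | normc (f t) <= K] ->
  exists l, ucvg G f l.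
Proof.
move=> UG fK; have PG : ProperFilter G by exact: ultra_proper.
have [|a ha] := @ultra_real_lim G (fun t => complex.Re (f t)) K UG.
  by apply: filterS fK => t /=; apply: le_trans; exact: normc_geRe.
have [|b hb] := @ultra_real_lim G (fun t => complex.Im (f t)) K UG.
  by apply: filterS fK => t /=; apply: le_trans; exact: normc_geIm.
exists (Complex a b) => e e0; have e2 : 0 < e / 2 by lra.
apply: filterS2 (ha _ e2) (hb _ e2) => t /= ta tb.
have -> : f t - Complex a b = (complex.Re (f t) - a)%:C%C +
    (Complex 0 1) * (complex.Im (f t) - b)%:C%C.
  by case: (f t) => x y; apply/eqP; rewrite eq_complex /=; apply/andP; split; apply/eqP; ring.
apply: le_lt_trans (le_normcD _ _) _; rewrite normcM !normcR.
have -> : normc (Complex 0 1 : R[i]) = 1 by rewrite /normc /= expr0n expr1n add0r sqrtr1.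
lra.
Qed.

End ultralimit.

(** * Real-valued norms and Frechet differentials *)

Section rnorm.
Context {R : realType} {E : normedModType R[i]}.
Implicit Types (x y h k : E) (c : R[i]).
Local Notation "x %:C" := (real_complex _ x).

Definition rnorm x : R := complex.Re `|x|.

Lemma rnormE x : `|x| = (rnorm x)%:C.
Proof. by rewrite /rnorm RRe_real // ger0_real. Qed.

Lemma normcE' (z : R[i]) : `|z : R[i]^o| = (normc z)%:C.
Proof. by []. Qed.

Lemma rnorm_ge0 x : 0 <= rnorm x.
Proof. by rewrite -ler0c -rnormE. Qed.

Lemma rnorm0 : rnorm 0 = 0.
Proof. by rewrite /rnorm normr0. Qed.

Lemma rnormN x : rnorm (- x) = rnorm x.
Proof. by rewrite /rnorm normrN. Qed.

Lemma rnorm_sub x y : rnorm (x - y) = rnorm (y - x).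
Proof. by rewrite -rnormN opprB. Qed.

Lemma rnormD x y : rnorm (x + y) <= rnorm x + rnorm y.
Proof. by have := ler_normD x y; rewrite !rnormE -rmorphD lecR. Qed.

Lemma rnormZ c x : rnorm (c *: x) = normc c * rnorm x.
Proof.
by apply: (@complexI R); rewrite -[LHS]rnormE normrZ rnormE [RHS]rmorphM.
Qed.

Lemma rnormZR (t : R) x : 0 <= t -> rnorm (t%:C *: x) = t * rnorm x.
Proof. by move=> t0; rewrite rnormZ ger0_normcR. Qed.

Lemma rnorm_eq0 x : rnorm x = 0 -> x = 0.
Proof. by move=> x0; apply/eqP; rewrite -normr_eq0 rnormE x0. Qed.

Lemma rnorm_gt0 x : (0 < rnorm x) = (x != 0).
Proof.
rewrite lt_def rnorm_ge0 andbT; congr negb; apply/eqP/eqP => [/rnorm_eq0//|->].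
exact: rnorm0.
Qed.

Lemma rnormB_ge x y : rnorm x - rnorm y <= rnorm (x - y).
Proof. by have := rnormD (x - y) y; rewrite subrK => ?; lra. Qed.

Lemma nbhs_rnormP x (P : set E) : nbhs x P <->
  exists2 r : R, 0 < r & forall y, rnorm (y - x) < r -> P y.
Proof.
split=> [/nbhs_ballP[e /= e0 eP]|[r r0 rP]].
  have eE : e = (complex.Re e)%:C by rewrite RRe_real // gtr0_real.
  exists (complex.Re e) => [|y yx]; first by rewrite -ltcR -eE.
  by apply: eP; rewrite -ball_normE /= distrC rnormE eE ltcR.
apply/nbhs_ballP; exists r%:C => /=; first by rewrite ltcR.
by move=> y; rewrite -ball_normE /= distrC rnormE ltcR; exact: rP.
Qed.

Lemma open_rnorm (U : set E) : open U -> forall x, U x ->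
  exists2 r : R, 0 < r & forall y, rnorm (y - x) < r -> U y.
Proof.
by move=> oU x Ux; apply/nbhs_rnormP; apply: open_nbhs_nbhs; split.
Qed.

Definition lin (L : E -> R[i]) := forall c u v, L (c *: u + v) = c * L u + L v.

Lemma lin0 L : lin L -> L 0 = 0.
Proof.
by move=> /(_ 1 0 0); rewrite scale1r addr0 mul1r => /esym/eqP; rewrite addrC -subr_eq0 addrK => /eqP.
Qed.

Lemma linZ L c u : lin L -> L (c *: u) = c * L u.
Proof. by move=> lL; have := lL c u 0; rewrite lin0 // !addr0. Qed.

Lemma linD L u v : lin L -> L (u + v) = L u + L v.
Proof. by move=> lL; have := lL 1 u v; rewrite scale1r mul1r. Qed.

Definition fder (f : E -> R[i]) x L := [/\ lin L,
  exists K, forall h, normc (L h) <= K * rnorm h &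
  forall e, 0 < e -> exists2 r : R, 0 < r & forall h, rnorm h < r ->
    normc (f (x + h) - f x - L h) <= e * rnorm h].

Lemma differentiable_fder (f : E -> R[i]^o) x : differentiable f x <-> exists L, fder f x L.
Proof.
split=> [df|[L [lL [K LK] fL]]].
  have /diff_locallyP[dc /eqaddoP dE] := df; exists ('d f x); split.
  - by move=> c u v; rewrite linearP.
  - have [k k0 dk] := linear_lipschitz dc; exists (complex.Re k) => h.
    have kE : k = (complex.Re k)%:C by rewrite RRe_real // gtr0_real.
    by have := dk h; rewrite kE normcE' rnormE -rmorphM lecR.
  - move=> e e0; have eC : 0 < e%:C by rewrite ltcR.
    have /nbhs_rnormP[r r0 rP] := dE _ eC; exists r => // h hr.
    have := rP h; rewrite subr0 => /(_ hr) /=.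
    rewrite rnormE normcE' -rmorphM lecR; congr (normc _ <= _).
    by rewrite -[LHS]/(f (h + x) - (f x + 'd f x h)) opprD addrA [h + x]addrC.
pose LL : {linear E -> R[i]^o} := HB.pack (L : E -> R[i]^o)
  (GRing.isLinear.Build R[i] E R[i]^o *:%R (L : E -> R[i]^o) lL).
have LLc : continuous LL.
  apply: bounded_linear_continuous; apply/ex_bound; exists (`|K|%:C).
  apply/nbhs_rnormP; exists 1 => // h; rewrite subr0 => h1 /=.
  rewrite normcE' lecR; apply: le_trans (LK h) _.
  have := ler_norm K; have := rnorm_ge0 h; have := normr_ge0 K; nra.
have E0 : f \o shift x = cst (f x) + LL +o_ 0 id.
  apply/eqaddoP => e e0.
  have eE : e = (complex.Re e)%:C by rewrite RRe_real // gtr0_real.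
  have [|r r0 rP] := fL (complex.Re e); first by rewrite -ltcR -eE.
  apply/nbhs_rnormP; exists r => // h; rewrite subr0 => hr /=.
  rewrite rnormE normcE' eE -rmorphM lecR; have := rP h hr; congr (normc _ <= _).
  by rewrite -[RHS]/(f (h + x) - (f x + L h)) opprD addrA [h + x]addrC.
have dE := diff_unique LLc E0.
by apply/diff_locallyP; rewrite dE.
Qed.

Lemma fder_line f x h (c : R[i]) L : fder f (x + c *: h) L ->
  cderiv (fun z => f (x + z *: h)) c (L h).
Proof.
move=> [lL [K LK] fL]; apply/cderivP => e e0.
have h1 : 0 < rnorm h + 1 by rewrite ltr_wpDl ?rnorm_ge0.
have [r r0 rP] := fL _ (divr_gt0 e0 h1).
exists (r / (rnorm h + 1)) => [|z zc]; first by rewrite divr_gt0.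
have zh : rnorm ((z - c) *: h) < r.
  rewrite rnormZ; move: zc; rewrite ltr_pdivlMr //.
  have := normc_ge0 (z - c); nra.
have E1 : x + c *: h + (z - c) *: h = x + z *: h.
  by rewrite -addrA -scalerDl addrCA subrr addr0.
have := rP _ zh; rewrite E1 linZ // => /le_trans; apply.
rewrite rnormZ mulrCA mulrC ler_wpM2r ?normc_ge0 //.
by rewrite mulrAC ler_pdivrMr // ler_pM2l // lerDl.
Qed.

Lemma fder_uniq f x L L' : fder f x L -> fder f x L' -> L = L'.
Proof.
move=> fL fL'; apply/funext => h.
have xE : x = x + 0 *: h by rewrite scale0r addr0.
rewrite xE in fL fL'; exact: cderiv_uniq (fder_line fL) (fder_line fL').
Qed.

Lemma fder_near f g x L (r : R) : 0 < r -> (forall y, rnorm (y - x) < r -> f y = g y) ->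
  fder g x L -> fder f x L.
Proof.
move=> r0 fg [lL bL gL]; split=> // e /gL[s s0 sP].
exists (Num.min r s) => [|h]; first by rewrite lt_min r0.
rewrite lt_min => /andP[hr hs].
by rewrite !fg ?subrr ?rnorm0 // ?(addrC x) ?addrK //; rewrite addrC; exact: sP.
Qed.

Lemma fderD f g x L L' : fder f x L -> fder g x L' ->
  fder (fun y => f y + g y) x (fun h => L h + L' h).
Proof.
move=> [lL [K LK] fL] [lL' [K' LK'] fL']; split.
- by move=> c u v; rewrite lL lL'; ring.
- exists (K + K') => h; apply: le_trans (le_normcD _ _) _.
  by rewrite mulrDl lerD.
- move=> e e0; have e2 : 0 < e / 2 by lra.
  have [r r0 rP] := fL _ e2; have [s s0 sP] := fL' _ e2.
  exists (Num.min r s) => [|h]; first by rewrite lt_min r0.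
  rewrite lt_min => /andP[/rP h1 /sP h2].
  rewrite (_ : _ - _ = (f (x + h) - f x - L h) + (g (x + h) - g x - L' h)); last by ring.
  by apply: le_trans (le_normcD _ _) _; lra.
Qed.

Lemma fderZ f x L (c : R[i]) : fder f x L -> fder (fun y => c * f y) x (fun h => c * L h).
Proof.
move=> [lL [K LK] fL]; split.
- by move=> a u v; rewrite lL; ring.
- exists (normc c * K) => h; rewrite normcM -mulrA.
  by rewrite ler_wpM2l ?normc_ge0.
- move=> e e0; have c1 : 0 < normc c + 1 by rewrite ltr_wpDl ?normc_ge0.
  have [r r0 rP] := fL _ (divr_gt0 e0 c1); exists r => // h /rP hr.
  rewrite (_ : _ - _ = c * (f (x + h) - f x - L h)); last by ring.
  rewrite normcM; apply: (@le_trans _ _ (normc c * (e / (normc c + 1) * rnorm h))).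
    by rewrite ler_wpM2l ?normc_ge0.
  rewrite mulrA ler_wpM2r ?rnorm_ge0 // mulrCA ler_piMr ?(ltW e0) //.
  by rewrite ler_pdivrMr // mul1r lerDl.
Qed.

Lemma fder_shift f x a L : fder f (x + a) L -> fder (fun y => f (y + a)) x L.
Proof.
move=> [lL bL fL]; split=> // e /fL[r r0 rP]; exists r => // h /rP.
by rewrite (_ : x + h + a = x + a + h) // addrAC.
Qed.

Lemma fder_cst (c : R[i]) x : fder (fun=> c) x (fun=> 0).
Proof.
split; first by move=> a u v; rewrite mulr0 addr0.
- by exists 0 => h; rewrite normc0 mul0r.
- by move=> e e0; exists 1 => // h _; rewrite !subrr normc0 mulr_ge0 ?(ltW e0) ?rnorm_ge0.
Qed.

Lemma fder_cont f x L : fder f x L -> forall e, 0 < e ->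
  exists2 r : R, 0 < r & forall y, rnorm (y - x) < r -> normc (f y - f x) < e.
Proof.
move=> [lL [K LK] fL] e e0; have [r r0 rP] := fL 1 ltr01.
have K0 : 0 < `|K| + 2 by rewrite ltr_wpDl.
exists (Num.min r (e / (`|K| + 2))) => [|y]; first by rewrite lt_min r0 divr_gt0.
rewrite lt_min => /andP[yr ye].
have := rP _ yr; rewrite (_ : x + (y - x) = y) ?mul1r; last by rewrite addrC subrK.
move=> h1.
have := le_normcD (f y - f x - L (y - x)) (L (y - x)); rewrite subrK => /le_lt_trans; apply.
move: ye; rewrite ltr_pdivlMr // => ye.
have := LK (y - x); have := rnorm_ge0 (y - x); have := ler_norm K; nra.
Qed.

End rnorm.

(** * Cauchy's estimates and holomorphy of differentials *)

Section cauchy.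
Context {R : realType} {E : normedModType R[i]}.
Implicit Types (f g : E -> R[i]) (x y h k : E) (U : set E).
Local Notation "x %:C" := (real_complex _ x).

Definition holo U f := forall x, U x -> exists L, fder f x L.

(** The differential, with the direction as the first argument, so that
directional derivatives can be iterated. *)
Definition D h f x : R[i] :=
  if pselect (exists L, fder f x L) is left e then sval (cid e) h else 0.

Lemma DP f x : (exists L, fder f x L) -> fder f x (fun h => D h f x).
Proof.
move=> fL; rewrite /D; case: pselect => // e.
by case: (cid e) => L LP /=; rewrite (_ : (fun h => L h) = L).
Qed.

Lemma fder_D f x L h : fder f x L -> D h f x = L h.
Proof.
move=> fL; have := DP (ex_intro _ L fL) => fD.
by rewrite -(fder_uniq fD fL).
Qed.

(** Cauchy's estimates only use f along the complex lines through x. *)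
Section ball.
Variables (f : E -> R[i]) (x : E) (r M : R) (L : E -> R[i]).
Hypotheses (r0 : 0 < r) (lL : lin L)
  (line_cdiff : forall k z, rnorm k <= r -> normc z <= 1 ->
     cdiff (fun z => f (x + z *: k)) z)
  (line_D : forall k, cderiv (fun z => f (x + z *: k)) 0 (L k))
  (fM : forall y, rnorm (y - x) <= r -> normc (f y) <= M).

Let M0 : 0 <= M.
Proof.
by apply: (le_trans (normc_ge0 (f x))); apply: fM; rewrite subrr rnorm0 ltW.
Qed.

Let line_bd k z : rnorm k <= r -> normc z <= 1 -> normc (f (x + z *: k)) <= M.
Proof.
move=> kr z1; apply: fM; rewrite addrAC subrr add0r rnormZ.
apply: le_trans kr; have := rnorm_ge0 k; nra.
Qed.

Let rescale h : h != 0 -> let k := (r / rnorm h)%:C *: h in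
  rnorm k = r /\ (rnorm h / r)%:C *: k = h.
Proof.
rewrite -rnorm_gt0 => h0 /=; split.
  by rewrite rnormZR ?divr_ge0 ?(ltW r0) ?(ltW h0) // divfK // gt_eqF.
rewrite scalerA -rmorphM (_ : _ / _ * _ = 1) ?scale1r //; field.
by rewrite !gt_eqF.
Qed.

Lemma line_second h : rnorm h < r ->
  normc (f (x + h) - f x - L h) <= 8 * M / r ^+ 2 * rnorm h ^+ 2.
Proof.
have [->|h0] := eqVneq h 0.
  by rewrite addr0 subrr (lin0 lL) subrr normc0 rnorm0 expr0n mulr0.
have [kr kh] := rescale h0; set k := (_ *: h) in kr kh.
move=> hr; have ar : normc (rnorm h / r)%:C = rnorm h / r.
  by rewrite ger0_normcR // divr_ge0 ?rnorm_ge0 // ltW.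
have := @schwarz_second _ (fun z => f (x + z *: k)) M
  (fun z => @line_cdiff k z (eq_ler kr)) (fun z => @line_bd k z (eq_ler kr))
  _ (rnorm h / r)%:C (line_D k).
rewrite ar scale0r addr0 kh ltr_pdivrMr // mul1r => /(_ hr).
by rewrite -(linZ _ _ lL) kh expr_div_n mulrA mulrAC.
Qed.

Lemma line_deriv_bound h : normc (L h) <= 2 * M / r * rnorm h.
Proof.
have [->|h0] := eqVneq h 0; first by rewrite (lin0 lL) normc0 rnorm0 mulr0.
have [kr kh] := rescale h0; set k := (_ *: h) in kr kh.
have [phi [cphi p0 pE]] := line_D k.
have := @schwarz_quot _ (fun z => f (x + z *: k)) M
  (fun z => @line_cdiff k z (eq_ler kr)) (fun z => @line_bd k z (eq_ler kr)) phi 0 cphi pE.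
rewrite normc0 p0 => /(_ ler01) DM.
rewrite -{1}kh (linZ _ _ lL) normcM ger0_normcR ?divr_ge0 ?rnorm_ge0 ?(ltW r0) //.
rewrite mulrC -mulrA [r^-1 * _]mulrC.
by rewrite ler_wpM2r // divr_ge0 ?rnorm_ge0 // ltW.
Qed.

(** A linear family of derivatives along complex lines is a Frechet differential as
soon as the function is locally bounded, since line_second is uniform in the
direction. *)
Lemma fder_of_lines : fder f x L.
Proof.
split=> //; first by exists (2 * M / r) => h; exact: line_deriv_bound.
move=> e e0; pose C := 8 * M / r ^+ 2.
have C0 : 0 <= C by rewrite !mulr_ge0 ?invr_ge0 ?exprn_ge0 // ltW.
have C1 : 0 < C + 1 by lra.
exists (Num.min r (e / (C + 1))) => [|k]; first by rewrite lt_min r0 divr_gt0.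
rewrite lt_min => /andP[kr]; rewrite ltr_pdivlMr // => ke.
apply: le_trans (line_second kr) _; rewrite expr2 mulrA ler_wpM2r ?rnorm_ge0 //.
by apply: le_trans (ltW ke); rewrite mulrDr mulr1 mulrC lerDl rnorm_ge0.
Qed.

End ball.

Section fder_ball.
Variables (f : E -> R[i]) (x : E) (r M : R).
Hypotheses (r0 : 0 < r)
  (fd : forall y, rnorm (y - x) <= r -> exists L, fder f y L)
  (fM : forall y, rnorm (y - x) <= r -> normc (f y) <= M).

Let fx : fder f x (fun h => D h f x).
Proof. by apply: DP; apply: fd; rewrite subrr rnorm0 ltW. Qed.

Let lD : lin (fun h => D h f x). Proof. by have [] := fx. Qed.

Let line_cdiff k z : rnorm k <= r -> normc z <= 1 -> cdiff (fun z => f (x + z *: k)) z.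
Proof.
move=> kr z1; have [|L fL] := fd (_ : rnorm (x + z *: k - x) <= r).
  by rewrite addrAC subrr add0r rnormZ; apply: le_trans kr; have := rnorm_ge0 k; nra.
by exists (L k); exact: fder_line.
Qed.

Let line_D k : cderiv (fun z => f (x + z *: k)) 0 (D k f x).
Proof.
have := @fder_line _ _ f x k 0 (fun h => D h f x).
by rewrite scale0r addr0; apply; exact: fx.
Qed.

Lemma cauchy_second h : rnorm h < r ->
  normc (f (x + h) - f x - D h f x) <= 8 * M / r ^+ 2 * rnorm h ^+ 2.
Proof. exact: (line_second r0 lD line_cdiff line_D fM). Qed.

Lemma cauchy_D h : normc (D h f x) <= 2 * M / r * rnorm h.
Proof. exact: (line_deriv_bound r0 lD line_cdiff line_D fM). Qed.

End fder_ball.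

Lemma holo_ball U f x : open U -> holo U f -> U x -> exists2 r : R, 0 < r &
  exists M : R, forall y, rnorm (y - x) <= r -> U y /\ normc (f y) <= M.
Proof.
move=> oU fU Ux; have [r r0 rU] := open_rnorm oU Ux.
have [L fL] := fU x Ux; have [s s0 fs] := fder_cont fL ltr01.
pose t := Num.min r s / 2.
have m0 : 0 < Num.min r s by rewrite lt_min r0.
have m1 : Num.min r s <= r by rewrite ge_min lexx.
have m2 : Num.min r s <= s by rewrite ge_min lexx orbT.
have tm : t < Num.min r s by rewrite /t; lra.
exists t; first by rewrite divr_gt0.
exists (normc (f x) + 1) => y yt; split; first by apply: rU; lra.
have := fs y; have := ler_normc_sub (f y) (f x); move=> a /(_ _) b.
have : normc (f y - f x) < 1 by apply: b; lra.
lra.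
Qed.

(** Montel's argument: the difference quotients of f in the direction h are
holomorphic and uniformly bounded near a point, so an ultrafilter limit of
their differentials exists, and Cauchy's estimates pass to the limit. *)
Lemma D_holo U f h : open U -> holo U f -> holo U (D h f).
Proof.
move=> oU fU x0 Ux0; have [r4 r40 [M fM]] := holo_ball oU fU Ux0.
pose r := r4 / 4; have r0 : 0 < r by rewrite /r; lra.
have rE : r4 = 4 * r by rewrite /r; lra.
have inU y : rnorm (y - x0) <= 4 * r -> exists L, fder f y L.
  by rewrite -rE => /fM[/fU].
have bdf y : rnorm (y - x0) <= 4 * r -> normc (f y) <= M by rewrite -rE => /fM[].
have tri y z : rnorm (y - x0) <= rnorm (y - z) + rnorm (z - x0).
  by have := rnormD (y - z) (z - x0); rewrite addrA subrK.
have inU2 x y : rnorm (x - x0) <= 2 * r -> rnorm (y - x) <= 2 * r -> exists L, fder f y L.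
  by move=> xr yr; apply: inU; have := tri y x; lra.
have bdf2 x y : rnorm (x - x0) <= 2 * r -> rnorm (y - x) <= 2 * r -> normc (f y) <= M.
  by move=> xr yr; apply: bdf; have := tri y x; lra.
have r20 : 0 < 2 * r by lra.
have M0 : 0 <= M.
  by apply: (le_trans (normc_ge0 (f x0))); apply: bdf; rewrite subrr rnorm0; lra.
pose H := rnorm h + 1; have H0 : 0 < H by rewrite ltr_wpDl ?rnorm_ge0.
pose s := r / H; have s0 : 0 < s by rewrite divr_gt0.
pose t (n : nat) : R := s / n.+1%:R.
have t0 n : 0 < t n by rewrite divr_gt0.
have ts n : t n <= s by rewrite ler_pdivrMr // ler_peMr ?(ltW s0) // ler1n.
have tC n : (t n)%:C != 0 :> R[i] by rewrite -normc_gt0 ger0_normcR ?t0 // ltW.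
have th n : rnorm ((t n)%:C *: h) <= r.
  rewrite rnormZR ?(ltW (t0 n)) //; have -> : r = s * H by rewrite /s divfK // gt_eqF.
  by apply: ler_pM; rewrite ?rnorm_ge0 ?(ltW (t0 n)) // /H lerDl.
pose K := 8 * M / (2 * r) ^+ 2 * rnorm h ^+ 2.
have K0 : 0 <= K by rewrite !mulr_ge0 ?invr_ge0 ?exprn_ge0 ?rnorm_ge0 // ltW.
pose Q n x := (t n)%:C^-1 * (f (x + (t n)%:C *: h) - f x).
have near_D n x : rnorm (x - x0) <= 2 * r -> normc (Q n x - D h f x) <= K * t n.
  move=> xr; have [lD _ _] := DP (inU x (ltac:(lra))).
  have := @cauchy_second f x (2 * r) M r20 (fun y => @inU2 x y xr) (fun y => @bdf2 x y xr)
    ((t n)%:C *: h).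
  have lt2 : rnorm ((t n)%:C *: h) < 2 * r by have := th n; lra.
  move=> /(_ lt2); rewrite (linZ _ _ lD) rnormZR ?(ltW (t0 n)) // => le.
  rewrite /Q (_ : _ - _ = (t n)%:C^-1 * (f (x + (t n)%:C *: h) - f x - (t n)%:C * D h f x)); last first.
    by rewrite [RHS]mulrBr mulKf.
  rewrite normcM normcV ger0_normcR ?(ltW (t0 n)) // ler_pdivrMl //.
  by apply: le_trans le _; rewrite /K exprMn; lra.
have DM x : rnorm (x - x0) <= 2 * r -> normc (D h f x) <= 2 * M / (2 * r) * rnorm h.
  move=> xr; exact: (@cauchy_D f x (2 * r) M r20 (fun y => @inU2 x y xr) (fun y => @bdf2 x y xr)).
pose N := 2 * M / (2 * r) * rnorm h + K * s.
have QN n x : rnorm (x - x0) <= r -> normc (Q n x) <= N.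
  move=> xr; have x2 : rnorm (x - x0) <= 2 * r by lra.
  have := le_normcD (Q n x - D h f x) (D h f x); rewrite subrK => /le_trans; apply.
  have := near_D n x x2; have := DM x x2; rewrite /N.
  have : K * t n <= K * s by rewrite ler_wpM2l.
  lra.
have Qd n x : rnorm (x - x0) <= r -> exists L, fder (Q n) x L.
  move=> xr; have [L fL] := inU x (ltac:(lra)).
  have [|L' fL'] := inU (x + (t n)%:C *: h).
    have E1 : x + (t n)%:C *: h - x = (t n)%:C *: h by rewrite addrAC subrr add0r.
    have := tri (x + (t n)%:C *: h) x; rewrite E1.
    have := th n; lra.
  exists (fun k => (t n)%:C^-1 * (L' k + (-1) * L k)).
  have := fderZ ((t n)%:C^-1) (fderD (fder_shift fL') (fderZ (-1) fL)).
  by congr fder; apply/funext => y; rewrite /Q mulN1r.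
have [G [UG Goo]] := ultraFilterLemma (@eventually_filter).
have PG : ProperFilter G by exact: ultra_proper.
have bdL n k : normc (D k (Q n) x0) <= 2 * N / r * rnorm k.
  exact: (@cauchy_D (Q n) x0 r N r0 (Qd n) (QN n)).
have /choice[L HL] k : exists l, ucvg G (fun n => D k (Q n) x0) l.
  by apply: (@ucvg_ex _ _ G _ (2 * N / r * rnorm k) UG); apply: filterS filterT => n _; exact: bdL.
have x00 : rnorm (x0 - x0) <= r by rewrite subrr rnorm0 ltW.
have lQ n : lin (fun k => D k (Q n) x0) by have [] := DP (Qd n x0 x00).
have QcvgD x : rnorm (x - x0) <= 2 * r -> ucvg G (fun n => Q n x) (D h f x).
  move=> xr e e0; apply: Goo.
  have := @cvg_harmonic R => /cvgrPdist_lt; have K1 : 0 < K * s + 1 by rewrite ltr_wpDl // mulr_ge0 // ltW.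
  move=> /(_ (e / (K * s + 1)) (divr_gt0 e0 K1)) [n0 _ hn]; exists n0 => // n /hn /=.
  rewrite sub0r normrN ger0_norm ?invr_ge0 // ltr_pdivlMr // => hh.
  apply: le_lt_trans (near_D n x xr) _; rewrite /t mulrA mulrC.
  by apply: le_lt_trans hh; rewrite ler_pM2l ?invr_gt0 // lerDl.
exists L; split.
- move=> c u v; apply: (ucvg_uniq PG (HL (c *: u + v))).
  have -> : (fun n => D (c *: u + v) (Q n) x0) = (fun n => c * D u (Q n) x0 + D v (Q n) x0).
    by apply/funext => n; rewrite (lQ n c u v).
  by apply: ucvgD; [exact: ucvgZ|exact: HL].
- exists (2 * N / r) => k; apply: (ucvg_le PG (HL k)).
  by apply: filterS filterT => n _; exact: bdL.
move=> e e0; pose C := 8 * N / r ^+ 2.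
have N0 : 0 <= N by apply: (le_trans (normc_ge0 (Q 0%N x0))); exact: QN.
have C0 : 0 <= C by rewrite !mulr_ge0 ?invr_ge0 ?exprn_ge0 // ltW.
have C1 : 0 < C + 1 by lra.
exists (Num.min r (e / (C + 1))) => [|k]; first by rewrite lt_min r0 divr_gt0.
rewrite lt_min => /andP[kr]; rewrite ltr_pdivlMr // => ke.
have kx : rnorm (x0 + k - x0) <= 2 * r by rewrite addrAC subrr add0r; lra.
have x02 : rnorm (x0 - x0) <= 2 * r by lra.
have step : normc (D h f (x0 + k) - D h f x0 - L k) <= C * rnorm k ^+ 2.
  apply: (ucvg_le PG (ucvgB _ (ucvgB _ (QcvgD _ kx) (QcvgD _ x02)) (HL k))).
  apply: filterS filterT => n _ /=.
  exact: (@cauchy_second (Q n) x0 r N r0 (Qd n) (QN n)).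
apply: le_trans step _; rewrite expr2 mulrA ler_wpM2r ?rnorm_ge0 //.
by apply: le_trans (ltW ke); rewrite mulrDr mulr1 mulrC lerDl rnorm_ge0.
Qed.

End cauchy.

(** * Multilinear forms and homogeneous polynomials *)

Section multilinear_lines.
Context {R : realType} {E : normedModType R[i]}.
Implicit Types (x y h : E) (z c : R[i]) (U : set E).

(** Fixing the first argument of a multilinear form leaves a multilinear form in the
others; this is how inductions on the number of arguments proceed. *)
Definition ocons n h (w : 'I_n -> E) : 'I_n.+1 -> E :=
  fun i => oapp w h (unlift ord0 i).

Lemma ocons0 n h (w : 'I_n -> E) : ocons h w ord0 = h.
Proof. by rewrite /ocons unlift_none. Qed.

Lemma ocons_lift n h (w : 'I_n -> E) i : ocons h w (lift ord0 i) = w i.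
Proof. by rewrite /ocons liftK. Qed.

Lemma oconsE n (v : 'I_n.+1 -> E) : v = ocons (v ord0) (fun i => v (lift ord0 i)).
Proof.
by apply/funext => i; rewrite /ocons; case: unliftP => [j|] ->.
Qed.

Lemma dfwith_ocons0 n h (w : 'I_n -> E) y :
  @dfwith 'I_n.+1 (fun=> E) (ocons h w) ord0 y = ocons y w.
Proof.
apply/funext => i; case: (unliftP ord0 i) => [j|] ->.
  by rewrite dfwithout ?neq_lift // !ocons_lift.
by rewrite dfwithin ocons0.
Qed.

Lemma dfwith_ocons n h (w : 'I_n -> E) j y :
  @dfwith 'I_n.+1 (fun=> E) (ocons h w) (lift ord0 j) y =
  ocons h (@dfwith 'I_n (fun=> E) w j y).
Proof.
apply/funext => i; case: (unliftP ord0 i) => [k|] ->; last first.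
  by rewrite dfwithout ?ocons0 // eq_sym neq_lift.
rewrite ocons_lift; have [->|jk] := eqVneq j k; first by rewrite !dfwithin.
by rewrite !dfwithout ?ocons_lift // (inj_eq lift_inj).
Qed.

Lemma multilinear_ocons n (A : ('I_n.+1 -> E) -> R[i]^o) h :
  multilinear A -> multilinear (fun w => A (ocons h w)).
Proof.
by move=> mA v i c x y; have := mA (ocons h v) (lift ord0 i) c x y; rewrite !dfwith_ocons.
Qed.

Lemma multilinear_head n (A : ('I_n.+1 -> E) -> R[i]^o) (w : 'I_n -> E) :
  multilinear A -> lin (fun h => A (ocons h w)).
Proof.
by move=> mA c x y; have := mA (ocons 0 w) ord0 c x y; rewrite !dfwith_ocons0.
Qed.

Lemma ocons_line n (v w : 'I_n.+1 -> E) z : (fun i => v i + z *: w i) =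
  ocons (v ord0 + z *: w ord0) (fun i => v (lift ord0 i) + z *: w (lift ord0 i)).
Proof. by rewrite [LHS]oconsE. Qed.

Lemma multilinear_line_deriv n (A : ('I_n -> E) -> R[i]^o) v w z0 : multilinear A ->
  cderiv (fun z => A (fun i => v i + z *: w i)) z0
    (\sum_i A (@dfwith 'I_n (fun=> E) (fun j => v j + z0 *: w j) i (w i))).
Proof.
elim: n A v w => [|n IH] A v w mA.
  rewrite big_ord0; apply: (@cderiv_near _ _ (fun=> A v) _ _ 1) => //.
    by move=> z _; congr A; apply/funext => -[].
  exact: cderiv_cst.
have head u : lin (fun h => A (ocons h u)) by exact: multilinear_head.
pose u z i := v (lift ord0 i) + z *: w (lift ord0 i).
have AE z : A (fun i => v i + z *: w i) = A (ocons (v ord0) (u z)) + z * A (ocons (w ord0) (u z)).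
  by rewrite ocons_line -/(u z) addrC head addrC.
apply: (@cderiv_near _ _ (fun z => A (ocons (v ord0) (u z)) + z * A (ocons (w ord0) (u z))) _ _ 1) => //.
have := cderivD (IH _ (fun i => v (lift ord0 i)) (fun i => w (lift ord0 i)) (multilinear_ocons (v ord0) mA))
  (cderivM (cderiv_id z0) (IH _ (fun i => v (lift ord0 i)) (fun i => w (lift ord0 i)) (multilinear_ocons (w ord0) mA))).
congr cderiv; rewrite big_ord_recl ocons_line dfwith_ocons0 mul1r addrCA; congr (_ + _).
rewrite mulr_sumr -big_split /=; apply: eq_bigr => i _.
by rewrite dfwith_ocons [v ord0 + _]addrC head addrC.
Qed.

Lemma multilinear_homog n (A : ('I_n -> E) -> R[i]^o) v c : multilinear A ->
  A (fun i => c *: v i) = c ^+ n * A v.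
Proof.
elim: n A v => [|n IH] A v mA.
  by rewrite expr0 mul1r; congr A; apply/funext => -[].
rewrite [fun i => _]oconsE /= (linZ _ _ (multilinear_head _ mA)).
by rewrite (IH _ _ (multilinear_ocons _ mA)) -oconsE mulrA exprS.
Qed.

Definition diag_deriv n (A : ('I_n -> E) -> R[i]^o) x h : R[i] :=
  \sum_i A (@dfwith 'I_n (fun=> E) (fun=> x) i h).

Lemma diag_deriv_lin n (A : ('I_n -> E) -> R[i]^o) x : multilinear A ->
  lin (diag_deriv A x).
Proof.
move=> mA c u v; rewrite /diag_deriv mulr_sumr -big_split /=.
by apply: eq_bigr => i _; rewrite (mA (fun=> x) i c u v).
Qed.

Lemma diag_line_deriv n (A : ('I_n -> E) -> R[i]^o) x h z0 : multilinear A ->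
  cderiv (fun z => A (fun=> x + z *: h)) z0 (diag_deriv A (x + z0 *: h) h).
Proof. by move=> mA; exact: (@multilinear_line_deriv n A (fun=> x) (fun=> h)). Qed.

Definition homog n (P : E -> R[i]) := forall c x, P (c *: x) = c ^+ n * P x.

Definition bdd_on_balls (P : E -> R[i]) := forall r : R, exists M : R,
  forall x, rnorm x <= r -> normc (P x) <= M.

Definition entire_bt (P : E -> R[i]) := holo setT P /\ bdd_on_balls P.

(** Homogeneity carries a bound from one ball to all balls. *)
Lemma homog_bdd n P (r M : R) : homog n P -> 0 < r ->
  (forall x, rnorm x <= r -> normc (P x) <= M) -> bdd_on_balls P.
Proof.
move=> hP r0 PM s; pose t := (`|s| + 1) / r.
have t0 : 0 < t by rewrite divr_gt0 // ltr_wpDl.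
exists (t ^+ n * M) => x xs.
have tC : t%:C%C != 0 :> R[i] by rewrite -normc_gt0 ger0_normcR // ltW.
have -> : x = t%:C%C *: (t^-1%:C%C *: x).
  by rewrite scalerA fmorphV mulfV // scale1r.
rewrite hP normcM normcX ger0_normcR ?(ltW t0) // ler_wpM2l ?exprn_ge0 ?(ltW t0) //.
apply: PM; rewrite rnormZR ?invr_ge0 ?(ltW t0) // ler_pdivrMl // /t divfK ?gt_eqF //.
by have := ler_norm s; lra.
Qed.

Lemma diag_homog n (A : ('I_n -> E) -> R[i]^o) : multilinear A ->
  homog n (fun x => A (fun=> x)).
Proof. by move=> mA c x; exact: (multilinear_homog (fun=> x)). Qed.

(** Along a line the form is a polynomial in one variable; local boundedness
upgrades these derivatives to a Frechet differential. *)
Lemma diag_entire n (A : ('I_n -> E) -> R[i]^o) : multilinear A ->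
  bdd_on_balls (fun x => A (fun=> x)) -> holo setT (fun x => A (fun=> x)).
Proof.
move=> mA bA x _; have [M AM] := bA (rnorm x + 1).
exists (diag_deriv A x).
apply: (@fder_of_lines _ _ _ x 1 M) => //.
- exact: diag_deriv_lin.
- by move=> k z _ _; eexists; exact: diag_line_deriv.
- by move=> k; have := diag_line_deriv x k 0 mA; rewrite scale0r addr0.
- move=> y y1; apply: AM; have := rnormD (y - x) x; rewrite subrK; lra.
Qed.

(** The tail of the polynomial beyond degree k plays the part of q in coef_bound. *)
Lemma poly_coef_bound n (c : nat -> R[i]) M (k : nat) :
  (forall z, normc z = 1 -> normc (\sum_(j < n) c j * z ^+ j) <= M) -> (k < n)%N ->
  normc (c k) <= M.
Proof.
move=> cM kn; pose q z := \sum_(j < n - k) c (k + j)%N * z ^+ j.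
have <- : q 0 = c k.
  rewrite /q -(subnSK kn) big_ord_recl big1 ?addr0; last first.
    by move=> i _; rewrite exprS mul0r mulr0.
  by rewrite addn0 expr0 mulr1.
apply: (@coef_bound _ k c (fun z => \sum_(j < n) c j * z ^+ j) q) => //.
- move=> z _; apply: cdiff_sum => j; apply: cdiffM; first exact: cdiff_cst.
  by apply: cdiffX; exact: cdiff_id.
- move=> z; rewrite -(subnKC (ltnW kn)) big_split_ord /=; congr (_ + _).
  rewrite /q mulr_sumr; apply: eq_bigr => j _.
  by rewrite exprD; ring.
- apply: ccont_sum => j; apply: ccontM; first exact: ccont_cst.
  by apply: ccontX; exact: ccont_id.
Qed.

Lemma holo_cont U (f : E -> R[i]) x : holo U f -> U x -> forall e, 0 < e ->
  exists2 r : R, 0 < r & forall y, rnorm (y - x) < r -> normc (f y - f x) < e.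
Proof. by move=> fU /fU[L fL]; exact: (fder_cont fL). Qed.

Lemma holo_continuous (f : E -> R[i]^o) : holo setT f -> continuous f.
Proof.
move=> fU x; apply/(@cvgrPdist_lt _ _ _ (nbhs x)) => e e0.
have eE : e = ((complex.Re e)%:C)%C by rewrite RRe_real // gtr0_real.
have e1 : 0 < complex.Re e by rewrite -ltcR -eE.
have [r r0 rP] := @holo_cont setT f x fU I _ e1.
apply/nbhs_rnormP; exists r => // y /rP yx.
by rewrite distrC normcE' eE ltcR.
Qed.

Lemma continuous_bdd0 (f : E -> R[i]^o) : continuous f -> exists2 r : R, 0 < r &
  exists M : R, forall x, rnorm x <= r -> normc (f x) <= M.
Proof.
move=> /(_ 0) /(@cvgrPdist_lt _ _ _ (nbhs (0 : E))) /(_ _ ltr01) /nbhs_rnormP[r r0 rP].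
exists (r / 2); first by rewrite divr_gt0.
exists (normc (f 0) + 1) => x xr; have := rP x; rewrite subr0 => /(_ (ltac:(lra))).
rewrite distrC normcE' -[1]/(1%:C)%C ltcR => h.
by have := ler_normc_sub (f x) (f 0); lra.
Qed.

Lemma holoD U (f g : E -> R[i]) : holo U f -> holo U g -> holo U (fun x => f x + g x).
Proof.
by move=> fU gU x Ux; have [L fL] := fU x Ux; have [L' gL] := gU x Ux; eexists; exact: fderD fL gL.
Qed.

Lemma holoZ U (f : E -> R[i]) c : holo U f -> holo U (fun x => c * f x).
Proof.
by move=> fU x Ux; have [L fL] := fU x Ux; eexists; exact: fderZ fL.
Qed.

Lemma holo_cst U c : holo U (fun=> c).
Proof. by move=> x Ux; eexists; exact: fder_cst. Qed.

Lemma entire_btD (f g : E -> R[i]) : entire_bt f -> entire_bt g ->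
  entire_bt (fun x => f x + g x).
Proof.
move=> [fd fb] [gd gb]; split; first exact: holoD.
move=> r; have [M fM] := fb r; have [N gN] := gb r; exists (M + N) => x xr.
by apply: le_trans (le_normcD _ _) _; rewrite lerD ?fM ?gN.
Qed.

Lemma entire_btZ (f : E -> R[i]) c : entire_bt f -> entire_bt (fun x => c * f x).
Proof.
move=> [fd fb]; split; first exact: holoZ.
move=> r; have [M fM] := fb r; exists (normc c * M) => x xr.
by rewrite normcM ler_wpM2l ?normc_ge0 ?fM.
Qed.

Lemma entire_bt_cst c : entire_bt (fun=> c).
Proof. by split; [exact: holo_cst|move=> r; exists (normc c)]. Qed.

Lemma entire_bt_sum n (F : 'I_n -> E -> R[i]) : (forall i, entire_bt (F i)) ->
  entire_bt (fun x => \sum_i F i x).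
Proof.
elim: n F => [|n IH] F eF.
  rewrite (_ : (fun x => _) = fun=> 0); first exact: entire_bt_cst.
  by apply/funext => x; rewrite big_ord0.
rewrite (_ : (fun x => _) = fun x => F ord0 x + \sum_(i < n) F (lift ord0 i) x).
  by apply: entire_btD => //; apply: IH.
by apply/funext => x; rewrite big_ord_recl.
Qed.

(** Cauchy's estimates along lines bound every homogeneous component near the
origin by the bound of the whole sum there. *)
Lemma continuous_polynomial_homog (P : E -> R[i]^o) : continuous_polynomial P ->
  exists n (Q : 'I_n -> E -> R[i]), (forall k, entire_bt (Q k) /\ homog k (Q k)) /\
    (forall x, P x = \sum_k Q k x).
Proof.
move=> [cP [n [A [mA PE]]]].
exists n.+1, (fun k x => A k (fun=> x)); split=> // k.
have hA := diag_homog (mA k); split=> //.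
have [r r0 [M PM]] := continuous_bdd0 cP.
have bA : bdd_on_balls (fun x => A k (fun=> x)).
  apply: (homog_bdd hA r0 (M := M)) => x xr.
  pose c j := if insub j is Some i then A i (fun=> x) else 0.
  have ci (i : 'I_n.+1) : c i = A i (fun=> x) by rewrite /c valK.
  rewrite -ci; apply: (@poly_coef_bound n.+1) => // z z1.
  have := PM (z *: x); rewrite rnormZ z1 mul1r => /(_ xr); rewrite PE.
  congr (normc _ <= _); apply: eq_bigr => i _.
  by rewrite (diag_homog (mA i)) ci mulrC.
by split=> //; exact: diag_entire.
Qed.

Lemma continuous_polynomial_entire (P : E -> R[i]^o) :
  continuous_polynomial P -> entire_bt P.
Proof.
move=> /continuous_polynomial_homog[n [Q [eQ PE]]].
rewrite (funext PE : P = _); apply: entire_bt_sum => k; exact: (eQ k).1.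
Qed.

End multilinear_lines.

(** * Taylor polynomials at the origin *)

Section taylor_polynomials.
Context {R : realType} {E : normedModType R[i]}.
Variable U : set E.
Hypotheses (oU : open U) (U0 : U 0).
Implicit Types (x y h : E) (z c : R[i]) (f g : E -> R[i]).

(** Directional derivatives depend on the function in U alone, which lets
iterated derivatives ignore values outside U. *)
Lemma D_near f g x h : (forall y, U y -> f y = g y) -> U x -> holo U g ->
  D h f x = D h g x.
Proof.
move=> fg Ux gU; have [r r0 rU] := open_rnorm oU Ux.
have gD := DP (gU x Ux).
apply: (@fder_D _ _ f x (fun h => D h g x)); apply: fder_near r0 _ gD => y /rU.
exact: fg.
Qed.

(** n! times the n-th Taylor coefficient of f at 0, as a multilinear form. *)
Fixpoint Dn n f : ('I_n -> E) -> R[i] := match n with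
  | 0%N => fun=> f 0
  | m.+1 => fun v => Dn (D (v ord0) f) (fun i : 'I_m => v (lift ord0 i))
  end.

Lemma DnS n f h (w : 'I_n -> E) : Dn f (ocons h w) = Dn (D h f) w.
Proof.
by rewrite /= ocons0; congr Dn; apply/funext => i; rewrite ocons_lift.
Qed.

Lemma Dn_near n f g (v : 'I_n -> E) : (forall y, U y -> f y = g y) -> holo U g ->
  Dn f v = Dn g v.
Proof.
elim: n f g v => [|n IH] f g v fg gU /=; first exact: fg.
apply: IH; last exact: D_holo.
by move=> y Uy; exact: D_near.
Qed.

Lemma Dn_linear n f g (v : 'I_n -> E) c : holo U f -> holo U g ->
  Dn (fun x => c * f x + g x) v = c * Dn f v + Dn g v.
Proof.
elim: n f g v => [|n IH] f g v fU gU //=.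
rewrite -IH; [|exact: D_holo..].
apply: Dn_near; last by apply: holoD; [apply: holoZ|]; exact: D_holo.
move=> y Uy.
apply: (@fder_D _ _ _ y (fun h => c * D h f y + D h g y)).
apply: fderD; last by apply: DP; exact: gU.
by apply: fderZ; apply: DP; exact: fU.
Qed.

(** Linearity in the first direction is that of the differential, and Dn is linear
in the function. *)
Lemma Dn_multilinear n f : holo U f -> multilinear (fun v : 'I_n -> E => Dn f v : R[i]^o).
Proof.
elim: n f => [|n IH] f fU v i; first by case: i.
case: (unliftP ord0 i) => [j|] -> c x y; rewrite [v]oconsE.
  by rewrite !dfwith_ocons !DnS; exact: (IH _ (D_holo _ oU fU)).
rewrite !dfwith_ocons0 !DnS -[RHS]/(c * _ + _) -Dn_linear; [|exact: D_holo..].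
apply: Dn_near; last by apply: holoD; [apply: holoZ|]; exact: D_holo.
by move=> z Uz; have [lD _ _] := DP (fU z Uz); rewrite lD.
Qed.

Lemma Dn_iter n f x : Dn f (fun _ : 'I_n => x) = iter n (D x) f 0 :> R[i].
Proof. by elim: n f => [|n IH] f //=; rewrite IH -iterSr. Qed.

Lemma iter_D_holo n f x : holo U f -> holo U (iter n (D x) f).
Proof. by move=> fU; elim: n => //= n; exact: D_holo. Qed.

Definition taylor_term n f x : R[i] := Dn f (fun _ : 'I_n => x) / n`!%:R.

Section estimates.
Variables (f : E -> R[i]) (x : E) (rho M : R).
Hypotheses (fU : holo U f) (rho1 : 1 < rho)
  (xU : forall z, normc z <= rho -> U (z *: x))
  (xM : forall z, normc z <= rho -> normc (f (z *: x)) <= M).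

Let y := rho%:C%C *: x.
Let rho0 : 0 < rho. Proof. exact: lt_trans rho1. Qed.

Let zy z : normc z <= 1 -> normc (z * rho%:C%C) <= rho.
Proof. by move=> z1; rewrite normcM ger0_normcR ?(ltW rho0) // ler_piMl // ltW. Qed.

Let ph n z := iter n (D y) f (z *: y).

Let phd n z : normc z <= 1 -> cderiv (ph n) z (ph n.+1 z).
Proof.
move=> z1; have Uz : U (0 + z *: y) by rewrite add0r scalerA; apply/xU/zy.
have := fder_line (DP (iter_D_holo n y fU Uz)).
rewrite add0r; congr cderiv; apply/funext => w; by rewrite /ph add0r.
Qed.

Let phM z : normc z <= 1 -> normc (ph 0 z) <= M.
Proof. by move=> z1; rewrite /ph /= scalerA; apply/xM/zy. Qed.

Let phE n : ph n 0 = rho%:C%C ^+ n * Dn f (fun _ : 'I_n => x).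
Proof.
rewrite /ph scale0r -Dn_iter.
exact: (multilinear_homog (fun=> x) rho%:C%C (@Dn_multilinear n f fU)).
Qed.

Lemma taylor_term_bound n : normc (taylor_term n f x) <= M / rho ^+ n.
Proof.
rewrite ler_pdivlMr ?exprn_gt0 // mulrC.
have := taylor_coef_bound phd phM n; rewrite phE -mulrA normcM normcX.
by rewrite ger0_normcR // ltW.
Qed.

(** This is the expansion in one variable of z |-> f (z y), with y = rho x, at
z = 1 / rho. *)
Lemma taylor_sum n : normc (f x - \sum_(k < n) taylor_term k f x) <= n.+1%:R * M / rho ^+ n.
Proof.
have r1 : normc (rho^-1%:C%C : R[i]) = rho^-1 by rewrite ger0_normcR // invr_ge0 ltW.
have := @taylor_remainder _ ph phd M phM n rho^-1%:C%C.
rewrite r1 invf_lt1 // => /(_ rho1); rewrite exprVn; congr (normc (_ - _) <= _).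
  by rewrite /ph /= scalerA -rmorphM mulVf ?gt_eqF // scale1r.
apply: eq_bigr => k _; rewrite phE /taylor_term.
have rC : rho%:C%C ^+ k != 0 :> R[i].
  by rewrite expf_neq0 // -normc_gt0 ger0_normcR // ltW.
rewrite fmorphV exprVn; set d := _^-1; set u := rho%:C%C ^+ k in rC *.
by rewrite -[u * _ * _]mulrA [u * (_ * d)]mulrC mulfK.
Qed.

End estimates.

(** Cauchy's estimates bound the n-th term on a ball around the origin, and a
locally bounded homogeneous polynomial is entire. *)
Lemma taylor_term_polynomial n f : holo U f ->
  entire_bt (taylor_term n f) /\ continuous_polynomial (taylor_term n f : E -> R[i]^o).
Proof.
move=> fU; have [r r0 [M fM]] := holo_ball oU fU U0.
have mD (c : R[i]) m : multilinear (fun v : 'I_m -> E => c * Dn f v : R[i]^o).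
  move=> v i a x y /=; rewrite (Dn_multilinear fU v i a x y) mulrDr.
  by rewrite /GRing.scale /=; ring.
pose A (v : 'I_n -> E) : R[i]^o := n`!%:R^-1 * Dn f v.
have TE : taylor_term n f = (fun x => A (fun=> x)).
  by apply/funext => x; rewrite /taylor_term /A mulrC.
have bT : bdd_on_balls (taylor_term n f).
  have r20 : 0 < r / 2 by lra.
  apply: (@homog_bdd _ _ n _ (r / 2) (M / 2 ^+ n)) => //.
    by rewrite TE; exact: (diag_homog (@mD _ n)).
  move=> x xr; have zr z : normc z <= 2 -> rnorm (z *: x - 0) <= r.
    move=> z2; rewrite subr0 rnormZ; have := rnorm_ge0 x; have := normc_ge0 z; nra.
  by apply: (@taylor_term_bound f x 2 M fU); [lra|move=> z /zr /fM[]..].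
have hT : holo setT (taylor_term n f).
  by rewrite TE; apply: (diag_entire (@mD _ n)); rewrite -TE.
split=> //; split; first exact: holo_continuous.
exists n, (fun (k : 'I_n.+1) (v : 'I_k -> E) =>
  (if (k == n :> nat) then k`!%:R^-1 else 0) * @Dn k f v).
split=> [k|x]; first exact: mD.
rewrite big_ord_recr /= eqxx big1 ?add0r /taylor_term ?[_ / _]mulrC //.
by move=> k _; rewrite ltn_eqF ?mul0r.
Qed.

End taylor_polynomials.

(** * The algebra of bounded type functions and its topology *)

Section ubounded.
Context {R : realType} {E : normedModType R[i]}.
Variable U : set E.
Implicit Types (A B : set E) (x y : E).
Local Notation "x %:C" := (real_complex _ x).

(** U-boundedness of a subset of E; sets of points of the subtype U are compared
with it through U_boundedP. *)
Definition ubd A := [/\ A `<=` U, exists M : R, forall x, A x -> rnorm x <= M &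
  exists2 d : R, 0 < d & forall x y, A x -> ~ U y -> d <= rnorm (x - y)].

Definition inU (x : E) (Ux : U x) : U := SigSub (mem_set Ux).

Lemma val_inU x (Ux : U x) : val (inU Ux) = x. Proof. by []. Qed.

Lemma valU (u : U) : U (val u). Proof. exact: set_valP. Qed.

Lemma bounded_realP (V : normedModType R[i]) (T : Type) (f : T -> V) (A : set T) :
  [bounded f x | x in A] <-> exists M : R, forall t, A t -> rnorm (f t) <= M.
Proof.
split=> [/pinfty_ex_gt0[M M0 fM]|[M fM]].
  exists (complex.Re M) => x Ax; have := fM x Ax; rewrite /= rnormE -{1}(RRe_real (gtr0_real M0)).
  by rewrite lecR.
exists (M%:C); split; first by apply/complex_realP; exists M.
by move=> N /ltW MN x /fM h; apply: le_trans MN; rewrite rnormE lecR.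
Qed.

Lemma U_boundedP (A : set U) : U_bounded A <-> ubd [set val u | u in A].
Proof.
split=> [[/bounded_realP[M AM] [d d0 dA]]|[_ [M AM] [d d0 dA]]].
  split; first by move=> _ [u _ <-]; exact: valU.
    by exists M => _ [u /AM ? <-].
  have dE : d = (complex.Re d)%:C by rewrite RRe_real // gtr0_real.
  exists (complex.Re d) => [|_ y [u Au <-] Uy]; first by rewrite -ltcR -dE.
  by have := dA u y Au Uy; rewrite dE rnormE lecR.
split; first by apply/bounded_realP; exists M => u Au; apply: AM; exists u.
exists d%:C => [|u y Au Uy]; first by rewrite ltcR.
by rewrite rnormE lecR; apply: dA Uy; exists u.
Qed.

Lemma ubd_U_bounded A : ubd A -> U_bounded (fun u : U => A (val u)).
Proof.
move=> [AU [M AM] [d d0 dA]]; apply/U_boundedP; split.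
- by move=> _ [u _ <-]; exact: valU.
- by exists M => _ [u Au <-]; exact: AM.
- by exists d => // _ y [u Au <-]; exact: dA.
Qed.

Lemma ubdU A B : ubd A -> ubd B -> ubd (A `|` B).
Proof.
move=> [AU [M AM] [d d0 dA]] [BU [N BN] [e e0 eB]]; split.
- by move=> x []; [exact: AU|exact: BU].
- by exists (Num.max M N) => x [/AM|/BN] h; rewrite le_max h ?orbT.
- exists (Num.min d e) => [|x y]; first by rewrite lt_min d0.
  by move=> [/dA h|/eB h] /h h'; rewrite ge_min h' ?orbT.
Qed.

Lemma ubd0 : ubd set0.
Proof. by split=> //; [exists 0|exists 1]. Qed.

Lemma ubd1 x : open U -> U x -> ubd [set x].
Proof.
move=> oU Ux; have [r r0 rU] := open_rnorm oU Ux.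
split; first by move=> _ ->.
  by exists (rnorm x) => _ ->.
exists r => // _ y -> Uy; rewrite leNgt; apply/negP; rewrite rnorm_sub => /rU.
exact: Uy.
Qed.

Definition Hbt (g : E -> R[i]) := holo U g /\
  forall A, ubd A -> exists M : R, forall x, A x -> normc (g x) <= M.

Lemma entire_Hbt g : entire_bt g -> Hbt g.
Proof.
move=> [gd gb]; split=> [x _|A [_ [M AM] _]]; first exact: gd.
by have [N gN] := gb M; exists N => x /AM; exact: gN.
Qed.

Definition ext (f : Hb U) : E -> R[i] := 'valL_(0 : R[i]^o) f.

Lemma valL0_val (g : U -> R[i]^o) (u : U) : ('valL_(0 : R[i]^o) g : E -> R[i]) (val u) = g u.
Proof. exact: (congr1 (fun h => h u) (@valLK _ _ 0 U g)). Qed.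

Lemma extE (f : Hb U) (u : U) : ext f (val u) = f u.
Proof. exact: valL0_val. Qed.

Lemma ext_holo f : holo U (ext f).
Proof.
have /asboolP[hf _] := Hb_valP f.
by move=> x Ux; have := hf (inU Ux) => /differentiable_fder.
Qed.

Lemma ext_Hbt f : Hbt (ext f).
Proof.
split; first exact: ext_holo.
move=> A uA; have /asboolP[_ /(_ _ (ubd_U_bounded uA)) /bounded_realP[M fM]] := Hb_valP f.
exists M => x Ax; have Ux : U x by case: uA => + _ _; apply.
by rewrite -(val_inU Ux) extE; exact: fM.
Qed.

Lemma Hbt_pred g : open U -> Hbt g -> (fun u : U => g (val u) : R[i]^o) \in @Hb_pred R E U.
Proof.
move=> oU [gd gb]; apply/asboolP; split=> [u|A /U_boundedP/gb[M gM]].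
  apply/differentiable_fder; have [r r0 rU] := open_rnorm oU (valU u).
  have [L gL] := gd _ (valU u); exists L; apply: fder_near r0 _ gL => y /rU Uy.
  by rewrite -(val_inU Uy) valL0_val.
by apply/bounded_realP; exists M => u Au; apply: gM; exists u.
Qed.

Lemma Hb_ext_eq (f g : Hb U) : (forall u, f u = g u) -> f = g.
Proof. by move=> fg; apply: val_inj; apply/funext. Qed.

Lemma HbD (f g : Hb U) u : (f + g) u = f u + g u. Proof. by []. Qed.
Lemma HbZ c (f : Hb U) u : (c *: f) u = c * f u. Proof. by []. Qed.
Lemma HbB (f g : Hb U) u : (f - g) u = f u - g u. Proof. by []. Qed.
Lemma HbM (f g : Hb U) u : Hb_mul f g u = f u * g u. Proof. by []. Qed.

Definition dominated (A : set E) (phi : Hb U -> R[i]) C :=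
  forall (f : Hb U) c, 0 <= c -> (forall u : U, A (val u) -> normc (f u) <= c) -> normc (phi f) <= C * c.

Lemma entourage_normc (W : set (R[i]^o * R[i]^o)) : entourage W ->
  exists2 e : R, 0 < e & forall a b : R[i]^o, normc (a - b) < e -> W (a, b).
Proof.
rewrite -entourage_ballE => -[e /= e0 eW].
have eE : e = (complex.Re e)%:C by rewrite RRe_real // gtr0_real.
exists (complex.Re e) => [|a b ab]; first by rewrite -ltcR -eE.
by apply: eW; rewrite -ball_normE /= normcE' eE ltcR.
Qed.

Lemma normc_entourage (e : R) : 0 < e ->
  entourage [set ab : R[i]^o * R[i]^o | normc (ab.1 - ab.2) < e].
Proof.
move=> e0; rewrite -entourage_ballE; exists e%:C => /=; first by rewrite ltcR.
by move=> [a b]; rewrite -ball_normE /= normcE' ltcR.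
Qed.

(** The functions that are small on a U-bounded set form a basis of the
neighbourhoods of 0 for convergence on U-bounded sets. *)
Lemma continuous_dominated (phi : Hb U -> R[i]^o) : linear phi -> continuous phi ->
  exists A C, ubd A /\ dominated A phi C.
Proof.
move=> lphi cphi.
pose F : set_system (Hb U) := [set S | exists A e, [/\ ubd A, 0 < e &
  [set f : Hb U | forall u : U, A (val u) -> normc (f u) < e] `<=` S]].
have FF : Filter F.
  split.
  - by exists set0, 1; split=> //; exact: ubd0.
  - move=> S T [A [e [uA e0 AS]]] [B [d [uB d0 BT]]].
    exists (A `|` B), (Num.min e d); split; first exact: ubdU.
      by rewrite lt_min e0.
    move=> f fAB; split; [apply: AS|apply: BT] => u Au.
      by have := fAB u (or_introl Au); rewrite lt_min => /andP[].
    by have := fAB u (or_intror Au); rewrite lt_min => /andP[].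
  - by move=> S T ST [A [e [uA e0 AS]]]; exists A, e; split=> //; exact: subset_trans ST.
have F0 : F --> (0 : Hb U).
  move=> S; rewrite /= nbhsE => -[B [[C oC CB] B0] BS].
  have : (@Hb_to_family R E U @ F) --> (Hb_to_family (0 : Hb U)).
    apply/fam_cvgP => A /U_boundedP uA S' /uniform_nbhs[W [/entourage_normc[e e0 eW] WS]].
    exists [set val u | u in A], e; split=> // f fA; apply: WS => u Au /=.
    apply: eW; rewrite [X in X - _](_ : _ = 0) // sub0r normcN.
    by apply: fA; exists u.
  move=> /(_ C) CF; have : nbhs (Hb_to_family (0 : Hb U)) C.
    by apply: open_nbhs_nbhs; split=> //; move: B0; rewrite -CB.
  by move=> /CF; apply: (@filterS _ F FF) => f Cf; apply: BS; rewrite -CB.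
have phi0 : phi 0 = 0.
  by have := lphi (-1) 0 0; rewrite scaler0 addr0 scaleN1r addNr.
have := cphi 0; rewrite /continuous_at phi0.
move=> /(@cvgrPdist_lt _ _ _ (nbhs (0 : Hb U))) /(_ _ ltr01) /F0[A [e [uA e0 AS]]].
exists A, (2 / e); split=> //.
have main (f : Hb U) c : 0 < c -> (forall u : U, A (val u) -> normc (f u) <= c) ->
    normc (phi f) <= 2 / e * c.
  move=> c0 fc; pose t := e / (2 * c); have t0 : 0 < t by rewrite divr_gt0 // mulr_gt0.
  have tc : t * c < e by rewrite /t invfM mulrA mulfVK ?gt_eqF //; lra.
  have phiZ (k : R[i]) : phi (k *: f) = k * phi f.
    by have := lphi k f 0; rewrite phi0 !addr0.
  have := AS (t%:C *: f).
  rewrite /= sub0r normrN phiZ normcE' -[1]/(1%:C) ltcR normcM ger0_normcR ?(ltW t0) //.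
  move=> h; have -> : 2 / e * c = t^-1 by rewrite /t invf_div; ring.
  rewrite -(mulr1 t^-1) ler_pdivlMl //; apply/ltW/h => u Au.
  rewrite [X in normc X](_ : _ = t%:C * f u) // normcM ger0_normcR ?(ltW t0) //.
  apply: le_lt_trans tc.
  by rewrite ler_pM2l // fc.
move=> f c; rewrite le_eqVlt => /predU1P[<- f0|]; last exact: main.
rewrite mulr0; apply/ler_addgt0Pr => d d0; rewrite add0r.
have -> : d = 2 / e * (d * e / 2) by field; rewrite gt_eqF.
apply: main => [|u /f0 h]; first by rewrite divr_gt0 // mulr_gt0.
by apply: (le_trans h); rewrite divr_ge0 // mulr_ge0 // ltW.
Qed.

Lemma dominated_continuous A C (phi : Hb U -> R[i]^o) : ubd A -> linear phi ->
  dominated A phi C -> continuous phi.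
Proof.
move=> uA lphi dphi f0; apply/(@cvgrPdist_lt _ _ _ (nbhs f0)) => e e0.
have eE : e = (complex.Re e)%:C by rewrite RRe_real // gtr0_real.
have e1 : 0 < complex.Re e by rewrite -ltcR -eE.
pose r := complex.Re e / (`|C| + 1); have r0 : 0 < r by rewrite divr_gt0 // ltr_wpDl.
have nb := @fam_nbhs U R[i]^o (@U_bounded R E U) (fun u : U => A (val u))
  _ (Hb_to_family f0) (normc_entourage r0) (ubd_U_bounded uA).
have := @initial_continuous _ _ (@Hb_to_family R E U) f0 _ nb.
apply: (@filterS _ (nbhs f0)) => f /= fr.
have phiB : phi f0 - phi f = phi (f0 - f).
  have := lphi (-1) f f0; rewrite scaleN1r [- f + f0]addrC => ->.
  by rewrite scaleN1r addrC.
rewrite phiB normcE' eE ltcR.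
apply: le_lt_trans (dphi (f0 - f) r (ltW r0) _) _.
  by move=> u Au; rewrite HbB; apply/ltW/fr.
rewrite /r mulrC mulrAC ltr_pdivrMr ?ltr_wpDl // ltr_pM2l //.
by have := ler_norm C; lra.
Qed.

End ubounded.

(** * The dual space *)

Section dual_topology.
Context {R : realType} {E : normedModType R[i]}.
Local Notation "x %:C" := (real_complex _ x).

Lemma dual_lin (f : dual E) : lin f.
Proof.
move=> c u v; have /asboolP[lf _] : dual_val f \in @dual_pred R E by case: f.
exact: lf.
Qed.

Lemma dual_continuous (f : dual E) : continuous (f : E -> R[i]^o).
Proof. by have /asboolP[_ cf] : dual_val f \in @dual_pred R E by case: f. Qed.

Lemma lin_bounded_continuous (L : E -> R[i]^o) (K : R) : lin L ->
  (forall x, normc (L x) <= K * rnorm x) -> continuous L.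
Proof.
move=> lL LK; apply: holo_continuous => x _; exists L; split=> //; first by exists K.
move=> e e0; exists 1 => // h _; rewrite linD // [_ x + _]addrC addrK subrr normc0.
by rewrite mulr_ge0 ?rnorm_ge0 // ltW.
Qed.

Lemma mkdual_pred (L : E -> R[i]^o) (K : R) : lin L ->
  (forall x, normc (L x) <= K * rnorm x) -> L \in @dual_pred R E.
Proof.
by move=> lL LK; apply/asboolP; split=> //; exact: lin_bounded_continuous LK.
Qed.

Definition mkdual (L : E -> R[i]^o) (K : R) (lL : lin L)
  (LK : forall x, normc (L x) <= K * rnorm x) : dual E := Dual (mkdual_pred lL LK).

Lemma dual_fder (f : dual E) x : fder f x f.
Proof.
have [r r0 [M fM]] := continuous_bdd0 (@dual_continuous f).
have lf := @dual_lin f.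
split=> //; last first.
  move=> e e0; exists 1 => // h _; rewrite linD // [_ x + _]addrC addrK subrr normc0.
  by rewrite mulr_ge0 ?rnorm_ge0 // ltW.
exists (M / r) => h; have [->|h0] := eqVneq h 0.
  by rewrite lin0 // normc0 rnorm0 mulr0.
have h1 : 0 < rnorm h by rewrite rnorm_gt0.
have := fM ((r / rnorm h)%:C *: h); rewrite rnormZR ?divr_ge0 ?(ltW r0) ?(ltW h1) //.
rewrite divfK ?gt_eqF // => /(_ (lexx _)).
rewrite linZ // normcM ger0_normcR ?divr_ge0 ?(ltW r0) ?(ltW h1) //.
rewrite mulrAC ler_pdivrMr // => h2; rewrite mulrAC ler_pdivlMr //; lra.
Qed.

Lemma dual_bound (f : dual E) : exists2 K : R, 0 <= K & forall x, normc (f x) <= K * rnorm x.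
Proof.
have [_ [K fK] _] := dual_fder f 0; exists `|K| => // x.
by apply: le_trans (fK x) _; rewrite ler_wpM2r ?rnorm_ge0 // ler_norm.
Qed.

Lemma dual_entire (f : dual E) : entire_bt f.
Proof.
split; first by move=> x _; exists f; exact: dual_fder.
move=> r; have [K K0 fK] := dual_bound f; exists (K * r) => x xr.
by apply: le_trans (fK x) _; rewrite ler_wpM2l.
Qed.

Lemma dualD (f g : dual E) x : (f + g) x = f x + g x. Proof. by []. Qed.
Lemma dualZ c (f : dual E) x : (c *: f) x = c * f x. Proof. by []. Qed.
Lemma dualB (f g : dual E) x : (f - g) x = f x - g x. Proof. by []. Qed.

Definition dual_dominated (Phi : dual E -> R[i]) (C : R) :=
  forall (f : dual E) c, 0 <= c -> (forall x, rnorm x <= 1 -> normc (f x) <= c) ->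
    normc (Phi f) <= C * c.

Lemma dual_dominated_continuous (Phi : dual E -> R[i]^o) C : linear Phi ->
  dual_dominated Phi C -> continuous Phi.
Proof.
move=> lphi dphi f0; apply/(@cvgrPdist_lt _ _ _ (nbhs f0)) => e e0.
have eE : e = (complex.Re e)%:C by rewrite RRe_real // gtr0_real.
have e1 : 0 < complex.Re e by rewrite -ltcR -eE.
pose r := complex.Re e / (`|C| + 1); have r0 : 0 < r by rewrite divr_gt0 // ltr_wpDl.
have nb : nbhs (dual_to_uniform f0) [set g | forall x : E, `|x| <= 1 ->
    normc (f0 x - g x) < r].
  by apply/uniform_nbhs; exists [set ab | normc (ab.1 - ab.2) < r]; split=> //; exact: normc_entourage.
have := @initial_continuous _ _ (@dual_to_uniform R E) f0 _ nb.
apply: (@filterS _ (nbhs f0)) => f /= fr.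
have phiB : Phi f0 - Phi f = Phi (f0 - f).
  have := lphi (-1) f f0; rewrite scaleN1r [- f + f0]addrC => ->.
  by rewrite scaleN1r addrC.
rewrite phiB normcE' eE ltcR.
apply: le_lt_trans (dphi (f0 - f) r (ltW r0) _) _.
  move=> x x1; rewrite dualB; apply/ltW/fr.
  by rewrite rnormE -[1]/(1%:C) lecR.
rewrite /r mulrC mulrAC ltr_pdivrMr ?ltr_wpDl // ltr_pM2l //.
by have := ler_norm C; lra.
Qed.

Lemma dual_continuous_dominated (Phi : dual E -> R[i]^o) : linear Phi -> continuous Phi ->
  exists C, dual_dominated Phi C.
Proof.
move=> lphi cphi.
have phi0 : Phi 0 = 0.
  by have := lphi (-1) 0 0; rewrite scaler0 addr0 scaleN1r addNr.
have := cphi 0; rewrite /continuous_at phi0.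
move=> /(@cvgrPdist_lt _ _ _ (nbhs (0 : dual E))) /(_ _ ltr01).
rewrite /= nbhsE => -[B [[S oS SB] B0] BS].
have : nbhs (dual_to_uniform (0 : dual E)) S.
  by apply: open_nbhs_nbhs; split=> //; move: B0; rewrite -SB.
move=> /uniform_nbhs[W [/entourage_normc[e e0 eW] WS]].
have AS (f : dual E) : (forall x, rnorm x <= 1 -> normc (f x) < e) -> normc (Phi f) < 1.
  move=> fe; have : B f.
    rewrite -SB; apply: WS => x x1; apply: eW.
    rewrite [X in X - _](_ : _ = 0) // sub0r normcN; apply: fe.
    by move: x1; rewrite /= rnormE -[1]/(1%:C) lecR.
  by move=> /BS; rewrite /= sub0r normrN normcE' -[1]/(1%:C) ltcR.
exists (2 / e).
have main (f : dual E) c : 0 < c -> (forall x, rnorm x <= 1 -> normc (f x) <= c) ->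
    normc (Phi f) <= 2 / e * c.
  move=> c0 fc; pose t := e / (2 * c); have t0 : 0 < t by rewrite divr_gt0 // mulr_gt0.
  have tc : t * c < e by rewrite /t invfM mulrA mulfVK ?gt_eqF //; lra.
  have phiZ (k : R[i]) : Phi (k *: f) = k * Phi f.
    by have := lphi k f 0; rewrite phi0 !addr0.
  have := AS (t%:C *: f); rewrite phiZ normcM ger0_normcR ?(ltW t0) //.
  move=> h; have -> : 2 / e * c = t^-1 by rewrite /t invf_div; ring.
  rewrite -(mulr1 t^-1) ler_pdivlMl //; apply/ltW/h => x x1.
  rewrite dualZ normcM ger0_normcR ?(ltW t0) //; apply: le_lt_trans tc.
  by rewrite ler_pM2l // fc.
move=> f c; rewrite le_eqVlt => /predU1P[<- f0|]; last exact: main.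
rewrite mulr0; apply/ler_addgt0Pr => d d0; rewrite add0r.
have -> : d = 2 / e * (d * e / 2) by field; rewrite gt_eqF.
apply: main => [|u /f0 h]; first by rewrite divr_gt0 // mulr_gt0.
by apply: (le_trans h); rewrite divr_ge0 // mulr_ge0 // ltW.
Qed.

End dual_topology.

(** * Density of polynomials on balanced sets *)

Section density.
Context {R : realType} {E : normedModType R[i]}.
Variable U : set E.
Hypotheses (oU : open U) (bU : balanced_set U).
Implicit Types (A B : set E) (x y : E) (f g : E -> R[i]).
Local Notation "x %:C" := (real_complex _ x).

Lemma normc_le1 (z : R[i]) : (`|z| <= 1) = (normc z <= 1).
Proof. by rewrite [`|z|]normcE' -[1]/(1%:C) lecR. Qed.

Lemma balanced0 : U 0.
Proof.
by case: bU => -[x Ux] /(_ 0 x); rewrite scale0r normr0; apply => //; exact: ler01.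
Qed.

Lemma balancedZ (z : R[i]) x : normc z <= 1 -> U x -> U (z *: x).
Proof. by case: bU => _ h; rewrite -normc_le1; exact: h. Qed.

Lemma bernoulli (u : R) n : 0 <= u -> 1 + n%:R * u <= (1 + u) ^+ n.
Proof.
move=> u0; elim: n => [|n IH]; first by rewrite mul0r addr0 expr0.
rewrite exprS; apply: (@le_trans _ _ ((1 + u) * (1 + n%:R * u))).
  have : 0 <= n%:R * u by rewrite mulr_ge0.
  rewrite -nat1r; nra.
by rewrite ler_wpM2l // addr_ge0.
Qed.

(** With rho > (1 + u)^2, Bernoulli's inequality applied to one of the two factors
(1 + u)^n absorbs the factor n + 1. *)
Lemma poly_geometric_small (rho N e : R) : 1 < rho -> 0 < e ->
  exists n : nat, n.+1%:R * N / rho ^+ n <= e.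
Proof.
move=> r1 e0; pose u := Num.min 1 ((rho - 1) / 3).
have u0 : 0 < u by rewrite lt_min ltr01 divr_gt0 //; lra.
have u1 : u <= 1 by rewrite ge_min lexx.
have u3 : u <= (rho - 1) / 3 by rewrite ge_min lexx orbT.
have urho : (1 + u) ^+ 2 <= rho by rewrite expr2; nra.
pose n := Num.bound (`|N| / (u * u * e)).
have nb : `|N| / (u * u * e) < n%:R.
  apply: le_lt_trans (archi_boundP _); first by rewrite lexx.
  by rewrite divr_ge0 // mulr_ge0 ?(ltW e0) // mulr_ge0 // ltW.
exists n; have p0 : 0 < (1 + u) ^+ n by rewrite exprn_gt0 //; lra.
have r0 : 0 < rho ^+ n by rewrite exprn_gt0 //; lra.
rewrite ler_pdivrMr //; apply: (@le_trans _ _ (e * ((1 + u) ^+ n * (1 + u) ^+ n))); last first.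
  rewrite ler_pM2l // -expr2 exprAC lerXn2r // nnegrE ?exprn_ge0 //; lra.
have b := @bernoulli u n (ltW u0).
have n1 : n.+1%:R * u <= (1 + u) ^+ n by rewrite -nat1r; nra.
have N1 : `|N| <= e * u * (1 + u) ^+ n.
  move: nb; rewrite ltr_pdivrMr; last by rewrite !mulr_gt0.
  move=> nb; apply: (@le_trans _ _ (e * u * (n%:R * u))); first by nra.
  by rewrite ler_wpM2l ?mulr_ge0 ?(ltW e0) ?(ltW u0) //; lra.
apply: (@le_trans _ _ (n.+1%:R * `|N|)); first by rewrite ler_wpM2l // ler_norm.
apply: (@le_trans _ _ (n.+1%:R * (e * u * (1 + u) ^+ n))); first by rewrite ler_wpM2l.
rewrite (_ : n.+1%:R * _ = e * (1 + u) ^+ n * (n.+1%:R * u)); last by ring.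
by rewrite -[leLHS]mulrA; apply: ler_wpM2l; [exact: ltW|apply: ler_wpM2l => //; exact: ltW].
Qed.

(** Multiples z x with |z| <= 1 are either short, thus far from the complement of U,
or have |z| bounded below, and then dividing by z brings a point outside U to
a point outside U.  A factor rho slightly above 1 moves points by little. *)
Lemma balanced_hull_ubd A : ubd U A -> exists2 rho : R, 1 < rho &
  ubd U [set y | exists z x, [/\ normc z <= rho, A x & y = z *: x]].
Proof.
move=> [AU [M0 AM0] [d d0 dA]].
have [s s0 sU] := open_rnorm oU balanced0.
pose M := `|M0| + 1; have M1 : 0 < M by rewrite ltr_wpDl.
have AM x : A x -> rnorm x <= M by move=> /AM0; have := ler_norm M0; rewrite /M; lra.
pose d' := Num.min (s / 2) (d * (s / (2 * M))).
have sM : 0 < s / (2 * M) by rewrite divr_gt0 // mulr_gt0.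
have d'0 : 0 < d' by rewrite lt_min; apply/andP; split; [lra|exact: mulr_gt0].
have dist z x y : normc z <= 1 -> A x -> ~ U y -> d' <= rnorm (z *: x - y).
  move=> z1 Ax Uy.
  have ys : s <= rnorm y by rewrite leNgt; apply/negP => h; apply: Uy; apply: sU; rewrite subr0.
  have [zx|zx] := lerP (normc z * rnorm x) (s / 2).
    rewrite ge_min; apply/orP; left.
    by have := rnormB_ge y (z *: x); rewrite rnorm_sub rnormZ; lra.
  have zM : s / (2 * M) <= normc z.
    rewrite ler_pdivrMr ?mulr_gt0 //; have := AM x Ax; have := normc_ge0 z; nra.
  have z0 : z != 0 by rewrite -normc_gt0; exact: lt_le_trans zM.
  have Uzy : ~ U (z^-1 *: y).
    by move=> /(balancedZ z1); rewrite scalerA mulfV // scale1r.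
  have := dA x _ Ax Uzy => h.
  have -> : z *: x - y = z *: (x - z^-1 *: y) by rewrite scalerBr scalerA mulfV // scale1r.
  rewrite rnormZ ge_min; apply/orP; right.
  by rewrite mulrC; apply: ler_pM => //; exact: ltW.
pose rho := 1 + d' / (2 * M).
have rho1 : 1 < rho by rewrite /rho ltrDl divr_gt0 // mulr_gt0.
have rho0 : 0 < rho by lra.
exists rho => //.
have shrink z : normc z <= rho -> normc (z / rho%:C) <= 1.
  by move=> zr; rewrite normcM normcV ger0_normcR ?(ltW rho0) // ler_pdivrMr // mul1r.
have close z x : normc z <= rho -> A x -> rnorm (z *: x - (z / rho%:C) *: x) <= d' / 2.
  move=> zr Ax; have rC : rho%:C != 0 :> R[i] by rewrite -normc_gt0 ger0_normcR // ltW.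
  have -> : z *: x - (z / rho%:C) *: x = (z / rho%:C * (rho - 1)%:C) *: x.
    by rewrite -scalerBl rmorphB rmorph1; congr (_ *: _); field.
  have e1 : rho - 1 = d' / (2 * M) by rewrite /rho addrC addKr.
  rewrite rnormZ normcM ger0_normcR; last by rewrite e1 divr_ge0 ?(ltW d'0) // mulr_ge0 // ltW.
  have := shrink z zr; have := AM x Ax; have := normc_ge0 (z / rho%:C); have := rnorm_ge0 x.
  rewrite e1; set a := normc _; set b := rnorm x => b0 a0 bM a1.
  have -> : d' / 2 = 1 * (d' / (2 * M)) * M by field; rewrite gt_eqF.
  apply: ler_pM => //; first by rewrite mulr_ge0 // divr_ge0 ?(ltW d'0) // mulr_ge0 // ltW.
  by rewrite ler_wpM2r // divr_ge0 ?(ltW d'0) // mulr_ge0 // ltW.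
have far z x y : normc z <= rho -> A x -> ~ U y -> d' / 2 <= rnorm (z *: x - y).
  move=> zr Ax Uy; have := dist _ x y (shrink z zr) Ax Uy.
  have := rnormD ((z / rho%:C) *: x - z *: x) (z *: x - y); rewrite addrA subrK.
  by have := close z x zr Ax; rewrite [rnorm (_ - z *: x)]rnorm_sub; lra.
split.
- move=> _ [z [x [zr Ax ->]]]; apply: contrapT => Uzx.
  by have := far z x _ zr Ax Uzx; rewrite subrr rnorm0; lra.
- exists (rho * M) => _ [z [x [zr Ax ->]]]; rewrite rnormZ.
  by apply: ler_pM => //; [exact: normc_ge0|exact: rnorm_ge0|exact: AM].
- by exists (d' / 2) => [|_ y [z [x [zr Ax ->]]]]; [lra|exact: far].
Qed.

(** Terms of degree below n only: the form of degree n is given the coefficient 0. *)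
Lemma taylor_polynomial n f : holo U f ->
  let P := fun x => \sum_(k < n) taylor_term k f x in
  entire_bt P /\ continuous_polynomial (P : E -> R[i]^o).
Proof.
move=> fU P; have eP : entire_bt P.
  by apply: entire_bt_sum => k; exact: (taylor_term_polynomial oU balanced0 k fU).1.
split=> //; split; first exact: holo_continuous eP.1.
exists n, (fun (k : 'I_n.+1) (v : 'I_k -> E) =>
  (if (k < n)%N then k`!%:R^-1 else 0) * @Dn R E k f v); split.
  move=> k v i a x y /=; rewrite (Dn_multilinear oU balanced0 fU v i a x y) mulrDr.
  by rewrite /GRing.scale /=; ring.
move=> x; rewrite big_ord_recr /= ltnn mul0r addr0.
by apply: eq_bigr => k _; rewrite ltn_ord /taylor_term mulrC.
Qed.

(** The function is bounded on the multiples of A by scalars of modulus at most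
rho > 1, so Taylor polynomials converge geometrically on A. *)
Lemma polynomial_dense (g : E -> R[i]) A e : Hbt U g -> ubd U A -> 0 < e ->
  exists P : E -> R[i]^o, [/\ entire_bt P, continuous_polynomial P &
    forall x, A x -> normc (g x - P x) <= e].
Proof.
move=> [gU gb] uA e0; have [rho rho1 uB] := balanced_hull_ubd uA.
have [N gN] := gb _ uB; have [n ne] := poly_geometric_small N rho1 e0.
have [eP cP] := taylor_polynomial n gU.
exists (fun x => \sum_(k < n) taylor_term k g x); split=> // x Ax.
apply: le_trans ne; apply: (taylor_sum oU balanced0 gU rho1) => z zr.
- by case: uB => + _ _; apply; exists z, x.
- by apply: gN; exists z, x.
Qed.

End density.

(** * Operations on entire functions and polynomials *)

Section entire_algebra.
Context {R : realType} {E : normedModType R[i]}.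
Implicit Types (f g : E -> R[i]) (x y : E).
Local Notation "x %:C" := (real_complex _ x).

Lemma entire_btM f g : entire_bt f -> entire_bt g -> entire_bt (fun x => f x * g x).
Proof.
move=> [fd fb] [gd gb]; split.
  move=> x _; apply/(@differentiable_fder _ _ (fun x => f x * g x)).
  by apply: (@differentiableM _ _ (f : E -> R[i]^o) (g : E -> R[i]^o)); apply/differentiable_fder; [exact: fd|exact: gd].
move=> r; have [M fM] := fb r; have [N gN] := gb r; exists (M * N) => x xr.
by rewrite normcM ler_pM ?normc_ge0 ?fM ?gN.
Qed.

Lemma fder_scale f c x L : fder f (c *: x) L -> fder (fun y => f (c *: y)) x (fun h => L (c *: h)).
Proof.
move=> [lL [K LK] fL]; split.
- by move=> a u v; rewrite scalerDr scalerA mulrC -scalerA lL.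
- by exists (K * normc c) => h; apply: le_trans (LK _) _; rewrite rnormZ mulrA.
move=> e e0; have c1 : 0 < normc c + 1 by rewrite ltr_wpDl ?normc_ge0.
have [r r0 rP] := fL _ (divr_gt0 e0 c1).
exists (r / (normc c + 1)) => [|h]; first by rewrite divr_gt0.
rewrite ltr_pdivlMr // => hr; rewrite scalerDr.
have ch : rnorm (c *: h) < r by rewrite rnormZ; have := rnorm_ge0 h; nra.
apply: le_trans (rP _ ch) _; rewrite rnormZ mulrA ler_wpM2r ?rnorm_ge0 //.
by rewrite mulrAC ler_pdivrMr // ler_pM2l // lerDl.
Qed.

Lemma entire_bt_scale f c : entire_bt f -> entire_bt (fun y => f (c *: y)).
Proof.
move=> [fd fb]; split=> [x _|r].
  by have [L fL] := fd (c *: x) I; eexists; exact: fder_scale fL.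
have [M fM] := fb (normc c * r); exists M => x xr; apply: fM.
by rewrite rnormZ ler_wpM2l ?normc_ge0.
Qed.

Lemma entire_bt_shift f a : entire_bt f -> entire_bt (fun y => f (y + a)).
Proof.
move=> [fd fb]; split=> [x _|r].
  by have [L fL] := fd (x + a) I; exists L; exact: fder_shift.
have [M fM] := fb (r + rnorm a); exists M => x xr; apply: fM.
by apply: le_trans (rnormD _ _) _; rewrite lerD2r.
Qed.

Lemma continuous_polynomial_scale (P : E -> R[i]^o) c : continuous_polynomial P ->
  continuous_polynomial (fun y => P (c *: y)).
Proof.
move=> cP; split.
  exact: holo_continuous (entire_bt_scale c (continuous_polynomial_entire cP)).1.
case: cP => _ [n [A [mA PE]]]; exists n, (fun (k : 'I_n.+1) (v : 'I_k -> E) => c ^+ k * A k v); split.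
  by move=> k v i a x y /=; rewrite (mA k v i a x y) mulrDr /GRing.scale /=; ring.
by move=> x; rewrite PE; apply: eq_bigr => k _; exact: (diag_homog (mA k)).
Qed.

Lemma finite_type_scale (Q : E -> R[i]^o) c : finite_type_polynomial Q ->
  finite_type_polynomial (fun y => Q (c *: y) : R[i]^o).
Proof.
elim=> [a|f|P Q' _ IH1 _ IH2|P Q' _ IH1 _ IH2].
- exact: finite_type_cst.
- rewrite (_ : (fun y => _) = (c *: f : dual E)); first exact: finite_type_dual.
  by apply/funext => y; rewrite dualZ (linZ _ _ (@dual_lin _ _ f)).
- exact: finite_type_add IH1 IH2.
- exact: finite_type_mul IH1 IH2.
Qed.

Lemma finite_type_entire (Q : E -> R[i]^o) : finite_type_polynomial Q -> entire_bt Q.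
Proof.
elim=> [a|f|P Q' _ IH1 _ IH2|P Q' _ IH1 _ IH2].
- exact: entire_bt_cst.
- exact: dual_entire.
- exact: entire_btD.
- exact: entire_btM.
Qed.

Lemma dual_ball_bound (f : dual E) c x : (forall x, rnorm x <= 1 -> normc (f x) <= c) ->
  normc (f x) <= c * rnorm x.
Proof.
have lf := @dual_lin _ _ f.
move=> fc; have [->|x0] := eqVneq x 0; first by rewrite lin0 // normc0 rnorm0 mulr0.
have x1 : 0 < rnorm x by rewrite rnorm_gt0.
have := fc ((rnorm x)^-1%:C *: x); rewrite rnormZR ?invr_ge0 ?(ltW x1) // mulVf ?gt_eqF //.
move=> /(_ (lexx _)); rewrite linZ // normcM ger0_normcR ?invr_ge0 ?(ltW x1) //.
by rewrite ler_pdivrMl // mulrC.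
Qed.

End entire_algebra.

(** * Characters of an H_b(U)-convex set in a Tsirelson-like space *)

Section characters.
Context {R : realType} {E : normedModType R[i]}.
Variable U : set E.
Hypotheses (oU : open U) (bU : balanced_set U).
Implicit Types (A B : set E) (x y : E) (f g : Hb U).
Local Notation "x %:C" := (real_complex _ x).

Definition restr (g : E -> R[i]) (H : Hbt U g) : Hb U := MkHb (Hbt_pred oU H).

Lemma restrE (g : E -> R[i]) (H : Hbt U g) (u : U) : restr H u = g (val u). Proof. by []. Qed.

Let one : Hb U := restr (entire_Hbt U (@entire_bt_cst R E 1)).

Lemma ext_inU f x (Ux : U x) : ext f x = f (inU Ux).
Proof. exact: (extE f (inU Ux)). Qed.

Fixpoint Hb_pow f n : Hb U := if n is m.+1 then Hb_mul f (Hb_pow f m) else one.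

Lemma Hb_powE f n u : Hb_pow f n u = f u ^+ n.
Proof. by elim: n => //= n IH; rewrite [LHS](_ : _ = f u * Hb_pow f n u) // IH exprS. Qed.

Lemma delta_sub_Mb : delta U `<=` Mb U.
Proof.
move=> _ [x _ <-]; split=> //.
- apply: (@dominated_continuous _ _ _ [set val x] 1) => //.
    exact: ubd1 oU (valU x).
  by move=> f c c0 fc; rewrite mul1r; exact: fc.
- by exists one; exact: oner_neq0.
Qed.

Lemma Mb_one phi : Mb U phi -> phi one = 1.
Proof.
move=> [_ mphi _ [f f0]]; apply: (mulIf f0); rewrite mul1r -mphi; congr phi.
by apply: Hb_ext_eq => u; rewrite HbM mul1r.
Qed.

(** The continuity estimate for f^m bounds |phi f|^m by a constant times the m-th
power of the supremum of f; roots of order m make the constant 1. *)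
Lemma Mb_dominated phi : Mb U phi -> exists2 A, ubd U A & dominated A phi 1.
Proof.
move=> Mphi; have p1 := Mb_one Mphi; case: (Mphi) => lphi mphi cphi _.
have [A [C [uA dA]]] := continuous_dominated lphi cphi.
exists A => // f c c0 fc; rewrite mul1r.
apply: (@power_bound _ 1 _ C) => //; first exact: normc_ge0.
move=> m; rewrite mul1r -normcX.
have -> : phi f ^+ m = phi (Hb_pow f m).
  by elim: m => [|m IH] /=; rewrite ?expr0 ?p1 // exprS IH mphi.
apply: dA => [|u Au]; first exact: exprn_ge0.
by rewrite Hb_powE normcX lerXn2r ?nnegrE ?normc_ge0 // fc.
Qed.

(** The set of values is bounded, so that the supremum in the definition of the
hull is an upper bound. *)
Lemma hull_sup (A : set E) f (u : U) : ubd U A -> A (val u) ->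
  normc (f u) <= sup [set normc (f a) | a in [set a : U | A (val a)]].
Proof.
move=> uA Au; have [_ fb] := ext_Hbt f; have [M fM] := fb _ uA.
apply: ub_le_sup; last by exists u.
by exists M => _ [a Aa <-]; rewrite -extE; exact: fM.
Qed.

Section backward.
Hypotheses (cU : Hb_convex U) (tE : Tsirelson_like E).
Variables (phi : Hb U -> R[i]^o) (A : set E).
Hypotheses (Mphi : Mb U phi) (uA : ubd U A) (dA : dominated A phi 1).

Let lphi : linear phi. Proof. by case: Mphi. Qed.

Let phiB f g : phi (f - g) = phi f - phi g.
Proof.
have := lphi (-1) g f; rewrite scaleN1r [- g + f]addrC => ->.
by rewrite scaleN1r addrC.
Qed.

Let phi_close f g e : 0 <= e -> (forall u, A (val u) -> normc (f u - g u) <= e) ->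
  normc (phi f - phi g) <= e.
Proof. by move=> e0 fg; rewrite -phiB -[e]mul1r; exact: dA. Qed.

(** The restriction of phi to the dual is continuous for the norm topology because A
is bounded; reflexivity represents it by a point. *)
Let evalpt : exists x, forall (h : dual E) (H : Hbt U h), phi (restr H) = h x.
Proof.
case: (tE) => refl _.
pose Phi (h : dual E) : R[i]^o := phi (restr (entire_Hbt U (dual_entire h))).
have lPhi : linear Phi.
  by move=> a h h'; rewrite /Phi -lphi; congr phi; exact: Hb_ext_eq.
pose LPhi : {linear dual E -> R[i]^o} := HB.pack Phi
  (GRing.isLinear.Build R[i] (dual E) R[i]^o *:%R Phi lPhi).
have [|x xP] := refl LPhi.
  case: (uA) => _ [M AM] _.
  apply: (@dual_dominated_continuous _ _ _ `|M|) => // h c c0 hc.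
  have := @dA (restr (entire_Hbt U (dual_entire h))) (`|M| * c); rewrite mul1r.
  apply; first by rewrite mulr_ge0.
  move=> u Au; apply: le_trans (dual_ball_bound (val u) hc) _.
  by rewrite mulrC ler_wpM2r //; apply: le_trans (AM _ Au) _; exact: ler_norm.
by exists x => h H; rewrite -xP /=; congr phi; exact: Hb_ext_eq.
Qed.

(** On the dual, then on finite type polynomials, then on all polynomials, phi is
the evaluation at x.  That x lies in U is where convexity enters. *)
Lemma Mb_delta : delta U phi.
Proof.
have [x xP] := evalpt; case: (tE) => _ approx.
have fin (Q : E -> R[i]^o) : finite_type_polynomial Q -> forall H : Hbt U Q, phi (restr H) = Q x.
  elim=> [a|h|P Q' ftP IH1 ftQ IH2|P Q' ftP IH1 ftQ IH2] H.
  - rewrite (_ : restr H = a *: one); last by apply: Hb_ext_eq => u; rewrite HbZ [RHS]mulr1.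
    have := lphi a one 0; rewrite addr0 => ->.
    rewrite (_ : phi 0 = 0); last by have := phiB 0 0; rewrite !subrr.
    by rewrite addr0 (Mb_one Mphi) [LHS]mulr1.
  - exact: xP.
  - have eP := entire_Hbt U (finite_type_entire ftP).
    have eQ := entire_Hbt U (finite_type_entire ftQ).
    rewrite (_ : restr H = 1 *: restr eP + restr eQ); last by rewrite scale1r; exact: Hb_ext_eq.
    by rewrite lphi IH1 IH2 scale1r.
  - have eP := entire_Hbt U (finite_type_entire ftP).
    have eQ := entire_Hbt U (finite_type_entire ftQ).
    rewrite (_ : restr H = Hb_mul (restr eP) (restr eQ)); last exact: Hb_ext_eq.
    by case: Mphi => _ mphi _ _; rewrite mphi IH1 IH2.
have poly (P : E -> R[i]^o) : continuous_polynomial P -> forall H : Hbt U P, phi (restr H) = P x.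
  move=> cP H; case: (uA) => _ [M AM] _.
  (* Approximability concerns the unit ball; the dilation by r covers A and x. *)
  pose r := `|M| + rnorm x + 1.
  have r0 : 0 < r by rewrite /r; have := rnorm_ge0 x; have := normr_ge0 M; lra.
  have rC : r%:C != 0 :> R[i] by rewrite -normc_gt0 ger0_normcR // ltW.
  have rr y : r%:C^-1 *: (r%:C *: y) = y by rewrite scalerA mulVf // scale1r.
  have rr' y : r%:C *: (r%:C^-1 *: y) = y by rewrite scalerA mulfV // scale1r.
  apply/eqP; rewrite -subr_eq0; apply/eqP/eq0_normc/eqP.
  rewrite eq_le normc_ge0 andbT; apply/ler_addgt0Pr => e e0; rewrite add0r.
  have e2 : 0 < (e / 2)%:C :> R[i] by rewrite ltcR; lra.
  have [Q ftQ QP] := approx _ (continuous_polynomial_scale r%:C cP) _ e2.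
  have ftQ' := finite_type_scale r%:C^-1 ftQ.
  have near y : rnorm y <= r -> normc (P y - Q (r%:C^-1 *: y)) <= e / 2.
    move=> yr; have := QP (r%:C^-1 *: y).
    rewrite rr' rnormE -[1]/(1%:C) lecR -fmorphV rnormZR ?invr_ge0 ?(ltW r0) //.
    by rewrite ler_pdivrMl // mulr1 normcE' lecR; apply.
  pose HQ := entire_Hbt U (finite_type_entire ftQ').
  have := le_normcD (phi (restr H) - phi (restr HQ)) (Q (r%:C^-1 *: x) - P x).
  rewrite [phi (restr HQ)](fin _ ftQ') addrA subrK => /le_trans; apply.
  have -> : e = e / 2 + e / 2 by lra.
  apply: lerD; last first.
    by rewrite normc_sub; apply: near; rewrite /r; have := normr_ge0 M; lra.
  rewrite -(fin _ ftQ' HQ); apply: phi_close; first lra.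
  move=> u Au; apply: near; have := AM _ Au; have := ler_norm M; have := rnorm_ge0 x.
  rewrite /r; lra.
have Psup (P : E -> R[i]^o) c : continuous_polynomial P -> 0 <= c ->
    (forall y, A y -> normc (P y) <= c) -> normc (P x) <= c.
  move=> cP c0 Pc; have eP := entire_Hbt U (continuous_polynomial_entire cP).
  rewrite -(poly P cP eP) -[c]mul1r; apply: dA => // u Au; exact: Pc.
have [rho rho1 uB] := balanced_hull_ubd oU bU uA.
set B := [set y | _] in uB.
have Ux : U x.
  have := cU (ubd_U_bounded uB) => /U_boundedP [_ _ [d d0 dH]].
  (* By convexity, the hull of B is at distance at least d from the complement;
     it contains the points t x that are in U. *)
  have step (t : R) : 0 <= t <= 1 -> U (t%:C *: x) -> forall y, ~ U y -> d <= rnorm (t%:C *: x - y).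
    move=> t01 Utx y Uy; apply: dH => //; exists (inU Utx) => // f.
    apply/ler_addgt0Pr => e e0; have e2 : 0 < e / 2 by lra.
    have uBt := ubdU uB (ubd1 oU Utx).
    have [P [eP cP PB]] := polynomial_dense oU bU (ext_Hbt f) uBt e2.
    set S := sup _.
    have S0 : 0 <= S.
      rewrite /S; have [[u Bu]|nB] := pselect (exists u : U, B (val u)).
        exact: le_trans (normc_ge0 _) (hull_sup f uB Bu).
      rewrite (_ : [set normc (f a) | a in _] = set0) ?sup0 //.
      by apply/seteqP; split=> [z [u Bu _]|//]; case: nB; exists u.
    have tx : normc (P (t%:C *: x)) <= S + e / 2.
      apply: (Psup (fun y => P (t%:C *: y))).
      - exact: continuous_polynomial_scale.
      - lra.
      move=> z Az; have Bz : B (t%:C *: z).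
        exists t%:C, z; split=> //; rewrite ger0_normcR; lra.
      have := PB _ (or_introl Bz); have Uz : U (t%:C *: z) by case: uB => + _ _; apply.
      have := @hull_sup B f (inU Uz) uB Bz; rewrite -/S (ext_inU f Uz).
      have := ler_normc_sub (P (t%:C *: z)) (f (inU Uz)).
      rewrite [normc (P _ - f _)]normc_sub; lra.
    have := PB _ (or_intror (erefl _)); rewrite (ext_inU f Utx) => h.
    have := ler_normc_sub (f (inU Utx)) (P (t%:C *: x)); move: tx; lra.
  (* Steps of length |x| / N < d lead from 0 to x without leaving U. *)
  pose N := (Num.bound (rnorm x / d)).+1.
  have N0 : 0 < N%:R :> R by rewrite ltr0n.
  have Nd : rnorm x / N%:R < d.
    rewrite ltr_pdivrMr // mulrC -ltr_pdivrMr //.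
    apply: lt_le_trans (archi_boundP _) _; first by rewrite divr_ge0 ?rnorm_ge0 // ltW.
    by rewrite ler_nat.
  have walk k : (k <= N)%N -> U ((k%:R / N%:R)%:C *: x).
    elim: k => [|k IH] kN; first by rewrite mul0r scale0r; exact: (balanced0 bU).
    have kN' := ltnW kN; apply: contrapT => nU.
    have k1 : 0 <= (k%:R / N%:R : R) <= 1.
      by rewrite divr_ge0 //= ler_pdivrMr // mul1r ler_nat.
    have := step _ k1 (IH kN') _ nU; rewrite -scalerBl -rmorphB -mulrBl.
    rewrite -nat1r opprD addrCA subrr addr0 rnormZ mulN1r rmorphN normcN.
    by rewrite ger0_normcR ?invr_ge0 ?(ltW N0) // mulrC; lra.
  by have := walk N (leqnn _); rewrite divff ?gt_eqF // rmorph1 scale1r.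
exists (inU Ux) => //; apply/funext => f.
apply/eqP; rewrite -subr_eq0; apply/eqP/eq0_normc/eqP.
rewrite eq_le normc_ge0 andbT; apply/ler_addgt0Pr => e e0; rewrite add0r.
have e2 : 0 < e / 2 by lra.
have [P [eP cP PA]] := polynomial_dense oU bU (ext_Hbt f) (ubdU uA (ubd1 oU Ux)) e2.
have HP := entire_Hbt U eP.
have := le_normcD (f (inU Ux) - P x) (phi (restr HP) - phi f).
rewrite (poly P cP HP) addrA subrK => /le_trans; apply.
have -> : e = e / 2 + e / 2 by lra.
apply: lerD.
  by have := PA x (or_intror erefl); rewrite (ext_inU f Ux).
rewrite -(poly P cP HP); apply: phi_close; first lra.
by move=> u Au; rewrite normc_sub -extE; apply: PA; left.
Qed.

End backward.

End characters.

(** * The Hahn-Banach theorem *)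

Section sublinear.
Context {R : realType} {V : lmodType R[i]}.
Implicit Types (p q : V -> R) (v w : V).
Local Notation "x %:C" := (real_complex _ x).

Lemma le_infD (A B C : set R) (m : R) : A !=set0 -> B !=set0 -> lbound C m ->
  (forall a b, A a -> B b -> exists2 c, C c & c <= a + b) -> inf C <= inf A + inf B.
Proof.
move=> A0 B0 Cm AB; have hC : has_lbound C by exists m.
rewrite -lerBlDl; apply: lb_le_inf => // b Bb; rewrite lerBlDl -lerBlDr.
apply: lb_le_inf => // a Aa; rewrite lerBlDr; have [c Cc /(le_trans _)] := AB a b Aa Bb.
by apply; exact: ge_inf.
Qed.

Lemma le_infM (A C : set R) (m t : R) : 0 < t -> A !=set0 -> lbound C m ->
  (forall a, A a -> exists2 c, C c & c <= t * a) -> inf C <= t * inf A.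
Proof.
move=> t0 A0 Cm AC; rewrite -ler_pdivrMl //; apply: lb_le_inf => // a Aa.
rewrite ler_pdivrMl //; have [c Cc /(le_trans _)] := AC a Aa; apply; apply: ge_inf => //.
by exists m.
Qed.

Definition sublin p := (forall v w, p (v + w) <= p v + p w) /\
  (forall (t : R) v, 0 < t -> p (t%:C *: v) <= t * p v).

Lemma sublinZ p (t : R) v : sublin p -> 0 < t -> p (t%:C *: v) = t * p v.
Proof.
move=> [_ pZ] t0; apply/eqP; rewrite eq_le pZ //=.
have ti : 0 < t^-1 by rewrite invr_gt0.
have := pZ t^-1 (t%:C *: v) ti; rewrite scalerA -rmorphM mulVf ?gt_eqF //.
by rewrite scale1r ler_pdivlMl.
Qed.

Lemma sublin0 p : sublin p -> p 0 = 0.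
Proof.
move=> sp; have := @sublinZ p 2 0 sp (ltr0n _ 2); rewrite scaler0; lra.
Qed.

Lemma sublinN p v : sublin p -> - p (- v) <= p v.
Proof.
move=> sp; have := sp.1 v (- v); rewrite subrr sublin0 //; lra.
Qed.

(** The largest sublinear functional below p whose value at - w is at most - p w.
When p is minimal it coincides with p, so that p (- w) = - p w. *)
Definition tilt p w v : R := inf [set p (v + t%:C *: w) - t * p w | t in [set t | 0 <= t]].

Section tilt.
Variables (p : V -> R) (w : V).
Hypothesis sp : sublin p.

Let tilt_lb v : lbound [set p (v + t%:C *: w) - t * p w | t in [set t | 0 <= t]] (- p (- v)).
Proof.
move=> _ [t /= t0 <-]; have := sp.1 (v + t%:C *: w) (- v); rewrite addrAC subrr add0r.
have [t1|t1] := eqVneq t 0; first by rewrite t1 scale0r sublin0 //; lra.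
by rewrite sublinZ // ?lt_def ?t1 //; lra.
Qed.

Let tilt_ne v : [set p (v + t%:C *: w) - t * p w | t in [set t | 0 <= t]] !=set0.
Proof. by eexists; exists 0 => /=. Qed.

Lemma tilt_le t v : 0 <= t -> tilt p w v <= p (v + t%:C *: w) - t * p w.
Proof.
by move=> t0; apply: ge_inf; [exists (- p (- v)); exact: tilt_lb|exists t].
Qed.

Lemma tilt_le0 v : tilt p w v <= p v.
Proof. by have := @tilt_le 0 v (lexx _); rewrite scale0r addr0 mul0r subr0. Qed.

Lemma tilt_opp : tilt p w (- w) <= - p w.
Proof.
have := @tilt_le 1 (- w) ler01.
by rewrite scale1r addNr sublin0 // mul1r sub0r.
Qed.

Lemma tilt_sublin : sublin (tilt p w).
Proof.
split=> [v1 v2|c v c0].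
  apply: (le_infD (tilt_ne v1) (tilt_ne v2) (@tilt_lb _)).
  move=> _ _ [s s0 <-] [t t0 <-]; eexists; first by exists (s + t) => //; exact: addr_ge0.
  have -> : v1 + v2 + (s + t)%:C *: w = (v1 + s%:C *: w) + (v2 + t%:C *: w).
    by rewrite rmorphD scalerDl addrACA.
  by have := sp.1 (v1 + s%:C *: w) (v2 + t%:C *: w); lra.
apply: (le_infM c0 (tilt_ne v) (@tilt_lb _)).
move=> _ [s s0 <-]; eexists; first by exists (c * s) => //; exact: mulr_ge0 (ltW c0) s0.
by rewrite rmorphM -scalerA -scalerDr sublinZ // mulrBr mulrA.
Qed.

End tilt.

(** Zorn's lemma: the infimum of a chain is finite because p v is at least
- q (- v), and it is sublinear because two members of a chain are comparable. *)
Lemma sublin_min q : sublin q -> exists p, [/\ sublin p, forall v, p v <= q v &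
  forall p', sublin p' -> (forall v, p' v <= p v) -> p' = p].
Proof.
move=> sq; pose T := {p : V -> R | sublin p /\ forall v, p v <= q v}.
pose le (s t : T) := `[< forall v, sval t v <= sval s v >].
have qq : sublin q /\ forall v, q v <= q v by [].
have lb (s : T) v : - q (- v) <= sval s v.
  by case: s => p [sp pq] /=; have := sublinN v sp; have := pq (- v); lra.
have [//|||A totA|[p [sp pq]] pmin] := @Zorn T le.
- by move=> s; apply/asboolP.
- move=> r s t /asboolP rs /asboolP st; apply/asboolP => v.
  exact: le_trans (st v) (rs v).
- move=> s t /asboolP st /asboolP ts.
  case: s t st ts => s hs [t ht] /= st ts.
  have e : s = t by apply/funext => v; apply/eqP; rewrite eq_le st ts.
  by subst t; congr exist; exact: Prop_irrelevance.
- have [[s0 As0]|nA] := pselect (exists s, A s); last first.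
    by exists (exist _ q qq) => s As; case: nA; exists s.
  pose S v := [set sval s v | s in A].
  have Sne v : S v !=set0 by exists (sval s0 v); exists s0.
  have Slb v : lbound (S v) (- q (- v)) by move=> _ [s _ <-].
  have Sge v s : A s -> inf (S v) <= sval s v.
    by move=> As; apply: ge_inf; [eexists; exact: Slb|exists s].
  have sS : sublin (fun v => inf (S v)).
    split=> [v1 v2|c v c0].
      apply: (le_infD (Sne v1) (Sne v2) (@Slb _)).
      move=> _ _ [s As <-] [t At <-].
      have main r : A r -> sval r v1 <= sval s v1 -> sval r v2 <= sval t v2 ->
          exists2 c, S (v1 + v2) c & c <= sval s v1 + sval t v2.
        move=> Ar r1 r2; exists (sval r (v1 + v2)); first by exists r.
        by case: r {Ar} r1 r2 => r [[sr _] _] /= r1 r2; have := sr v1 v2; lra.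
      by have [/asboolP h|/asboolP h] := totA _ _ As At; [apply: (main t)|apply: (main s)].
    apply: (le_infM c0 (Sne v) (@Slb _)).
    move=> _ [[s [ss sq']] As <-]; exists (s (c%:C *: v)); first by exists (exist _ s (conj ss sq')).
    by rewrite /= sublinZ.
  have Sq v : inf (S v) <= q v.
    by apply: le_trans (Sge v _ As0) _; case: s0 {As0} => s [].
  by exists (exist _ (fun v => inf (S v)) (conj sS Sq)) => s As; apply/asboolP => v; exact: Sge.
exists p; split=> // p' sp' p'p.
have p'q v : p' v <= q v by exact: le_trans (p'p v) (pq v).
have := pmin (exist _ p' (conj sp' p'q)).
by move=> /(_ (asboolT p'p)) /(congr1 sval).
Qed.

(** A minimal functional equals its own tilts. *)
Lemma sublin_min_additive p : sublin p ->
  (forall p', sublin p' -> (forall v, p' v <= p v) -> p' = p) ->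
  (forall v, p (- v) = - p v) /\ forall v w, p (v + w) = p v + p w.
Proof.
move=> sp pmin; have pN v : p (- v) = - p v.
  have := pmin _ (tilt_sublin v sp) (tilt_le0 v sp) => tp.
  by have := tilt_opp v sp; rewrite tp; have := sublinN v sp; lra.
split=> // v w; apply/eqP; rewrite eq_le sp.1 /=.
by have := sp.1 (- v) (- w); rewrite -opprD !pN; lra.
Qed.

(** A minimal sublinear functional below the tilt of q along v0 is real linear and
takes the value q v0 at v0; it is the real part of the functional. *)
Lemma hahn_banach q v0 : (forall v w, q (v + w) <= q v + q w) ->
  (forall c v, q (c *: v) = normc c * q v) ->
  exists l : V -> R[i], [/\ forall c v w, l (c *: v + w) = c * l v + l w,
    forall v, normc (l v) <= q v & l v0 = (q v0)%:C].
Proof.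
move=> qD qZ.
have sq : sublin q by split=> // t v t0; rewrite qZ ger0_normcR // ltW.
have [p [sp ptilt pmin]] := sublin_min (tilt_sublin v0 sq).
have pq v : p v <= q v by apply: le_trans (ptilt v) _; exact: tilt_le0.
have [pN pD] := sublin_min_additive sp pmin.
have pv0 : p v0 = q v0.
  apply/eqP; rewrite eq_le pq -lerN2 -pN.
  by apply: le_trans (ptilt _) _; exact: tilt_opp.
have pZ (t : R) v : p (t%:C *: v) = t * p v.
  have [t0|t0|->] := ltrgtP t 0.
  - have := @sublinZ p (- t) v sp; rewrite oppr_gt0 => /(_ t0).
    by rewrite rmorphN scaleNr pN; lra.
  - exact: sublinZ.
  - by rewrite scale0r mul0r sublin0.
pose i : R[i] := Complex 0 1.
(* The complex linear functional with real part p. *)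
pose l v : R[i] := Complex (p v) (- p (i *: v)).
have lZ c v : l (c *: v) = c * l v.
  case: c => a b; have -> : Complex a b = a%:C + b%:C * i :> R[i].
    by apply/eqP; rewrite eq_complex /=; apply/andP; split; apply/eqP; ring.
  have e1 : (a%:C + b%:C * i) *: v = a%:C *: v + b%:C *: (i *: v) by rewrite scalerDl scalerA.
  have e2 : i *: ((a%:C + b%:C * i) *: v) = a%:C *: (i *: v) + (- b)%:C *: v.
    rewrite !scalerA -scalerDl; congr (_ *: _).
    by apply/eqP; rewrite eq_complex /=; apply/andP; split; apply/eqP; ring.
  rewrite /l e2 e1 !pD !pZ.
  by apply/eqP; rewrite eq_complex /=; apply/andP; split; apply/eqP; ring.
have lq v : normc (l v) <= q v.
  have [l0|l0] := eqVneq (l v) 0.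
    by rewrite l0 normc0; have := qD v (- v); have := qZ (-1) v;
      have := qZ 0 v; rewrite scale0r normc0 mul0r scaleN1r subrr normcN normc1; lra.
  have n0 : 0 < normc (l v) by rewrite normc_gt0.
  pose c := (normc (l v))%:C / l v.
  have c1 : normc c = 1 by rewrite /c normcM normcV ger0_normcR ?normc_ge0 // divff // gt_eqF.
  have : l (c *: v) = (normc (l v))%:C by rewrite lZ divfK.
  move=> /(congr1 (@complex.Re R)) /= <-.
  by apply: le_trans (pq _) _; rewrite qZ c1 mul1r.
exists l; split=> //.
- move=> c v w; rewrite -lZ /l scalerDr !pD.
  by apply/eqP; rewrite eq_complex /=; apply/andP; split; apply/eqP; ring.
have := lq v0; rewrite /l pv0 => h.
suff -> : p (i *: v0) = 0 by rewrite oppr0.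
have q0 : 0 <= q v0 by apply: le_trans h; exact: normc_ge0.
move: h; rewrite /normc /= sqrrN -(ler_pXn2r (ltn0Sn 1)) ?nnegrE ?sqrtr_ge0 //.
rewrite sqr_sqrtr ?addr_ge0 ?sqr_ge0 // => h; apply/eqP; rewrite -sqrf_eq0 eq_le sqr_ge0 andbT; lra.
Qed.

End sublinear.

Section separation.
Context {R : realType} {V : lmodType R[i]}.
Variables (q : V -> R) (W : set V).
Hypotheses (qD : forall v w, q (v + w) <= q v + q w)
  (qZ : forall c v, q (c *: v) = normc c * q v)
  (W0 : W 0) (WL : forall c v w, W v -> W w -> W (c *: v + w)).
Local Notation "x %:C" := (real_complex _ x).

Let q0 : q 0 = 0.
Proof. by have := qZ 0 0; rewrite scale0r normc0 mul0r. Qed.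

Let q_ge0 v : 0 <= q v.
Proof.
have := qD v (- v); rewrite subrr q0 -scaleN1r qZ normcN normc1 mul1r; lra.
Qed.

Let Q v := inf [set q (v - w) | w in W].

Let Qne v : [set q (v - w) | w in W] !=set0.
Proof. by eexists; exists 0. Qed.

Let Qlb v : lbound [set q (v - w) | w in W] 0.
Proof. by move=> _ [w _ <-]. Qed.

Let Q_le v w : W w -> Q v <= q (v - w).
Proof. by move=> Ww; apply: ge_inf; [exists 0; exact: Qlb|exists w]. Qed.

Let WD v w : W v -> W w -> W (v + w).
Proof. by move=> Wv Ww; rewrite -[v]scale1r; exact: WL. Qed.

Let WZ c v : W v -> W (c *: v).
Proof. by move=> Wv; rewrite -[_ *: _]addr0; exact: WL. Qed.

Let QZ_le c v : c != 0 -> Q (c *: v) <= normc c * Q v.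
Proof.
move=> c0; have n0 : 0 < normc c by rewrite normc_gt0.
apply: (le_infM n0 (Qne v) (@Qlb _)) => _ [w Ww <-].
by exists (q (c *: v - c *: w)); [exists (c *: w) => //; exact: WZ|rewrite -scalerBr qZ].
Qed.

(** Hahn-Banach for the quotient seminorm of q by W. *)
Lemma hahn_banach_sep v0 e : (forall w, W w -> e <= q (v0 - w)) ->
  exists (l : V -> R[i]) (a : R), [/\ forall c v w, l (c *: v + w) = c * l v + l w,
    forall v, normc (l v) <= q v, forall w, W w -> l w = 0, l v0 = a%:C & e <= a].
Proof.
move=> ev; have [||l [lL lQ lv]] := @hahn_banach R V Q v0.
- move=> v w; apply: (le_infD (Qne v) (Qne w) (@Qlb _)).
  move=> _ _ [v' Wv <-] [w' Ww <-]; exists (q (v + w - (v' + w'))).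
    by exists (v' + w') => //; exact: WD.
  by rewrite opprD addrACA; exact: qD.
- move=> c v; have [->|c0] := eqVneq c 0.
    rewrite scale0r normc0 mul0r; apply/eqP; rewrite eq_le.
    have := Q_le 0 W0; rewrite subrr q0 => -> /=.
    exact: lb_le_inf (Qne 0) (@Qlb _).
  apply/eqP; rewrite eq_le QZ_le //=.
  have := @QZ_le c^-1 (c *: v); rewrite invr_eq0 c0 scalerA mulVf // scale1r.
  move=> /(_ isT); rewrite normcV; have n0 : 0 < normc c by rewrite normc_gt0.
  by rewrite ler_pdivlMl.
exists l, (Q v0); split=> //.
- by move=> v; apply: le_trans (lQ v) _; have := Q_le v W0; rewrite subr0.
- move=> w Ww; apply/eq0_normc/eqP; rewrite eq_le normc_ge0 andbT.
  by apply: le_trans (lQ w) _; have := Q_le w Ww; rewrite subrr q0.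
- by apply: lb_le_inf (Qne _) _ => _ [w Ww <-]; exact: ev.
Qed.

End separation.

(** * Norming functionals and finite rank operators *)

Section norming.
Context {R : realType} {E : normedModType R[i]}.
Implicit Types (x y : E).
Local Notation "x %:C" := (real_complex _ x).

Lemma linB L x y : lin L -> L (x - y) = L x - L y.
Proof. by move=> lL; rewrite addrC -scaleN1r lL mulN1r addrC. Qed.

Lemma norming x : exists g : dual E,
  (forall y, normc (g y) <= rnorm y) /\ g x = (rnorm x)%:C.
Proof.
have [||l [lL lq lx]] := @hahn_banach R E (@rnorm R E) x.
- exact: rnormD.
- by move=> c v; rewrite rnormZ.
have lq1 y : normc (l y) <= 1 * rnorm y by rewrite mul1r.
by exists (mkdual (L := l) lL lq1).
Qed.

Lemma dual_separates x y : (forall f : dual E, f x = f y) -> x = y.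
Proof.
move=> fxy; have [g [_ gE]] := norming (x - y).
apply/eqP; rewrite -subr_eq0; apply/eqP/rnorm_eq0/(@complexI R).
by rewrite -gE (linB _ _ (dual_lin g)) fxy subrr.
Qed.

(** Operators x |-> sum_i f_i (x) e_i, with the pairs (f_i, e_i) in a list. *)
Definition frk (s : seq (dual E * E)) x : E := \sum_(p <- s) p.1 x *: p.2.

Lemma frk_cons p s x : frk (p :: s) x = p.1 x *: p.2 + frk s x.
Proof. by rewrite /frk big_cons. Qed.

Lemma frk_cat s s' x : frk (s ++ s') x = frk s x + frk s' x.
Proof. by rewrite /frk big_cat. Qed.

Lemma frk_scale c s x : frk [seq (c *: p.1, p.2) | p <- s] x = c *: frk s x.
Proof.
by rewrite /frk big_map scaler_sumr; apply: eq_bigr => p _; rewrite scalerA.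
Qed.

Lemma frk_lin s c u v : frk s (c *: u + v) = c *: frk s u + frk s v.
Proof.
rewrite /frk scaler_sumr -big_split; apply: eq_bigr => p _.
by rewrite (dual_lin p.1) scalerDl scalerA.
Qed.

Lemma frk_bound s : exists2 K : R, 0 <= K & forall x, rnorm (frk s x) <= K * rnorm x.
Proof.
elim: s => [|p s [K K0 IH]]; first by exists 0 => // x; rewrite /frk big_nil rnorm0 mul0r.
have [M M0 pM] := dual_bound p.1; exists (M * rnorm p.2 + K).
  by rewrite addr_ge0 // mulr_ge0 // rnorm_ge0.
move=> x; rewrite frk_cons; apply: le_trans (rnormD _ _) _.
by rewrite mulrDl lerD // rnormZ mulrAC ler_wpM2r ?rnorm_ge0.
Qed.

(** Induction on the number of spanning vectors: a functional with value 1 at the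
first one, if nonzero, splits off one term and projects the others. *)
Lemma finite_rank_frk (T : E -> E) (K : R) : (forall c u v, T (c *: u + v) = c *: T u + T v) ->
  (forall x, rnorm (T x) <= K * rnorm x) -> finite_rank T -> exists s, T = frk s.
Proof.
move=> lT bT [n [e]]; elim: n e T K lT bT => [|n IH] e T K lT bT eT.
  exists [::]; apply/funext => x; have [c ->] := eT x.
  by rewrite big_ord0 /frk big_nil.
have [g ge] : exists g : dual E, g (e ord0) *: e ord0 = e ord0.
  have [->|e0] := eqVneq (e ord0) 0; first by exists 0; rewrite scaler0.
  have [g [_ gE]] := norming (e ord0); exists ((rnorm (e ord0))%:C^-1 *: g).
  rewrite dualZ gE mulVf ?scale1r // -normc_gt0 ger0_normcR ?rnorm_ge0 //.
  by rewrite rnorm_gt0.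
have [M M0 gM] := dual_bound g.
have gT c u v : g (T (c *: u + v)) = c * g (T u) + g (T v) by rewrite lT (dual_lin g).
have gTb x : normc (g (T x)) <= M * K * rnorm x.
  by apply: le_trans (gM _) _; rewrite -mulrA ler_wpM2l.
pose T' x := T x - g (T x) *: e ord0.
have [||x|s sE] := IH (fun i => e (lift ord0 i) - g (e (lift ord0 i)) *: e ord0) T'
    (K + M * K * rnorm (e ord0)).
- move=> c u v; rewrite /T' gT lT scalerDl -scalerA scalerBr opprD addrACA //.
- move=> x; apply: le_trans (rnormD _ _) _; rewrite rnormN mulrDl lerD // rnormZ.
  by rewrite mulrAC ler_wpM2r ?rnorm_ge0.
- have [c cE] := eT x; exists (fun i => c (lift ord0 i)).
  have gS : g (T x) = \sum_i c i * g (e i).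
    rewrite cE (big_morph g (id1 := 0) (op1 := +%R)).
    + by apply: eq_bigr => i _; rewrite (linZ _ _ (dual_lin g)).
    + by move=> u v; rewrite (linD _ _ (dual_lin g)).
    + exact: lin0 (dual_lin g).
  rewrite /T' gS cE scaler_suml -sumrB big_ord_recl -scalerA ge subrr add0r.
  by apply: eq_bigr => i _; rewrite -scalerA scalerBr.
exists ((mkdual gT gTb, e ord0) :: s); apply/funext => x.
by rewrite frk_cons -sE /T' /= addrC subrK.
Qed.

End norming.

(** * Trace duality and the approximation property of the dual *)

Section bounded_functions.
Context {R : realType} {T : Type}.

Definition bfun_pred : {pred T -> R[i]^o} :=
  fun f => `[< exists M : R, forall t, normc (f t) <= M >].

Lemma bfun_submod : submod_closed bfun_pred.
Proof.
split=> [|c f g /asboolP[M fM] /asboolP[N gN]]; apply/asboolP.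
  by exists 0 => t; rewrite normc0.
exists (normc c * M + N) => t; have -> : (c *: f + g) t = c * f t + g t by [].
by apply: le_trans (le_normcD _ _) _; rewrite normcM lerD ?ler_wpM2l ?normc_ge0.
Qed.

HB.instance Definition _ :=
  GRing.isSubmodClosed.Build R[i] (T -> R[i]^o) bfun_pred bfun_submod.

Record bfun := Bfun { bfun_val :> T -> R[i]^o ; _ : bfun_val \in bfun_pred }.

HB.instance Definition _ := [isSub for bfun_val].
HB.instance Definition _ := [Choice of bfun by <:].
HB.instance Definition _ := [SubChoice_isSubLmodule of bfun by <:].

Implicit Types (f g : bfun).

Lemma bfunD f g t : (f + g) t = f t + g t. Proof. by []. Qed.
Lemma bfunB f g t : (f - g) t = f t - g t. Proof. by []. Qed.
Lemma bfunZ c f t : (c *: f) t = c * f t. Proof. by []. Qed.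

Lemma bfunP f g : (forall t, f t = g t) -> f = g.
Proof. by move=> fg; apply: val_inj; apply/funext. Qed.

Lemma bfun_sum (I : Type) (s : seq I) (F : I -> bfun) t :
  (\sum_(i <- s) F i) t = \sum_(i <- s) F i t.
Proof. by elim: s => [|i s IH]; rewrite ?big_nil // !big_cons bfunD IH. Qed.

Definition bnorm f : R := sup (range (fun t => normc (f t))).

Lemma bnorm_ge f t : normc (f t) <= bnorm f.
Proof.
apply: ub_le_sup; last by exists t.
by case: f => f /= /asboolP[M fM]; exists M => _ [u _ <-].
Qed.

Lemma bnorm_le f c : 0 <= c -> (forall t, normc (f t) <= c) -> bnorm f <= c.
Proof.
move=> c0 fc; have [[t _]|nT] := pselect (exists t : T, True).
  by apply: ge_sup => [|_ [u _ <-]//]; exists (normc (f t)), t.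
rewrite /bnorm [X in sup X](_ : _ = set0) ?sup0 //.
by apply/seteqP; split=> [z [u _ _]|//]; case: nT; exists u.
Qed.

Lemma bnorm_ge0 f : 0 <= bnorm f.
Proof.
have [[t _]|nT] := pselect (exists t : T, True).
  exact: le_trans (normc_ge0 _) (bnorm_ge f t).
rewrite /bnorm [X in sup X](_ : _ = set0) ?sup0 //.
by apply/seteqP; split=> [z [u _ _]|//]; case: nT; exists u.
Qed.

Lemma bnormD f g : bnorm (f + g) <= bnorm f + bnorm g.
Proof.
apply: bnorm_le => [|t]; first by rewrite addr_ge0 ?bnorm_ge0.
by rewrite bfunD; apply: le_trans (le_normcD _ _) _; rewrite lerD ?bnorm_ge.
Qed.

Lemma bnormZ c f : bnorm (c *: f) = normc c * bnorm f.
Proof.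
have le d g : bnorm (d *: g) <= normc d * bnorm g.
  apply: bnorm_le => [|t]; first by rewrite mulr_ge0 ?normc_ge0 ?bnorm_ge0.
  by rewrite bfunZ normcM ler_wpM2l ?normc_ge0 ?bnorm_ge.
apply/eqP; rewrite eq_le le /=; have [->|c0] := eqVneq c 0.
  by rewrite normc0 mul0r bnorm_ge0.
have := le c^-1 (c *: f); rewrite scalerA mulVf // scale1r normcV.
by rewrite ler_pdivlMl // normc_gt0.
Qed.

End bounded_functions.

Section null_families.
Context {R : realType} {E : normedModType R[i]}.
Implicit Types (x y : E).
Local Notation "x %:C" := (real_complex _ x).

(** A filter that does not cluster at 0 contains one of the finite sets of points
outside a neighbourhood of 0. *)
Lemma compact_null (I : choiceType) (y : I -> E) :
  (forall e : R, 0 < e -> exists s : seq I, forall i, i \notin s -> rnorm (y i) <= e) ->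
  compact ([set 0] `|` range y).
Proof.
move=> ny F PF FY; have [c0|] := pselect (cluster F 0); first by exists 0; split=> //; left.
move=> /existsNP[A] /existsNP[B] /not_implyP[FA] /not_implyP[/nbhs_rnormP[e e0 eB] AB].
have [|s sy] := ny (e / 2); first lra.
have FC : F [set y i | i in [set` s]].
  apply: filterS2 FA FY => x Ax; case=> [x0|[i _ yx]].
    by case: AB; exists x; split=> //; apply: eB; rewrite x0 subr0 rnorm0.
  have [si|si] := boolP (i \in s); first by exists i.
  case: AB; exists x; split=> //; apply: eB; rewrite subr0 -yx.
  by have := sy i si; lra.
have fC : finite_set [set y i | i in [set` s]] by exact/finite_image/finite_seq.
have [x [[i _ yx] cx]] := finite_compact fC PF FC.
by exists x; split=> //; right; exists i.
Qed.

Variables (I : choiceType) (z : I -> dual E) (r : I -> R).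
Hypotheses (reflE : @reflexive_space R E) (apE : approximation_property E)
  (r0 : forall i, 0 <= r i) (zr : forall i x, normc (z i x) <= r i ^+ 2 * rnorm x)
  (rnull : forall e : R, 0 < e -> exists s : seq I, forall i, i \notin s -> r i <= e).

Let B := {x : E | rnorm x <= 1}.
Let X := @bfun R (I * B).

Let rbd : exists2 b : R, 0 < b & forall i, r i <= b.
Proof.
have [s sr] := rnull ltr01; have S0 : 0 <= \sum_(i <- s) r i by exact: sumr_ge0.
exists (1 + \sum_(i <- s) r i) => [|i]; first lra.
have [si|/sr] := boolP (i \in s); last lra.
rewrite (big_rem i) //=; have : 0 <= \sum_(j <- rem i s) r j by exact: sumr_ge0.
lra.
Qed.

Let Tfun_pred (T : E -> E) (K : R) : (forall x, rnorm (T x) <= K * rnorm x) ->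
  (fun t : I * B => z t.1 (T (sval t.2)) : R[i]^o) \in @bfun_pred R (I * B).
Proof.
move=> TK; have [b b0 rb] := rbd; apply/asboolP; exists (b ^+ 2 * `|K|) => -[i [x x1]] /=.
apply: le_trans (zr _ _) _; apply: ler_pM; rewrite ?rnorm_ge0 ?sqr_ge0 //.
  by rewrite lerXn2r ?nnegrE // ltW.
apply: le_trans (TK x) _; apply: (@le_trans _ _ (`|K| * rnorm x)).
  by rewrite ler_wpM2r ?rnorm_ge0 ?ler_norm.
by rewrite ler_piMr.
Qed.

Let put_pred (i : I) (g : dual E) :
  (fun t : I * B => (if t.1 == i then g (sval t.2) else 0) : R[i]^o) \in @bfun_pred R (I * B).
Proof.
have [K K0 gK] := dual_bound g; apply/asboolP; exists K => -[j [x x1]] /=.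
case: ifP => _; last by rewrite normc0.
by apply: le_trans (gK x) _; rewrite ler_piMr.
Qed.

Let put i g : X := Bfun (put_pred i g).

Let put_sum (s : seq I) (h : I -> dual E) t : uniq s ->
  (\sum_(i <- s) put i (h i)) t = if t.1 \in s then h t.1 (sval t.2) else 0.
Proof.
case: t => j x; rewrite bfun_sum /=; elim: s => [|i s IH] /=; first by rewrite big_nil.
move=> /andP[nis us]; rewrite big_cons IH //= inE; have [ji|ji] := eqVneq j i.
  by rewrite ji (negbTE nis) addr0.
by rewrite /= add0r.
Qed.

(** Otherwise some functional l on bounded functions of (i, x) vanishes on the
functions z_i (S x) for S of finite rank, but not on z_i (x).  By reflexivity its
components are evaluations at points xs i, whose norms sum to at most 1, and
l (z_i (T x)) = sum_i z_i (T (xs i)).  The approximation property, applied to the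
null family of the vectors xs i rescaled to norm r i, gives a T of finite rank
for which this sum is close to that of the identity. *)
Lemma null_family_approx e : 0 < e -> exists s : seq (dual E * E), forall i x,
  rnorm x <= 1 -> normc (z i x - z i (frk s x)) <= e.
Proof.
move=> e0; apply: contrapT => nos.
have id1 x : rnorm (idfun x) <= 1 * rnorm x by rewrite mul1r.
pose v0 : X := Bfun (Tfun_pred id1).
pose W : set X := [set f | exists s, forall t, f t = z t.1 (frk s (sval t.2))].
have W0 : W 0 by exists [::] => t; rewrite /frk big_nil (lin0 (dual_lin _)).
have WL c (v w : X) : W v -> W w -> W (c *: v + w).
  move=> [s vE] [s' wE]; exists ([seq (c *: p.1, p.2) | p <- s] ++ s') => t.
  by rewrite bfunD bfunZ vE wE frk_cat frk_scale (dual_lin (z t.1)).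
have far w : W w -> e <= bnorm (v0 - w).
  move=> [s wE]; rewrite leNgt; apply/negP => lt; apply: nos; exists s => i x x1.
  have := bnorm_ge (v0 - w) (i, exist _ x x1); rewrite bfunB wE /= => /le_trans; apply.
  exact: ltW.
have [l [a [lL lq lW la ea]]] := hahn_banach_sep (@bnormD R (I * B)) (@bnormZ R (I * B)) W0 WL far.
have l0 : l 0 = 0 by exact: lW.
have lD f g : l (f + g) = l f + l g by have := lL 1 f g; rewrite scale1r mul1r.
have lB f g : l (f - g) = l f - l g.
  by have := lL (-1) g f; rewrite scaleN1r [- g + f]addrC => ->; rewrite mulN1r addrC.
have lsum s (F : I -> X) : l (\sum_(i <- s) F i) = \sum_(i <- s) l (F i).
  by rewrite (big_morph l lD l0).
have /choice[xs xsE] i : exists x, forall g, l (put i g) = g x.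
  pose Phi (g : dual E) : R[i]^o := l (put i g).
  have lPhi : linear Phi.
    move=> c g g'; rewrite /Phi -[RHS]lL; congr l; apply: bfunP => -[j x].
    rewrite bfunD bfunZ /=; case: ifP => _ //; by rewrite mulr0 addr0.
  pose LPhi : {linear dual E -> R[i]^o} := HB.pack Phi
    (GRing.isLinear.Build R[i] (dual E) R[i]^o *:%R Phi lPhi).
  have [|x xP] := reflE (Phi := LPhi); last by exists x.
  apply: (@dual_dominated_continuous _ _ _ 1) => // g c c0 gc; rewrite mul1r.
  apply: le_trans (lq _) _; apply: bnorm_le => // -[j [x x1]] /=.
  by case: ifP => _; [exact: gc|rewrite normc0].
(* The norms of the points are tested by a sum of norming functionals. *)
have xs1 s : uniq s -> \sum_(i <- s) rnorm (xs i) <= 1.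
  move=> us; have /choice[g gP] i := norming (xs i).
  have S0 : 0 <= \sum_(i <- s) rnorm (xs i) by apply: sumr_ge0 => i _; exact: rnorm_ge0.
  have := lq (\sum_(i <- s) put i (g i)); rewrite lsum.
  rewrite (eq_bigr (fun i => (rnorm (xs i))%:C)); last by move=> i _; rewrite xsE (gP i).2.
  rewrite -rmorph_sum ger0_normcR // => /le_trans; apply; apply: bnorm_le => // t.
  rewrite put_sum //; case: ifP => _; last by rewrite normc0.
  by apply: le_trans ((gP _).1 _) _; exact: svalP t.2.
(* Up to the members of the family outside s, l takes z_i (T x) to the trace. *)
have tail T K s d : (forall c u v, T (c *: u + v) = c *: T u + T v) ->
    (forall x, rnorm (T x) <= K * rnorm x) -> 0 <= K -> uniq s ->
    (forall i, i \notin s -> r i <= d) -> 0 <= d ->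
    forall f : X, (forall t, f t = z t.1 (T (sval t.2))) ->
    normc (l f - \sum_(i <- s) z i (T (xs i))) <= d ^+ 2 * K.
  move=> lT TK K0 us sd d0 f fE.
  have zT i c u v : z i (T (c *: u + v)) = c * z i (T u) + z i (T v).
    by rewrite lT (dual_lin (z i)).
  have zTb i x : normc (z i (T x)) <= r i ^+ 2 * K * rnorm x.
    by apply: le_trans (zr _ _) _; rewrite -mulrA ler_wpM2l ?sqr_ge0.
  pose h i := mkdual (zT i) (zTb i).
  have -> : \sum_(i <- s) z i (T (xs i)) = l (\sum_(i <- s) put i (h i)).
    by rewrite lsum; apply: eq_bigr => i _; rewrite xsE.
  have -> : l f - l (\sum_(i <- s) put i (h i)) = l (f - \sum_(i <- s) put i (h i)).
    by rewrite lB.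
  apply: le_trans (lq _) _; apply: bnorm_le => [|[i [x x1]]].
    by rewrite mulr_ge0 ?sqr_ge0.
  rewrite bfunB put_sum // fE /=; have [si|si] := boolP (i \in s).
    by rewrite subrr normc0 mulr_ge0 ?sqr_ge0.
  rewrite subr0; apply: le_trans (zTb i x) _; rewrite -[leRHS]mulr1.
  apply: ler_pM => //; rewrite ?rnorm_ge0 ?mulr_ge0 ?sqr_ge0 //.
  by rewrite ler_wpM2r // lerXn2r ?nnegrE // sd.
(* With the norms r i the points tend to 0, while z_i compensates the scaling since
   its norm is at most r i ^ 2. *)
pose y i := (r i / rnorm (xs i))%:C *: xs i.
have yr i : rnorm (y i) <= r i.
  rewrite rnormZR ?divr_ge0 ?rnorm_ge0 //.
  by have [->|x0] := eqVneq (rnorm (xs i)) 0; [rewrite mulr0|rewrite divfK].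
have cY : compact ([set 0] `|` range y).
  apply: compact_null => d /rnull[s sd]; exists s => i /sd; exact: le_trans.
have [b b0 rb] := rbd.
pose eta := e / (2 * b); have eta0 : 0 < eta by rewrite divr_gt0 // mulr_gt0.
have [|T0 [cT0 fT0 T0y]] := apE cY (eps := eta%:C); first by rewrite ltcR.
have [K0 K00 T0K] := linear_lipschitz cT0.
have K0E : K0 = (complex.Re K0)%:C by rewrite RRe_real // gtr0_real.
have [|||s0 s0E] := @finite_rank_frk R E T0 (complex.Re K0).
- by move=> c u v; rewrite linearP.
- by move=> x; have := T0K x; rewrite K0E !rnormE -rmorphM lecR.
- exact: fT0.
have [M M0 s0M] := frk_bound s0.
pose T x := x - frk s0 x.
have lT c u v : T (c *: u + v) = c *: T u + T v.
  by rewrite /T frk_lin scalerBr opprD addrACA.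
have TK x : rnorm (T x) <= (1 + M) * rnorm x.
  by apply: le_trans (rnormD _ _) _; rewrite rnormN mulrDl mul1r lerD2l.
have TY i : rnorm (T (y i)) <= eta.
  have /T0y : ([set 0] `|` range y) (y i) by right; exists i.
  by rewrite rnormE lecR s0E rnorm_sub.
pose w0 : X := Bfun (Tfun_pred s0M).
have lf : l (v0 - w0) = a%:C.
  rewrite lB la (lW w0) ?subr0 //.
  by exists s0.
pose d := Num.min 1 (e / (4 * (1 + M))).
have M1 : 0 < 1 + M by lra.
have d0 : 0 < d by rewrite lt_min ltr01 divr_gt0 // mulr_gt0.
have d1 : d <= 1 by rewrite ge_min lexx.
have dM : d * (1 + M) <= e / 4.
  rewrite -ler_pdivlMr // ge_min; apply/orP; right.
  by rewrite -mulrA -invfM mulrC.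
have [s sd] := rnull d0; have us := undup_uniq s.
have sd' i : i \notin undup s -> r i <= d by rewrite mem_undup; exact: sd.
have := @tail T (1 + M) _ d lT TK (ltW M1) us sd' (ltW d0) (v0 - w0).
have fE t : (v0 - w0) t = z t.1 (T (sval t.2)).
  by rewrite bfunB /T (linB _ _ (dual_lin (z t.1))).
move=> /(_ fE); rewrite lf => near.
have be0 : 0 <= b * eta by rewrite mulr_ge0 ?(ltW b0) ?(ltW eta0).
have T00 : T 0 = 0.
  have := TK 0; rewrite rnorm0 mulr0 => h; apply: rnorm_eq0.
  by apply/eqP; rewrite eq_le h rnorm_ge0.
have zTxs i : normc (z i (T (xs i))) <= rnorm (xs i) * (b * eta).
  have [x0|x0] := eqVneq (rnorm (xs i)) 0.
    by rewrite x0 mul0r (rnorm_eq0 x0) T00 (lin0 (dual_lin _)) normc0.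
  have [ri|ri] := eqVneq (r i) 0.
    apply: le_trans (zr _ _) _; rewrite ri expr0n mul0r.
    by rewrite mulr_ge0 ?rnorm_ge0.
  have ri0 : 0 < r i by rewrite lt_def ri r0.
  have xE : xs i = (rnorm (xs i) / r i)%:C *: y i.
    by rewrite /y scalerA -rmorphM mulrA divfK // divff // scale1r.
  have TZ c u : T (c *: u) = c *: T u.
    by have := lT c u 0; rewrite T00 !addr0.
  rewrite [X in T X]xE TZ (linZ _ _ (dual_lin _)) normcM ger0_normcR ?divr_ge0 ?rnorm_ge0 //.
  rewrite -mulrA ler_wpM2l ?rnorm_ge0 //.
  rewrite ler_pdivrMl //; apply: le_trans (zr _ _) _.
  rewrite expr2 -mulrA ler_wpM2l // ; apply: ler_pM => //; exact: rnorm_ge0.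
have main : normc (\sum_(i <- undup s) z i (T (xs i))) <= b * eta.
  have : normc (\sum_(i <- undup s) z i (T (xs i))) <= \sum_(i <- undup s) rnorm (xs i) * (b * eta).
    elim: (undup s) => [|j q IH]; first by rewrite !big_nil normc0.
    by rewrite !big_cons; apply: le_trans (le_normcD _ _) _; rewrite lerD.
  move=> /le_trans; apply; rewrite -mulr_suml ler_piMl ?xs1 //.
have be : b * eta = e / 2 by rewrite /eta; field; rewrite gt_eqF.
have := ler_normc_sub a%:C (\sum_(i <- undup s) z i (T (xs i))).
rewrite ger0_normcR; last by lra.
have : d ^+ 2 * (1 + M) <= e / 4.
  apply: le_trans dM; rewrite ler_wpM2r ?(ltW M1) // expr2 ler_piMl // ltW //.
lra.
Qed.

End null_families.

Section totally_bounded.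
Context {R : realType} {E : normedModType R[i]}.
Hypotheses (reflE : @reflexive_space R E) (apE : approximation_property E).
Implicit Types (x y : E) (K : set (dual E)).
Local Notation "x %:C" := (real_complex _ x).

Definition dual_le (f : dual E) (c : R) := forall x, rnorm x <= 1 -> normc (f x) <= c.

Definition totally_bounded_dual K := forall e : R, 0 < e -> exists s : seq (dual E),
  forall k, K k -> exists2 c, c \in s & dual_le (k - c) e.

Lemma dual_leD f g a b : dual_le f a -> dual_le g b -> dual_le (f + g) (a + b).
Proof.
by move=> fa gb x x1; apply: le_trans (le_normcD _ _) _; rewrite lerD ?fa ?gb.
Qed.

Lemma dual_leZ f a (t : R) : 0 <= t -> dual_le f a -> dual_le (t%:C *: f) (t * a).
Proof. by move=> t0 fa x x1; rewrite dualZ normcM ger0_normcR // ler_wpM2l ?fa. Qed.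

Lemma dual_leN f a : dual_le f a -> dual_le (- f) a.
Proof.
move=> fa x /fa; rewrite (_ : (- f : dual E) x = - f x) ?normcN //.
Qed.

Lemma geometric_small (e : R) : 0 < e -> exists n : nat, (2^-1) ^+ n <= e.
Proof.
move=> e0; have [n ne] := @poly_geometric_small R 2 1 e (ltr1n _ 2) e0; exists n.
apply: le_trans ne; rewrite mulr1 exprVn ler_peMl // ?ler1n //.
Qed.

(** A member of K is a sum of differences of elements of finer and finer finite
nets; the differences at level j, multiplied by 2^j, still tend to 0 with j, so
that they form a null family to which null_family_approx applies. *)
Let half_approx K e : totally_bounded_dual K -> (forall k, K k -> dual_le k (2^-1)) -> 0 < e ->
  exists s : seq (dual E * E), forall k x, K k -> rnorm x <= 1 ->
    normc (k x - k (frk s x)) <= e.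
Proof.
move=> tK K2 e0; pose h : R := 2^-1.
have h0 : 0 < h by rewrite invr_gt0.
have h1 : h < 1 by rewrite invf_lt1 ?ltr1n.
have hE : 2 * h = 1 by rewrite mulfV.
have hj j : 0 < h ^+ j by rewrite exprn_gt0.
have d0 j : 0 < h ^+ j ^+ 3 / 2 by rewrite divr_gt0 // exprn_gt0.
have /choice[N NP] j := tK _ (d0 j).
(* The net at level 0 is reduced to 0, which suffices in the ball of radius 1/2. *)
pose N' j := if j is 0%N then [:: 0] else N j.
have N'P j k : K k -> exists2 c, c \in N' j & dual_le (k - c) (h ^+ j ^+ 3 / 2).
  case: j => [|j] Kk; last exact: NP.
  by exists 0; rewrite ?mem_head // subr0 !expr1n mul1r; exact: K2.
pose L j := [seq ((h ^+ j)^-1)%:C *: (a - b) | a <- N' j.+1, b <- N' j].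
pose good j (g : dual E) := `[< forall x, normc (g x) <= h ^+ j ^+ 2 * rnorm x >].
pose z (p : nat * nat) : dual E := let g := nth 0 (L p.1) p.2 in if good p.1 g then g else 0.
pose r (p : nat * nat) : R := if (p.2 < size (L p.1))%N then h ^+ p.1 else 0.
have e4 : 0 < e / 4 by lra.
have [|||s sP] := @null_family_approx R E (nat * nat)%type z r reflE apE _ _ _ (e / 4) e4.
- by move=> p; rewrite /r; case: ifP => // _; exact: ltW.
- move=> [j i] x; rewrite /z /r /=; case: ifP => [|_]; last first.
    by rewrite normc0 mulr_ge0 ?sqr_ge0 ?rnorm_ge0.
  case: ltnP => [_ /asboolP //|ij _].
  by rewrite nth_default // normc0 mulr_ge0 ?sqr_ge0 ?rnorm_ge0.
- move=> d d00; have [J Jd] := geometric_small d00.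
  exists [seq (j, i) | j <- iota 0 J, i <- iota 0 (size (L j))] => -[j i] ni.
  rewrite /r /=; case: ltnP => ij; last exact: ltW.
  apply: le_trans Jd; apply: ler_wiXn2l; rewrite ?(ltW h0) ?(ltW h1) //.
  rewrite leqNgt; apply/negP => jJ; move/negP: ni; apply.
  by apply/allpairsPdep; exists j, i; split=> //; rewrite mem_iota.
exists s => k x Kk x1; have /choice[c cP] j : exists c : dual E, c \in N' j /\ dual_le (k - c) (h ^+ j ^+ 3 / 2).
  by have [c] := N'P j k Kk; exists c.
have step j : normc ((c j.+1 - c j) x - (c j.+1 - c j) (frk s x)) <= h ^+ j * (e / 4).
  pose g := ((h ^+ j)^-1)%:C *: (c j.+1 - c j).
  have gE y : (c j.+1 - c j) y = (h ^+ j)%:C * g y.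
    by rewrite /g dualZ mulrA -rmorphM mulfV ?gt_eqF // mul1r.
  have gL : g \in L j.
    by apply/allpairsP; exists (c j.+1, c j); split=> //=; [exact: (cP j.+1).1|exact: (cP j).1].
  have gg : good j g.
    apply/asboolP => y; apply: dual_ball_bound => u u1.
    have : dual_le g ((h ^+ j)^-1 * (h ^+ j ^+ 3 / 2 + h ^+ j.+1 ^+ 3 / 2)).
      apply: dual_leZ; first by rewrite invr_ge0 ltW.
      have -> : c j.+1 - c j = (k - c j) + - (k - c j.+1).
        by rewrite opprB addrAC [k + _]addrC subrK.
      by apply: dual_leD; [exact: (cP j).2|apply: dual_leN; exact: (cP j.+1).2].
    move=> /(_ u u1) /le_trans; apply; rewrite ler_pdivrMl // -exprS.
    have : h ^+ j.+1 ^+ 3 <= h ^+ j ^+ 3.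
      by rewrite lerXn2r ?nnegrE ?(ltW (hj _)) // exprS ler_piMl ?(ltW (hj j)) // ltW.
    lra.
  have := sP (j, index g (L j)) x x1; rewrite /z /= nth_index // gg => gle.
  rewrite (_ : _ - _ = (h ^+ j)%:C * (g x - g (frk s x))); last first.
    by rewrite mulrBr; congr (_ - _); exact: gE.
  by rewrite normcM ger0_normcR ?(ltW (hj j)) // ler_wpM2l // ltW.
have sum J : normc (c J x - c J (frk s x)) <= (2 - 2 * h ^+ J) * (e / 4).
  elim: J => [|J IH].
    have := (cP 0%N).1; rewrite /= inE => /eqP ->.
    by rewrite subrr normc0 expr0 mulr1 subrr mul0r.
  have -> : c J.+1 x - c J.+1 (frk s x) =
      ((c J.+1 - c J) x - (c J.+1 - c J) (frk s x)) + (c J x - c J (frk s x)).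
    by rewrite !dualB; ring.
  apply: le_trans (le_normcD _ _) _; have := step J; rewrite exprS mulrA hE mul1r; lra.
have [M M0 sM] := frk_bound s.
have M1 : 0 < 1 + M by lra.
have [J Je] := geometric_small (divr_gt0 e0 M1).
have eM : h ^+ J * (1 + M) <= e by rewrite -ler_pdivlMr.
have -> : k x - k (frk s x) = (k - c J) (x - frk s x) + (c J x - c J (frk s x)).
  by rewrite (linB _ _ (dual_lin _)) !dualB; ring.
apply: le_trans (le_normcD _ _) _.
have := dual_ball_bound (x - frk s x) (cP J).2.
have xs : rnorm (x - frk s x) <= 1 + M.
  apply: le_trans (rnormD _ _) _; rewrite rnormN lerD //; apply: le_trans (sM x) _.
  by rewrite ler_piMr.
have h3 : h ^+ J ^+ 3 <= h ^+ J.
  have hJ1 : h ^+ J <= 1 by rewrite exprn_ile1 // ltW.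
  by rewrite exprS ler_piMr ?(ltW (hj J)) // exprn_ile1 ?(ltW (hj J)).
have : h ^+ J ^+ 3 / 2 * rnorm (x - frk s x) <= h ^+ J / 2 * (1 + M).
  by apply: ler_pM => //; rewrite ?rnorm_ge0 ?(ltW (d0 J)) // ler_wpM2r.
have := sum J; have := mulr_gt0 (hj J) e0; lra.
Qed.

(** After a dilation, K lies in the ball of radius 1/2, where 0 serves as a first net. *)
Lemma totally_bounded_approx K e : totally_bounded_dual K -> 0 < e ->
  exists s : seq (dual E * E), forall k x, K k -> rnorm x <= 1 ->
    normc (k x - k (frk s x)) <= e.
Proof.
move=> tK e0; have [s sP] := tK 1 ltr01.
have /choice[b bP] (c : dual E) : exists b : R, 0 <= b /\ dual_le c b.
  have [b b0 cb] := dual_bound c; exists b; split=> // x x1.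
  by apply: le_trans (cb x) _; rewrite ler_piMr.
pose M := 1 + \sum_(c <- s) b c.
have S0 (q : seq (dual E)) : 0 <= \sum_(c <- q) b c by apply: sumr_ge0 => c _; exact: (bP c).1.
have M0 : 0 < M by rewrite /M; have := S0 s; lra.
have KM k : K k -> dual_le k M.
  move=> /sP[c cs kc] x x1; rewrite -[k](subrK c); apply: le_trans (le_normcD _ _) _.
  rewrite /M lerD ?kc //; apply: le_trans ((bP c).2 x x1) _.
  by rewrite (big_rem c) //= lerDl.
pose t := (2 * M)^-1; have t0 : 0 < t by rewrite invr_gt0 mulr_gt0.
have [|||s' s'P] := @half_approx [set t%:C *: k | k in K] (t * e).
- move=> d d0; have [q qP] := tK (d / t) (divr_gt0 d0 t0).
  exists [seq t%:C *: c | c <- q] => _ [k Kk <-].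
  have [c cq kc] := qP k Kk; exists (t%:C *: c); first exact: map_f.
  by rewrite -scalerBr (_ : d = t * (d / t)); [exact: dual_leZ (ltW t0) kc|rewrite mulrC divfK // gt_eqF].
- move=> _ [k Kk <-]; rewrite (_ : 2^-1 = t * M); first exact: dual_leZ (ltW t0) (KM k Kk).
  by rewrite /t; field; rewrite gt_eqF.
- exact: mulr_gt0.
exists s' => k x Kk x1; have := s'P _ x (ex_intro2 _ _ k Kk erefl) x1.
by rewrite !dualZ -mulrBr normcM ger0_normcR ?(ltW t0) // ler_pM2l.
Qed.

End totally_bounded.

(** * Reflexivity and convexity when characters are evaluations *)

Section ultrafilter_points.
Context {R : realType} {E : normedModType R[i]}.
Variable U : set E.
Hypotheses (oU : open U) (bU : balanced_set U)
  (MD : forall phi, Mb U phi -> delta U phi).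
Implicit Types (A : set E) (x y h : E) (f g : E -> R[i]).
Local Notation "x %:C" := (real_complex _ x).

(** The limit along an ultrafilter of the values at points of a U-bounded set
is a character. *)
Lemma ultra_point (T : Type) (G : set_system T) (b : T -> E) A : UltraFilter G ->
  ubd U A -> G [set t | A (b t)] -> exists y, U y /\
    forall g, Hbt U g -> ucvg G (fun t => g (b t)) (g y).
Proof.
move=> UG uA GA; have PG : ProperFilter G by exact: ultra_proper.
have AU : A `<=` U by case: uA.
have /choice[phi phiP] (f : Hb U) : exists l : R[i]^o, ucvg G (fun t => ext f (b t)) l.
  have [_ fb] := ext_Hbt f; have [M fM] := fb _ uA.
  by apply: (@ucvg_ex _ _ G _ M UG); apply: filterS GA => t /= /fM.
have [|y _ yE] := MD (phi := phi).
  split.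
  - move=> c f g; apply: (ucvg_uniq PG (phiP (c *: f + g))).
    apply: ucvg_eq (ucvgD _ (ucvgZ c _ (phiP f)) (phiP g)).
    by apply: filterS GA => t /= /AU Ut; rewrite !ext_inU.
  - move=> f g; apply: (ucvg_uniq PG (phiP (Hb_mul f g))).
    apply: ucvg_eq (ucvgM _ (phiP f) (phiP g)).
    by apply: filterS GA => t /= /AU Ut; rewrite !ext_inU.
  - apply: (@dominated_continuous _ _ _ A 1) => //.
      move=> c f g; apply: (ucvg_uniq PG (phiP (c *: f + g))).
      apply: ucvg_eq (ucvgD _ (ucvgZ c _ (phiP f)) (phiP g)).
      by apply: filterS GA => t /= /AU Ut; rewrite !ext_inU.
    move=> f c c0 fc; rewrite mul1r; apply: (ucvg_le PG (phiP f)).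
    by apply: filterS GA => t /= At; rewrite (ext_inU f (AU _ At)); exact: fc.
  - exists (restr oU (entire_Hbt U (@entire_bt_cst R E 1))).
    rewrite (_ : phi _ = 1) ?oner_neq0 //; apply: (ucvg_uniq PG (phiP _)).
    apply: ucvg_eq (ucvg_cst 1 _); apply: filterS GA => t /= /AU Ut.
    by rewrite ext_inU.
exists (val y); split=> [|g gU]; first exact: valU.
have := phiP (restr oU gU); rewrite -yE restrE.
apply: ucvg_eq; apply: filterS GA => t /= /AU Ut.
by rewrite ext_inU.
Qed.

(** Bounded families have weak limits, and entire functions of bounded type
follow them: dilations bring any bounded set into U. *)
Lemma ultra_weak_limit (T : Type) (G : set_system T) (b : T -> E) (r : R) : UltraFilter G ->
  G [set t | rnorm (b t) <= r] -> exists x,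
    forall f, entire_bt f -> ucvg G (fun t => f (b t)) (f x).
Proof.
move=> UG Gr; have [s s0 sU] := open_rnorm oU (balanced0 bU).
pose A := [set x : E | rnorm x <= s / 2].
have uA : ubd U A.
  split.
  - by move=> x; rewrite /A /= => xs; apply: sU; rewrite subr0; lra.
  - by exists (s / 2).
  - exists (s / 2) => [|x y]; first lra.
    rewrite /A /= => xs Uy.
    have ys : s <= rnorm y by rewrite leNgt; apply/negP => ys; apply: Uy; apply: sU; rewrite subr0.
    by have := rnormB_ge y x; rewrite rnorm_sub; lra.
pose c := s / (2 * (`|r| + 1)); have c0 : 0 < c by rewrite divr_gt0 // mulr_gt0 // ltr_wpDl.
have cC : c%:C != 0 :> R[i] by rewrite -normc_gt0 ger0_normcR // ltW.
have [|y [_ yP]] := @ultra_point T G (fun t => c%:C *: b t) A UG uA.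
  apply: filterS Gr => t /= tr; rewrite /A /= rnormZR ?(ltW c0) //.
  have -> : s / 2 = c * (`|r| + 1) by rewrite /c; field; rewrite gt_eqF // ltr_wpDl.
  by rewrite ler_pM2l //; have := ler_norm r; lra.
exists (c%:C^-1 *: y) => f ef.
have := yP _ (entire_Hbt U (entire_bt_scale c%:C^-1 ef)).
by congr ucvg; apply/funext => t; rewrite scalerA mulVf // scale1r.
Qed.

(** Functionals separate points, so the limit point is the given one. *)
Lemma weak_limit_entire (T : Type) (G : set_system T) (b : T -> E) (r : R) x :
  UltraFilter G -> G [set t | rnorm (b t) <= r] ->
  (forall h : dual E, ucvg G (fun t => h (b t)) (h x)) ->
  forall f, entire_bt f -> ucvg G (fun t => f (b t)) (f x).
Proof.
move=> UG Gr hx; have PG : ProperFilter G by exact: ultra_proper.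
have [y yP] := ultra_weak_limit UG Gr.
suff -> : x = y by [].
apply: dual_separates => h; apply: (ucvg_uniq PG (hx h)).
exact: yP (dual_entire h).
Qed.

Lemma dual_sum (I : Type) (s : seq I) (F : I -> dual E) x :
  (\sum_(i <- s) F i : dual E) x = \sum_(i <- s) F i x.
Proof. by elim: s => [|i s IH]; rewrite ?big_nil // !big_cons dualD IH. Qed.

Lemma normc_line_sq (d a : R[i]) (t : R) :
  normc (d - t%:C * a) ^+ 2 = normc d ^+ 2 - 2 * t * complex.Re ((d^*)%C * a) + t ^+ 2 * normc a ^+ 2.
Proof. by rewrite !normc_sq; case: d => x y; case: a => u v /=; ring. Qed.

Section goldstine.
Variables (Phi : dual E -> R[i]^o) (C : R).
Hypotheses (lPhi : linear Phi) (C0 : 0 < C) (dPhi : dual_dominated Phi C).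

(** Goldstine's theorem: a point of the ball that almost minimises the distance
to the values of Phi on finitely many functionals almost attains them, by the
variational inequality at that point. *)
Lemma goldstine (F : seq (dual E)) (e : R) : 0 < e -> exists2 x : E, rnorm x <= C &
  forall f : dual E, f \in F -> normc (f x - Phi f) < e.
Proof.
move=> e0; pose Q x : R := \sum_(f <- F) normc (Phi f - f x) ^+ 2.
have Q0 x : 0 <= Q x by apply: sumr_ge0 => f _; exact: sqr_ge0.
suff [x xC Qe] : exists2 x, rnorm x <= C & Q x < e ^+ 2.
  exists x => // f fF; rewrite normc_sub.
  rewrite -(ltr_pXn2r (ltn0Sn 1)) ?nnegrE ?normc_ge0 ?(ltW e0) //.
  apply: le_lt_trans Qe; rewrite /Q (big_rem f) //= lerDl.
  by apply: sumr_ge0 => g _; exact: sqr_ge0.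
apply: contrapT => nox; pose S := [set Q x | x in [set x | rnorm x <= C]].
have Sne : S !=set0 by exists (Q 0), 0 => //=; rewrite rnorm0 ltW.
have Slb : lbound S (e ^+ 2).
  by move=> _ [x xC <-]; rewrite leNgt; apply/negP => Qe; apply: nox; exists x.
have hS : has_inf S by split=> //; exists (e ^+ 2).
set m := inf S in hS *.
have m0 : 0 < m by apply: lt_le_trans (lb_le_inf Sne Slb); rewrite exprn_gt0.
have /choice[K KP] (f : dual E) : exists K : R, 0 <= K /\ forall x, normc (f x) <= K * rnorm x.
  by have [K K0 fK] := dual_bound f; exists K.
pose B : R := \sum_(f <- F) (K f * (2 * C)) ^+ 2.
have B0 : 0 <= B by apply: sumr_ge0 => f _; exact: sqr_ge0.
have B1 : 0 < 1 + B by lra.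
pose t := Num.min 1 (m / (1 + B)).
have t0 : 0 < t by rewrite lt_min ltr01 divr_gt0.
have t1 : t <= 1 by rewrite ge_min lexx.
have tB : t * (1 + B) <= m by rewrite -ler_pdivlMr // ge_min lexx orbT.
have [_ [x /= xC <-] Qx] := inf_adherent (exprn_gt0 2 t0) hS; rewrite -/m in Qx.
pose d (f : dual E) : R[i] := Phi f - f x.
pose g : dual E := \sum_(f <- F) (d f)^*%C *: f.
have gE u : g u = \sum_(f <- F) (d f)^*%C * f u by rewrite dual_sum.
(* The squared distance Q at x + t (u - x) is at least m, hence nearly Q x; its first order
   term in t bounds Re (g u) by Re (g x) for every u of the ball. *)
have var u : rnorm u <= C -> complex.Re (g u) <= complex.Re (g x) + t * (1 + B) / 2.
  move=> uC; pose xt := x + t%:C *: (u - x).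
  have ux : rnorm (u - x) <= 2 * C by have := rnormD u (- x); rewrite rnormN; lra.
  have xtC : rnorm xt <= C.
    have -> : xt = (1 - t)%:C *: x + t%:C *: u.
      by rewrite /xt scalerBr rmorphB scalerBl scale1r addrA addrAC.
    apply: le_trans (rnormD _ _) _; rewrite !rnormZR ?(ltW t0) ?subr_ge0 //.
    have : (1 - t) * rnorm x <= (1 - t) * C by rewrite ler_wpM2l // subr_ge0.
    have : t * rnorm u <= t * C by rewrite ler_pM2l.
    lra.
  have mQ : m <= Q xt by apply: ge_inf; [exists (e ^+ 2)|exists xt].
  have QE : Q xt = Q x - 2 * t * complex.Re (g (u - x)) +
      t ^+ 2 * \sum_(f <- F) normc (f (u - x)) ^+ 2.
    rewrite gE raddf_sum /Q !mulr_sumr -sumrB -big_split /=; apply: eq_bigr => f _.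
    rewrite -/(d f) -normc_line_sq; congr (normc _ ^+ 2).
    by rewrite /xt [x + _]addrC (dual_lin f) /d opprD addrA addrAC.
  have QB : \sum_(f <- F) normc (f (u - x)) ^+ 2 <= B.
    apply: ler_sum => f _; rewrite lerXn2r ?nnegrE ?normc_ge0 //.
      by rewrite mulr_ge0 ?(KP f).1 // mulr_ge0 // ltW.
    by apply: le_trans ((KP f).2 _) _; rewrite ler_wpM2l ?(KP f).1.
  have tQB := ler_wpM2l (sqr_ge0 t) QB.
  rewrite QE (linB _ _ (dual_lin g)) raddfB /= in mQ.
  have key : t * (2 * (complex.Re (g u) - complex.Re (g x))) <= t * (t * (1 + B)) by lra.
  by move: key; rewrite ler_pM2l //; lra.
pose s := complex.Re (g x) + t * (1 + B) / 2.
have gs u : rnorm u <= C -> normc (g u) <= s.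
  move=> uC; have [c c1 cE] := unimodular_rotation (g u).
  have := var (c *: u); rewrite rnormZ c1 mul1r => /(_ uC).
  by rewrite (linZ _ _ (dual_lin g)) cE.
have s0 : 0 <= s by apply: le_trans (gs 0 _); rewrite ?normc_ge0 // rnorm0 ltW.
have := dPhi (f := g) (divr_ge0 s0 (ltW C0)) _.
rewrite mulrCA divff ?gt_eqF // mulr1 => Phig.
have {}Phig : normc (Phi g) <= s.
  apply: Phig => u u1; rewrite ler_pdivlMr // mulrC.
  have := gs (C%:C *: u); rewrite rnormZR ?(ltW C0) // => /(_ _).
  rewrite (linZ _ _ (dual_lin g)) normcM ger0_normcR ?(ltW C0) //; apply.
  by rewrite ler_piMr // ltW.
have PhiD u v : Phi (u + v) = Phi u + Phi v by have := lPhi 1 u v; rewrite !scale1r.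
have Phi0 : Phi 0 = 0 by have := lPhi (-1) 0 0; rewrite scaler0 addr0 scaleN1r addNr.
have PhiE : Phi g = \sum_(f <- F) (d f)^*%C * Phi f.
  rewrite /g (big_morph Phi PhiD Phi0); apply: eq_bigr => f _.
  by have := lPhi (d f)^*%C f 0; rewrite Phi0 !addr0.
have QE : Q x = complex.Re (Phi g) - complex.Re (g x).
  rewrite -raddfB PhiE gE -sumrB raddf_sum; apply: eq_bigr => f _ /=.
  by rewrite -mulrBr -/(d f) mulrC conj_mul_normc.
have := le_trans (ler_norm _) (normc_geRe (Phi g)).
have mQ : m <= Q x by apply: ge_inf; [exists (e ^+ 2)|exists x].
rewrite /s in Phig; lra.
Qed.

End goldstine.

(** By Goldstine's theorem, the values of Phi are limits of evaluations along an
ultrafilter of points of a ball, and such an ultrafilter has a weak limit. *)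
Lemma characters_reflexive : @reflexive_space R E.
Proof.
move=> Phi cPhi; have lPhi : linear Phi by move=> a u v; rewrite linearP.
have [C0 dPhi0] := dual_continuous_dominated lPhi cPhi.
pose C := `|C0| + 1; have C1 : 0 < C by rewrite ltr_wpDl.
have dPhi : dual_dominated Phi C.
  move=> f c c0 fc; apply: le_trans (dPhi0 f c c0 fc) _; rewrite ler_wpM2r //.
  by have := ler_norm C0; rewrite /C; lra.
pose W (p : seq (dual E) * R) := [set x : E | rnorm x <= C /\
  forall f : dual E, f \in p.1 -> normc (f x - Phi f) < p.2].
have PF : ProperFilter (filter_from [set p | 0 < p.2] W).
  apply: filter_from_proper; last first.
    by move=> [F e] /= e0; have [x xC xF] := goldstine lPhi C1 dPhi F e0; exists x.
  apply: filter_from_filter; first by exists ([::], 1) => /=.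
  move=> [F e] [F' e'] /= e0 e'0; exists (F ++ F', Num.min e e').
    by rewrite /= lt_min e0.
  move=> x [xC xF]; split; split=> // f /= fF.
    by have := xF f; rewrite /= mem_cat fF => /(_ isT); rewrite lt_min => /andP[].
  by have := xF f; rewrite /= mem_cat fF orbT => /(_ isT); rewrite lt_min => /andP[].
have [G [UG FG]] := ultraFilterLemma PF; have PG : ProperFilter G by exact: ultra_proper.
have [|x xP] := @ultra_weak_limit E G id C UG.
  by apply: FG; exists ([::], 1) => //= x [].
exists x => f; apply: (ucvg_uniq PG (f := f)); last exact: xP (dual_entire f).
move=> e e0; apply: FG; exists ([:: f], e) => // y [_ yf]; apply: yf.
by rewrite /= mem_head.
Qed.

(** Evaluation at x + z, for x in the hull of A and z small, is a character
dominated by the supremum over A + z; hence x + z lies in U. *)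
Lemma characters_hull_shift A x z (d : R) : ubd U A -> U x -> rnorm z < d ->
  (forall a y, A a -> ~ U y -> d <= rnorm (a - y)) ->
  (forall P c, entire_bt P -> 0 <= c -> (forall a, A a -> normc (P a) <= c) -> normc (P x) <= c) ->
  U (x + z).
Proof.
move=> [AU [M AM] _] Ux zd dA xA.
pose B := [set y | A (y - z)].
have uB : ubd U B.
  split.
  - move=> y By; apply: contrapT => Uy; have := dA _ _ By Uy.
    by rewrite addrAC subrr add0r rnormN; lra.
  - exists (M + rnorm z) => y /AM yM; have := rnormD (y - z) z; rewrite subrK; lra.
  - exists (d - rnorm z) => [|y w By Uw]; first lra.
    have := dA _ _ By Uw; have := rnormD (y - w) (- z); rewrite addrAC rnormN; lra.
have xB P c : entire_bt P -> 0 <= c -> (forall y, B y -> normc (P y) <= c) -> normc (P (x + z)) <= c.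
  move=> eP c0 Pc; apply: (xA (fun y => P (y + z))) => //; first exact: entire_bt_shift.
  by move=> a Aa; apply: Pc; rewrite /B /= addrK.
have BU : B `<=` U by case: uB.
pose u (n : nat) : R := n.+1%:R^-1.
(* A function f is replaced by approximations on B by entire functions, which can
   be evaluated at x + z; the character is the limit of these values. *)
have /choice[P PP] (fn : Hb U * nat) : exists P : E -> R[i], entire_bt P /\
    forall y, B y -> normc (ext fn.1 y - P y) <= u fn.2.
  have n0 : 0 < u fn.2 :> R by rewrite /u invr_gt0.
  by have [Q [eQ _ QB]] := polynomial_dense oU bU (ext_Hbt fn.1) uB n0; exists Q.
have [G [UG Goo]] := ultraFilterLemma (@eventually_filter).
have PG : ProperFilter G by exact: ultra_proper.
have harm (K e : R) : 0 < e -> G [set n : nat | K * u n < e].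
  move=> e0; apply: Goo; exists (Num.bound (`|K| / e)) => // n /= nK.
  rewrite /u ltr_pdivrMr // (le_lt_trans (ler_norm K)) // mulrC -ltr_pdivrMr //.
  apply: lt_le_trans (archi_boundP _) _; first by rewrite divr_ge0 // ltW.
  by rewrite ler_nat ltnW.
have n1 n : u n <= 1 :> R by rewrite /u invf_le1 // ler1n.
have n0 n : 0 <= u n :> R by rewrite /u invr_ge0.
have bdP (f : Hb U) N : 0 <= N -> (forall y, B y -> normc (ext f y) <= N) ->
    forall n y, B y -> normc (P (f, n) y) <= N + u n.
  move=> N0 fN n y By; have := (PP (f, n)).2 y By => /= h.
  by have := ler_normc_sub (P (f, n) y) (ext f y); have := fN y By; rewrite [normc (P _ _ - _)]normc_sub; lra.
have bnd (f : Hb U) : exists2 N : R, 0 <= N & forall y, B y -> normc (ext f y) <= N.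
  have [_ fb] := ext_Hbt f; have [N fN] := fb _ uB; exists `|N| => // y /fN h.
  by apply: le_trans h (ler_norm _).
have /choice[phi phiP] (f : Hb U) : exists l : R[i]^o, ucvg G (fun n => P (f, n) (x + z)) l.
  have [N N0 fN] := bnd f; apply: (@ucvg_ex _ _ G _ (N + 1) UG).
  apply: filterS filterT => n _ /=; apply: (@le_trans _ _ (N + u n)); last by rewrite lerD2l.
  by apply: xB; [exact: (PP (f, n)).1|exact: addr_ge0|exact: bdP].
(* All approximations of order 1 / (n + 1) give the same limit. *)
have phiE (f : Hb U) (Q : nat -> E -> R[i]) K l : (forall n, entire_bt (Q n)) -> 0 <= K ->
    (forall n y, B y -> normc (ext f y - Q n y) <= K * u n) ->
    ucvg G (fun n => Q n (x + z)) l -> phi f = l.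
  move=> eQ K0 fQ Ql; apply: (ucvg_uniq PG (phiP f)) => e e0.
  have e2 : 0 < e / 2 by lra.
  apply: filterS2 (Ql _ e2) (harm (1 + K) _ e2) => n /= h1 h2.
  have : normc (P (f, n) (x + z) + (-1) * Q n (x + z)) <= (1 + K) * u n.
    apply: (xB (fun y => P (f, n) y + (-1) * Q n y)).
    - by apply: entire_btD; [exact: (PP (f, n)).1|exact: entire_btZ].
    - by rewrite mulr_ge0 // addr_ge0.
    move=> y By; have := (PP (f, n)).2 y By; have := fQ n y By => /= h3 h4.
    have -> : P (f, n) y + -1 * Q n y = (ext f y - Q n y) - (ext f y - P (f, n) y) by ring.
    by apply: le_trans (le_normcD _ _) _; rewrite normcN; lra.
  rewrite mulN1r => h3.
  have := le_normcD (P (f, n) (x + z) - Q n (x + z)) (Q n (x + z) - l).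
  rewrite addrA subrK; lra.
have phi_lin c (f g : Hb U) : phi (c *: f + g) = c * phi f + phi g.
  apply: (@phiE _ (fun n y => c * P (f, n) y + P (g, n) y) (normc c + 1)).
  - by move=> n; apply: entire_btD; [apply: entire_btZ|]; exact: (PP (_, n)).1.
  - by rewrite addr_ge0 ?normc_ge0.
  - move=> n y By; have := (PP (f, n)).2 y By; have := (PP (g, n)).2 y By => /= h1 h2.
    rewrite !(ext_inU _ (BU _ By)) in h1 h2 *.
    rewrite (_ : _ - _ = c * (f (inU (BU _ By)) - P (f, n) y) + (g (inU (BU _ By)) - P (g, n) y)); last first.
      by rewrite HbD HbZ; ring.
    apply: le_trans (le_normcD _ _) _; rewrite normcM mulrDl mul1r lerD //.
    by rewrite ler_wpM2l ?normc_ge0.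
  - by apply: ucvgD; [apply: ucvgZ|]; exact: phiP.
have phi_mul (f g : Hb U) : phi (Hb_mul f g) = phi f * phi g.
  have [N N0 fN] := bnd f; have [N' N'0 gN] := bnd g.
  apply: (@phiE _ (fun n y => P (f, n) y * P (g, n) y) (N + N' + 1)).
  - by move=> n; apply: entire_btM; exact: (PP (_, n)).1.
  - by rewrite !addr_ge0.
  - move=> n y By; have := (PP (f, n)).2 y By; have := (PP (g, n)).2 y By => /= h1 h2.
    have h3 := bdP g N' N'0 gN n y By; have h4 := fN y By.
    have -> : ext (Hb_mul f g) y = ext f y * ext g y by rewrite !(ext_inU _ (BU _ By)).
    rewrite (_ : _ - _ = ext f y * (ext g y - P (g, n) y) + (ext f y - P (f, n) y) * P (g, n) y); last by ring.
    apply: le_trans (le_normcD _ _) _; rewrite !normcM.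
    have a1 : normc (ext f y) * normc (ext g y - P (g, n) y) <= N * u n.
      by apply: ler_pM; rewrite ?normc_ge0.
    have a2 : normc (ext f y - P (f, n) y) * normc (P (g, n) y) <= u n * (N' + 1).
      by apply: ler_pM; rewrite ?normc_ge0 //; apply: le_trans h3 _; rewrite lerD2l.
    lra.
  - by apply: ucvgM; exact: phiP.
have phi_entire g (H : Hbt U g) : entire_bt g -> phi (restr oU H) = g (x + z).
  move=> eg; apply: (@phiE _ (fun=> g) 0) => //.
  - by move=> n y By; rewrite (ext_inU _ (BU _ By)) restrE subrr normc0 mul0r.
  - exact: ucvg_cst.
have [|y _ yE] := MD (phi := phi).
  split=> //.
  - apply: (@dominated_continuous _ _ _ B 1) => // f c c0 fc; rewrite mul1r.
    apply/ler_addgt0Pr => e e0; apply: (ucvg_le PG (phiP f)).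
    apply: filterS (harm 1 e e0) => n /=; rewrite mul1r => ne.
    apply: (@le_trans _ _ (c + u n)); last by rewrite lerD2l ltW.
    apply: xB; [exact: (PP (f, n)).1|exact: addr_ge0|].
    by apply: bdP => // w Bw; rewrite (ext_inU _ (BU _ Bw)); exact: fc.
  - exists (restr oU (entire_Hbt U (@entire_bt_cst R E 1))).
    by rewrite phi_entire ?oner_neq0 //; exact: entire_bt_cst.
suff <- : val y = x + z by exact: valU.
apply: dual_separates => h; have eh := dual_entire h.
by rewrite -(phi_entire _ (entire_Hbt U eh) eh) -yE.
Qed.

Lemma characters_hull_convex : Hb_convex U.
Proof.
move=> A /U_boundedP uA; case: (uA) => AU [M AM] [d d0 dA].
set A' := [set val u | u in A] in uA AU AM dA.
have hullP (x : U) (P : E -> R[i]) (c : R) : Hb_hull A x -> entire_bt P -> 0 <= c ->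
    (forall a, A' a -> normc (P a) <= c) -> normc (P (val x)) <= c.
  move=> hx eP c0 Pc; have := hx (restr oU (entire_Hbt U eP)) => /le_trans; apply.
  have [[a Aa]|nA] := pselect (exists a, A a).
    apply: ge_sup; first by exists (normc (restr oU (entire_Hbt U eP) a)), a.
    by move=> _ [b Ab <-]; apply: Pc; exists b.
  rewrite [X in sup X](_ : _ = set0) ?sup0 //.
  by apply/seteqP; split=> [w [u Au _]|//]; case: nA; exists u.
apply/U_boundedP; split.
- by move=> _ [u _ <-]; exact: valU.
- exists `|M| => _ [x hx <-]; have [g [gle gx]] := norming (val x).
  have := hullP x g `|M| hx (dual_entire g) (normr_ge0 _).
  rewrite gx ger0_normcR ?rnorm_ge0 //; apply => a Aa.
  by apply: le_trans (gle a) _; apply: le_trans (AM _ Aa) (ler_norm _).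
- exists d => // _ y [x hx <-] Uy; rewrite leNgt; apply/negP => xy; apply: Uy.
  rewrite -(subrK (val x) y) addrC; apply: (characters_hull_shift uA (valU x) _ dA).
    by rewrite rnorm_sub.
  by move=> P c; exact: hullP.
Qed.

End ultrafilter_points.

(** * Derivatives of homogeneous polynomials, approximability *)

Section homogeneous.
Context {R : realType} {E : normedModType R[i]}.
Implicit Types (x y h : E) (P Q : E -> R[i]).
Local Notation "x %:C" := (real_complex _ x).

Lemma entire_bt_D h P : entire_bt P -> entire_bt (D h P).
Proof.
move=> [Pd Pb]; split; first by apply: D_holo => //; exact: openT.
move=> r; have [M PM] := Pb (r + 1); exists (2 * M / 1 * rnorm h) => x xr.
apply: (@cauchy_D _ _ P x 1 M ltr01) => y yx; first exact: Pd.
by apply: PM; have := rnormD (y - x) x; rewrite subrK; lra.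
Qed.

Lemma entire_D_lin P x : entire_bt P -> lin (fun h => D h P x).
Proof. by move=> [Pd _]; have [] := DP (Pd x I). Qed.

(** For c = 0 the identity follows by continuity from the case of nonzero c. *)
Lemma homog_D n h P : entire_bt P -> homog n.+1 P -> homog n (D h P).
Proof.
move=> eP hP; have [Pd _] := eP.
have nz c x : c != 0 -> D h P (c *: x) = c ^+ n * D h P x.
  move=> c0; apply: (mulfI c0); rewrite mulrA -exprS.
  have := fder_uniq (fder_scale (DP (Pd (c *: x) I))) _.
  have -> : (fun y => P (c *: y)) = fun y => c ^+ n.+1 * P y by apply/funext => y; exact: hP.
  move=> /(_ _ (fderZ (c ^+ n.+1) (DP (Pd x I)))) /(congr1 (fun L => L h)) <-.
  by rewrite (linZ _ _ (entire_D_lin _ eP)).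
move=> c x; have [->|] := eqVneq c 0; last exact: nz.
have [Dd _] := entire_bt_D h eP; have [L fL] := Dd (0 : E) I.
rewrite scale0r; apply/eqP; rewrite -subr_eq0; apply: contrapT => ne.
pose psi (c : R[i]) : R[i] := D h P (0 + c *: x) - c ^+ n * D h P x.
have cpsi : ccont psi 0.
  apply: ccontB.
    have fL' : fder (D h P) (0 + 0 *: x) L by rewrite scale0r addr0.
    by apply: cdiff_cont; exists (L x); exact: fder_line fL'.
  by apply: ccontM; [apply: ccontX; exact: ccont_id|exact: ccont_cst].
have psi0 : 0 < normc (psi 0).
  by rewrite normc_gt0 /psi scale0r addr0; exact/negP.
have [d d0 dP] := cpsi _ psi0.
have d2 : 0 < d / 2 by lra.
have psid : psi (d / 2)%:C = 0.
  by rewrite /psi add0r nz ?subrr // -normc_gt0 ger0_normcR // ltW.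
have := dP (d / 2)%:C; rewrite subr0 ger0_normcR ?(ltW d2) // => /(_ (ltac:(lra))).
by rewrite psid sub0r normcN ltxx.
Qed.

(** Both sides are the derivative at 0 of z |-> P (x + z x) = (1 + z)^n P (x). *)
Lemma homog_euler n P x : entire_bt P -> homog n P -> D x P x = n%:R * P x.
Proof.
move=> [Pd _] hP; have fL : fder P (x + 0 *: x) (fun h => D h P x).
  by rewrite scale0r addr0; exact: DP (Pd x I).
apply: (cderiv_uniq (fder_line fL)).
have powd m : cderiv (fun z => (1 + z) ^+ m : R[i]) 0 m%:R.
  elim: m => [|m IH]; first exact: cderiv_cst.
  have := cderivM (cderivD (cderiv_cst 1 0) (cderiv_id 0)) IH.
  by rewrite addr0 expr1n add0r !mul1r -nat1r; congr cderiv; apply/funext => z; rewrite exprS.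
have := cderivM (powd n) (cderiv_cst (P x) 0).
rewrite mulr0 addr0; congr cderiv; apply/funext => z.
by rewrite -hP scalerDl scale1r.
Qed.

Lemma entire_D_bound P x : entire_bt P ->
  exists K : R, forall h, normc (D h P x) <= K * rnorm h.
Proof. by move=> [Pd _]; have [_ + _] := DP (Pd x I). Qed.

Lemma approximableP (P : E -> R[i]^o) : approximable P <->
  forall e : R, 0 < e -> exists2 Q : E -> R[i]^o, finite_type_polynomial Q &
    forall x, rnorm x <= 1 -> normc (P x - Q x) <= e.
Proof.
split=> [aP e e0|aP e e0].
  have [|Q ftQ QP] := aP e%:C; first by rewrite ltcR.
  exists Q => // x x1; have := QP x; rewrite rnormE -[1]/(1%:C) lecR => /(_ x1).
  by rewrite normcE' lecR.
have eE : e = (complex.Re e)%:C by rewrite RRe_real // gtr0_real.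
have [|Q ftQ QP] := aP (complex.Re e); first by rewrite -ltcR -eE.
exists Q => // x; rewrite rnormE -[1]/(1%:C) lecR => x1.
by rewrite eE normcE' lecR; exact: QP.
Qed.

Lemma approximable_cst (c : R[i]) : approximable (fun _ : E => c : R[i]^o).
Proof.
apply/approximableP => e e0; exists (cst c); first exact: finite_type_cst.
by move=> x _; rewrite subrr normc0 ltW.
Qed.

Lemma approximable_add (P Q : E -> R[i]^o) : approximable P -> approximable Q ->
  approximable (fun x => P x + Q x).
Proof.
move=> /approximableP aP /approximableP aQ; apply/approximableP => e e0.
have e2 : 0 < e / 2 by lra.
have [P' ftP P'P] := aP _ e2; have [Q' ftQ Q'Q] := aQ _ e2.
exists (P' + Q'); first exact: finite_type_add.
move=> x x1; rewrite (_ : _ - _ = (P x - P' x) + (Q x - Q' x)); last first.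
  by rewrite -[(P' + Q') x]/(P' x + Q' x) opprD addrACA.
by apply: le_trans (le_normcD _ _) _; have := P'P x x1; have := Q'Q x x1; lra.
Qed.

Lemma approximable_dualM (f : dual E) (P : E -> R[i]^o) : approximable P ->
  approximable (fun x => f x * P x : R[i]^o).
Proof.
move=> /approximableP aP; apply/approximableP => e e0; have [K K0 fK] := dual_bound f.
have K1 : 0 < K + 1 by lra.
have [Q ftQ QP] := aP _ (divr_gt0 e0 K1).
exists ((f : E -> R[i]^o) * Q); first by apply: finite_type_mul => //; exact: finite_type_dual.
move=> x x1; rewrite -[((f : E -> R[i]^o) * Q) x]/(f x * Q x) -mulrBr normcM.
apply: (@le_trans _ _ ((K + 1) * (e / (K + 1)))); last by rewrite mulrC divfK // gt_eqF.
apply: ler_pM; rewrite ?normc_ge0 //; last exact: QP.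
by apply: le_trans (fK x) _; have := rnorm_ge0 x; nra.
Qed.

Lemma approximable_scale (c : R[i]) (P : E -> R[i]^o) : approximable P ->
  approximable (fun x => c * P x : R[i]^o).
Proof.
move=> /approximableP aP; apply/approximableP => e e0.
have c1 : 0 < normc c + 1 by rewrite ltr_wpDl ?normc_ge0.
have [Q ftQ QP] := aP _ (divr_gt0 e0 c1).
exists (cst c * Q); first by apply: finite_type_mul => //; exact: finite_type_cst.
move=> x x1; rewrite -[(cst c * Q) x]/(c * Q x) -mulrBr normcM.
apply: (@le_trans _ _ ((normc c + 1) * (e / (normc c + 1)))); last by rewrite mulrC divfK // gt_eqF.
by apply: ler_pM; rewrite ?normc_ge0 ?QP // lerDl.
Qed.

Lemma approximable_sum (I : Type) (s : seq I) (F : I -> E -> R[i]^o) :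
  (forall i, approximable (F i)) -> approximable (fun x => \sum_(i <- s) F i x : R[i]^o).
Proof.
move=> aF; elim: s => [|i s IH].
  rewrite (_ : (fun x => _) = fun=> 0); first exact: approximable_cst.
  by apply/funext => x; rewrite big_nil.
rewrite (_ : (fun x => _) = fun x => F i x + \sum_(j <- s) F j x).
  exact: approximable_add.
by apply/funext => x; rewrite big_cons.
Qed.

Lemma approximable_near (P : E -> R[i]^o) : (forall e : R, 0 < e ->
  exists2 Q : E -> R[i]^o, approximable Q & forall x, rnorm x <= 1 -> normc (P x - Q x) <= e) ->
  approximable P.
Proof.
move=> aP; apply/approximableP => e e0; have e2 : 0 < e / 2 by lra.
have [Q /approximableP/(_ _ e2)[Q' ftQ Q'Q] QP] := aP _ e2.
exists Q' => // x x1; have := le_normcD (P x - Q x) (Q x - Q' x).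
by rewrite addrA subrK; have := QP x x1; have := Q'Q x x1; lra.
Qed.

End homogeneous.

(** * Approximability when characters are evaluations *)

Section forward.
Context {R : realType} {E : normedModType R[i]}.
Variable U : set E.
Hypotheses (oU : open U) (bU : balanced_set U)
  (MD : forall phi, Mb U phi -> delta U phi).
Implicit Types (x y h : E) (P Q : E -> R[i]).
Local Notation "x %:C" := (real_complex _ x).

Definition diff_dual P (eP : entire_bt P) x : dual E :=
  mkdual (L := fun h => D h P x) (entire_D_lin x eP) (svalP (cid (entire_D_bound x eP))).

(** Otherwise some ultrafilter of points b of the ball keeps the differentials
at b away from the differential at the weak limit of b, on directions h b of
the ball; but the values P (b + t h b) follow weak limits, and Cauchy's
estimates recover the differentials from them uniformly. *)
Lemma differentials_totally_bounded P (eP : entire_bt P) :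
  totally_bounded_dual [set diff_dual eP b | b in [set b | rnorm b <= 1]].
Proof.
move=> e e0; apply: contrapT => nos.
pose W (s : seq (dual E)) := [set b : E | rnorm b <= 1 /\
  forall c, c \in s -> ~ dual_le (diff_dual eP b - c) e].
have PF : ProperFilter (filter_from [set: seq (dual E)] W).
  apply: filter_from_proper; last first.
    move=> s _; apply: contrapT => nob; apply: nos; exists s => _ [b b1 <-].
    apply: contrapT => noc; apply: nob; exists b; split=> // c cs bc.
    by apply: noc; exists c.
  apply: filter_from_filter; first by exists [::].
  move=> s s' _ _; exists (s ++ s') => // b [b1 bs]; split; split=> // c cs; apply: bs.
    by rewrite mem_cat cs.
  by rewrite mem_cat cs orbT.
have [G [UG FG]] := ultraFilterLemma PF; have PG : ProperFilter G by exact: ultra_proper.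
have fG : Filter G by exact: filter_filter.
have G1 : G [set b | rnorm b <= 1] by apply: FG; exists [::] => // b [].
have [x xP] := ultra_weak_limit oU bU MD (b := id) UG G1.
have /choice[k kP] (b : E) : exists h, rnorm h <= 1 /\
    (~ dual_le (diff_dual eP b - diff_dual eP x) e -> e < normc (D h P b - D h P x)).
  have [bd|/existsNP[h /not_implyP[h1 /negP]]] := pselect (dual_le (diff_dual eP b - diff_dual eP x) e).
    by exists 0; rewrite rnorm0; split.
  by rewrite -ltNge => bh; exists h.
have Gk : G [set b | rnorm (k b) <= 1] by apply: filterS filterT => b _; exact: (kP b).1.
have [h hP] := ultra_weak_limit oU bU MD (b := k) UG Gk.
have h1 : rnorm h <= 1.
  have [g [gle gh]] := norming h; have := hP _ (dual_entire g).
  rewrite gh => gk; rewrite -(ger0_normcR (rnorm_ge0 h)).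
  apply: (ucvg_le PG gk); apply: filterS Gk => b /= bk.
  exact: le_trans (gle _) bk.
have [Pd Pb] := eP; have [M PM] := Pb (rnorm x + 2).
have M0 : 0 <= M.
  by apply: (le_trans (normc_ge0 (P 0))); apply: PM; rewrite rnorm0 addr_ge0 ?rnorm_ge0.
(* Cauchy's estimate, uniform over directions v of the ball. *)
have quot y v (t : R) : rnorm y <= rnorm x + 1 -> rnorm v <= 1 -> 0 < t < 1 ->
    normc (t%:C^-1 * (P (y + t%:C *: v) - P y) - D v P y) <= 8 * M * t.
  move=> yx v1 /andP[t0 t1].
  have tC : t%:C != 0 :> R[i] by rewrite -normc_gt0 ger0_normcR // ltW.
  have vt : rnorm (t%:C *: v) <= t by rewrite rnormZR ?(ltW t0) // ler_piMr // ltW.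
  have := @cauchy_second _ _ P y 1 M ltr01 (fun w _ => Pd w I) _ (t%:C *: v).
  move=> /(_ _ (le_lt_trans vt t1)); rewrite (linZ _ _ (entire_D_lin y eP)) => est.
  rewrite (_ : _ - _ = t%:C^-1 * (P (y + t%:C *: v) - P y - t%:C * D v P y)); last first.
    by rewrite [RHS]mulrBr mulKf.
  rewrite normcM normcV ger0_normcR ?(ltW t0) // ler_pdivrMl //.
  apply: le_trans (est _) _.
    by move=> w wy; apply: PM; have := rnormD (w - y) y; rewrite subrK; lra.
  rewrite expr1n divr1 (_ : t * _ = 8 * M * t ^+ 2); last by ring.
  rewrite ler_wpM2l ?mulr_ge0 //.
  by rewrite lerXn2r ?nnegrE ?rnorm_ge0 // ltW.
(* The quotients converge for fixed t, within O(t) of the differentials. *)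
have lim : ucvg G (fun b => D (k b) P b) (D h P x).
  move=> d d0; have M1 : 0 < 32 * (M + 1) by lra.
  pose t := Num.min (2^-1) (d / (32 * (M + 1))).
  have t0 : 0 < t by rewrite lt_min invr_gt0 ltr0n divr_gt0.
  have t1 : t < 1 by rewrite gt_min invf_lt1 ?ltr1n.
  have t01 : 0 < t < 1 by rewrite t0.
  have tM : 8 * M * t <= d / 4.
    have : t * (32 * (M + 1)) <= d by rewrite -ler_pdivlMr // ge_min lexx orbT.
    lra.
  have Plim : ucvg G (fun b => P (b + t%:C *: k b)) (P (x + t%:C *: h)).
    apply: (weak_limit_entire oU bU MD (r := 1 + t) UG) => //.
      apply: filterS2 G1 Gk => b /= b1 k1; apply: le_trans (rnormD _ _) _.
      by rewrite lerD // rnormZR ?(ltW t0) // ler_piMr // ltW.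
    move=> g; rewrite (linD _ _ (dual_lin g)) (linZ _ _ (dual_lin g)).
    have := ucvgD fG (xP _ (dual_entire g)) (ucvgZ t%:C fG (hP _ (dual_entire g))).
    congr ucvg; apply/funext => b.
    by rewrite (linD _ _ (dual_lin g)) (linZ _ _ (dual_lin g)).
  have d4 : 0 < d / 4 by lra.
  have Qlim := ucvgZ t%:C^-1 fG (ucvgB fG Plim (xP P eP)).
  apply: filterS2 (Qlim _ d4) G1 => b /= q b1.
  have bx : rnorm b <= rnorm x + 1 by have := rnorm_ge0 x; lra.
  have xx : rnorm x <= rnorm x + 1 by lra.
  have q1 := quot b (k b) t bx (kP b).1 t01.
  have q2 := quot x h t xx h1 t01.
  set A := _^-1 * _ in q q1; set B := _^-1 * _ in q q2.
  rewrite (_ : _ - _ = - (A - D (k b) P b) + (A - B) + (B - D h P x)); last by ring.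
  apply: le_lt_trans (le_normcD _ _) _.
  have := le_normcD (- (A - D (k b) P b)) (A - B); rewrite normcN; lra.
have lim' : ucvg G (fun b => D (k b) P x) (D h P x) := hP _ (dual_entire (diff_dual eP x)).
have far : G [set b | ~ dual_le (diff_dual eP b - diff_dual eP x) e].
  by apply: FG; exists [:: diff_dual eP x] => // b [_]; apply; rewrite mem_head.
have := ucvgB fG lim lim'; rewrite subrr => /(_ e e0) near.
have [b [/= bn bf]] := filter_ex (filterI near far).
have := (kP b).2 bf; rewrite subr0 in bn; lra.
Qed.

Hypothesis apE : approximation_property E.

(** Euler's identity expresses P through its differentials, which a finite rank
operator approximates by functionals times derivatives of smaller degree. *)
Lemma homog_approximable n P : entire_bt P -> homog n P -> approximable (P : E -> R[i]^o).
Proof.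
elim: n P => [|n IH] P eP hP.
  rewrite (_ : P = fun=> P 0); first exact: approximable_cst.
  by apply/funext => x; rewrite -[in RHS](scale0r x) hP expr0 mul1r.
apply: approximable_near => e e0.
have rE := characters_reflexive oU bU MD.
have [s sP] := totally_bounded_approx rE apE (differentials_totally_bounded eP) e0.
exists (fun x => n.+1%:R^-1 * \sum_(p <- s) p.1 x * D p.2 P x).
  apply: approximable_scale; apply: approximable_sum => p.
  apply: approximable_dualM; apply: IH; [exact: entire_bt_D|exact: homog_D].
move=> x x1; have := sP (diff_dual eP x) x (ex_intro2 _ _ x x1 erefl) x1.
have nC : n.+1%:R != 0 :> R[i] by rewrite pnatr_eq0.
have -> : diff_dual eP x x = n.+1%:R * P x by exact: homog_euler.
have -> : diff_dual eP x (frk s x) = \sum_(p <- s) p.1 x * D p.2 P x.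
  have lk := dual_lin (diff_dual eP x).
  rewrite /frk (big_morph (diff_dual eP x) (fun u v => linD u v lk) (lin0 lk)).
  by apply: eq_bigr => p _; rewrite (linZ _ _ lk).
move=> near; rewrite -[P x](mulKf nC) -mulrBr normcM.
apply: le_trans near; rewrite ler_piMl ?normc_ge0 // normcV.
have -> : n.+1%:R = n.+1%:R%:C :> R[i] by rewrite rmorph_nat.
by rewrite ger0_normcR // invf_le1 ?ler1n // ltr0n.
Qed.

Lemma characters_Tsirelson_like : Tsirelson_like E.
Proof.
split; first exact: characters_reflexive oU bU MD.
move=> P /continuous_polynomial_homog[n [Q [QP PE]]].
rewrite (_ : P = fun x => \sum_(k <- enum 'I_n) Q k x); last first.
  by apply/funext => x; rewrite PE big_enum.
by apply: approximable_sum => k; have [eQ hQ] := QP k; exact: homog_approximable eQ hQ.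
Qed.

End forward.

Theorem theorem4p1 (R : realType) (E : completeNormedModType R[i]) (U : set E) :
  approximation_property E -> open U -> balanced_set U ->
  (Mb U = delta U <-> Hb_convex U /\ Tsirelson_like E).
Proof.
move=> apE oU bU; split=> [MD|[cU tE]].
  have {}MD phi : Mb U phi -> delta U phi by rewrite MD.
  by split; [exact: characters_hull_convex|exact: (characters_Tsirelson_like oU bU MD)].
apply/seteqP; split; last exact: delta_sub_Mb.
by move=> phi Mphi; have [A uA dA] := Mb_dominated oU Mphi; exact: Mb_delta Mphi uA dA.
Qed.
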